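(* Let $(A,\rho,[\cdot,\cdot])$ be a regular almost Lie algebroid over a smooth manifold $M$, let $F=\ker\rho$, and let $C^n=\bigoplus_{p+2q=n}\Gamma(\wedge^pA^*\otimes S^qF^* )$. With $D,\hat J,\hat\delta\colon C^\bullet\to C^{\bullet+1}$ the maps defined in the context, the map $$\mathrm{d}:=D+\hat J+\hat\delta$$ maps $C^n\to C^{n+1}$ for every $n$, satisfies the Leibniz rule $\mathrm{d}(\gamma_1\gamma_2)=\mathrm{d}(\gamma_1)\gamma_2+(-1)^{|\gamma_1|}\gamma_1\,\mathrm{d}(\gamma_2)$ for all homogeneous $\gamma_1\in C^{|\gamma_1|}$ and all $\gamma_2\in C^\bullet$, and satisfies $\mathrm{d}^2=0$.
   Context: An almost Lie algebroid $(A,\rho,[\cdot,\cdot])$ over a smooth manifold $M$ is a (real, finite rank, smooth) vector bundle $A\to M$ together with an $\mathbb{R}$-bilinear skew-symmetric bracket $[\cdot,\cdot]$ on $\Gamma(A)$ and a vector bundle morphism $\rho\colon A\to TM$ (the anchor) such that for all $\phi,\psi\in\Gamma(A)$, $f\in C^\infty(M)$: $[\phi,f\psi]=\rho(\phi)[f]\,\psi+f[\phi,\psi]$ and $\rho([\phi,\psi])=[\rho(\phi),\rho(\psi)]$. The Jacobi identity is not assumed. It is regular if $\operatorname{im}\rho\subset TM$ is a vector bundle (constant rank), so that $F:=\ker\rho\subset A$ is a vector subbundle; $t\colon F\hookrightarrow A$ is the inclusion and $t^*\colon A^*\to F^*$ its transpose. Jacobiator: $J(\phi,\psi,\chi)=[\phi,[\psi,\chi]]+[\psi,[\chi,\phi]]+[\chi,[\phi,\psi]]$.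 It is $C^\infty(M)$-trilinear, alternating and takes values in $F$, so $J\in\Gamma(\wedge^3A^*\otimes F)$. Cochains: $C^n=\bigoplus_{p+2q=n}\Gamma(\wedge^pA^*\otimes S^qF^* )$; $C^\bullet$ is a graded commutative associative algebra generated by $C^\infty(M)$ (degree 0), $\Gamma(A^* )$ (degree 1) and $\Gamma(F^* )$ (degree 2). $|\gamma|$ denotes the degree. Convention: $(\alpha_1\wedge\alpha_2)(\psi_1,\psi_2)=\alpha_1(\psi_1)\alpha_2(\psi_2)-\alpha_1(\psi_2)\alpha_2(\psi_1)$. An odd derivative is an $\mathbb{R}$-linear map $X\colon C^\bullet\to C^{\bullet+1}$ with $X(\gamma_1\gamma_2)=X(\gamma_1)\gamma_2+(-1)^{|\gamma_1|}\gamma_1X(\gamma_2)$; it is determined by its values on generators $f\in C^\infty(M)$, $\alpha\in\Gamma(A^* )$, $\beta\in\Gamma(F^* )$. $D$: for $\phi\in\Gamma(A)$, $v\in\Gamma(F)$, $\nabla_\phi v\in\Gamma(F)$ is defined by $t(\nabla_\phi v)=[\phi,t(v)]$; it is extended to $F^*$ by $\langle\nabla_\phi\beta,v\rangle=\rho(\phi)[\langle\beta,v\rangle]-\langle\beta,\nabla_\phi v\rangle$ and to $S^\bullet F^*$ by the Leibniz rule $\nabla_\phi(\beta_1\beta_2)=(\nabla_\phi\beta_1)\beta_2+\beta_1\nabla_\phi\beta_2$ (with $\nabla_\phi f=\rho(\phi)[f]$ on functions). For $\alpha\in\Gamma(\wedge^pA^*\otimes S^qF^* )$, $$D\alpha(\psi_0,\dots,\psi_p)=\sum_{i=0}^p(-1)^i\nabla_{\psi_i}\big(\alpha(\psi_0,\dots,\hat\psi_i,\dots,\psi_p)\big)+\sum_{i<j}(-1)^{i+j}\alpha([\psi_i,\psi_j],\psi_0,\dots,\hat\psi_i,\dots,\hat\psi_j,\dots,\psi_p).$$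 $D$ is an odd derivative. $\hat\delta$: the odd derivative with $\hat\delta(f)=0$, $\hat\delta(\alpha)=t^*\alpha\in\Gamma(F^* )$, $\hat\delta(\beta)=0$; e.g. $\hat\delta(\alpha_1\wedge\alpha_2\otimes\beta)=\alpha_2\otimes t^*(\alpha_1)\beta-\alpha_1\otimes t^*(\alpha_2)\beta$. $\hat J$: the odd derivative with $\hat J(f)=0$, $\hat J(\alpha)=0$, $\hat J(\beta)=\langle\beta,J(\cdot,\cdot,\cdot)\rangle\in\Gamma(\wedge^3A^* )$; thus $\hat J(\alpha\otimes\beta)=(-1)^p\alpha\wedge\langle\beta,J\rangle$ for $\alpha\in\Gamma(\wedge^pA^* )$. *)

(* Defs.v *)
From Stdlib Require List.
From HB Require Import structures.
From mathcomp Require Import all_boot all_order all_algebra.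
From mathcomp Require Import all_classical all_reals.
From mathcomp Require Import topology normedtype landau derive.

Set Implicit Arguments.
Unset Strict Implicit.
Unset Printing Implicit Defensive.

Import Order.TTheory GRing.Theory Num.Theory.
Import numFieldNormedType.Exports.

Local Open Scope classical_set_scope.
Local Open Scope ring_scope.

(* The element singled out by the property P (an arbitrary x0 if P is never
   satisfied).  It renders the definite descriptions below. *)
Definition the (T : Type) (x0 : T) (P : T -> Prop) : T :=
  if pselect (exists x, P x) is left h then projT1 (cid h) else x0.

Section SmoothFunctions.
Variables (R : realType) (n : nat).

(* f is of class C^k on the open set V of R^n, with f and its iterated
   Frechet derivatives tested against constant directions. *)
Fixpoint class_C (k : nat) (V : set 'rV[R]_n) (f : 'rV[R]_n -> R) : Prop :=
  match k with
  | 0 => forall y, V y -> {for y, continuous f}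
  | k'.+1 => (forall y, V y -> differentiable f y) /\
             (forall v, class_C k' V (fun y => 'd f y v))
  end.

Definition class_Coo (V : set 'rV[R]_n) (f : 'rV[R]_n -> R) :=
  forall k, class_C k V f.

End SmoothFunctions.

(* Smooth n-dimensional manifolds, given by a smooth atlas.  Outside of
   [cdom i] (resp. of its image) the values of [cmap i] (resp. [cinv i]) are
   meaningless.  [chart_at x] is a preferred chart at x. *)
Record manifold (R : realType) (n : nat) := Manifold {
  mpoint :> topologicalType;
  m_hausdorff : hausdorff_space mpoint;
  m_second_countable : @second_countable mpoint;
  chart : Type;
  cdom : chart -> set mpoint;
  cmap : chart -> mpoint -> 'rV[R]_n;
  cinv : chart -> 'rV[R]_n -> mpoint;
  chart_at : mpoint -> chart;
  chart_atP : forall x, cdom (chart_at x) x;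
  cdom_open : forall i, open (cdom i);
  cimg_open : forall i, open (cmap i @` cdom i);
  cmapK : forall i x, cdom i x -> cinv i (cmap i x) = x;
  cmap_continuous : forall i x, cdom i x -> {for x, continuous (cmap i)};
  cinv_continuous : forall i y, (cmap i @` cdom i) y ->
    {for y, continuous (cinv i)};
  chart_compat : forall i k (j : 'I_n),
    class_Coo (cmap i @` (cdom i `&` cdom k)) (fun y => cmap k (cinv i y) 0 j)
}.

Section Manifold.
Variables (R : realType) (n : nat) (M : manifold R n).

(* Smoothness on an open set U of M; C^oo(M) is the case U = setT. *)
Definition smooth_on (U : set M) (f : M -> R) :=
  forall i : chart M,
    class_Coo (cmap i @` (U `&` cdom i)) (fun y => f (cinv i y)).

Definition smooth (f : M -> R) := smooth_on setT f.

(* The tangent space T_x M is R^n, a vector being identified with its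
   coordinates in the preferred chart at x. *)
Definition tangent (x : M) : vectType R := 'rV[R]_n.

(* The derivative v[f]. *)
Definition vder (x : M) (v : tangent x) (f : M -> R) : R :=
  'd (fun y : 'rV[R]_n => f (cinv (chart_at x) y)) (cmap (chart_at x) x)
    (v : 'rV[R]_n).

(* The coordinates of v in the chart i. *)
Definition tcoord (i : chart M) (x : M) (v : tangent x) : 'rV[R]_n :=
  'd (fun y : 'rV[R]_n => cmap i (cinv (chart_at x) y)) (cmap (chart_at x) x)
    (v : 'rV[R]_n).

Definition smooth_vfield_on (U : set M) (X : forall x, tangent x) :=
  forall (i : chart M) (j : 'I_n),
    smooth_on (U `&` cdom i) (fun x => tcoord i (X x) 0 j).

End Manifold.

(* Smooth real vector bundles: a family of vector spaces with local
   trivializations whose transition matrices are smooth. *)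
Record vector_bundle (R : realType) (n : nat) (M : manifold R n) :=
  VectorBundle {
  fiber :> M -> vectType R;
  vb_rank : nat;
  triv : Type;
  tdom : triv -> set M;
  tmap : triv -> forall x, 'Hom(fiber x, 'rV[R]_vb_rank);
  tdom_open : forall k, open (tdom k);
  tdom_cover : forall x, exists k, tdom k x;
  tmap_bij : forall k x, tdom k x -> bijective (tmap k x);
  triv_compat : forall k l, exists g : M -> 'M[R]_vb_rank,
    (forall i j, smooth_on (tdom k `&` tdom l) (fun x => g x i j)) /\
    (forall x, (tdom k `&` tdom l) x ->
       forall a, tmap l x a = tmap k x a *m g x)
}.

Section Sections.
Variables (R : realType) (n : nat) (M : manifold R n) (E : vector_bundle M).

(* Not necessarily smooth sections. *)
Definition sect := forall x, E x.

Definition smooth_sect_on (U : set M) (s : sect) :=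
  forall (k : triv E) (j : 'I_(vb_rank E)),
    smooth_on (U `&` tdom k) (fun x => tmap k x (s x) 0 j).

Definition smooth_sect (s : sect) := smooth_sect_on setT s.

Definition lin_sect (a : R) (s1 s2 : sect) : sect :=
  fun x => a *: s1 x + s2 x.

Definition scale_sect (f : M -> R) (s : sect) : sect := fun x => f x *: s x.

End Sections.

(* Only the values of [br] on smooth sections matter.  [br_anchor] is the
   equality rho([phi,psi]) = [rho(phi),rho(psi)] of vector fields, the Lie
   bracket of X and Y being given by [X,Y][f] = X[Y[f]] - Y[X[f]]. *)
Record almost_Lie_algebroid (R : realType) (n : nat) (M : manifold R n) :=
  AlmostLieAlgebroid {
  abundle :> vector_bundle M;
  anchor : forall x, 'Hom(abundle x, tangent x);
  br : sect abundle -> sect abundle -> sect abundle;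
  anchor_smooth : forall (U : set M) (phi : sect abundle), open U ->
    smooth_sect_on U phi -> smooth_vfield_on U (fun x => anchor x (phi x));
  br_smooth : forall phi psi, smooth_sect phi -> smooth_sect psi ->
    smooth_sect (br phi psi);
  br_linear : forall a phi psi chi,
    smooth_sect phi -> smooth_sect psi -> smooth_sect chi ->
    br (lin_sect a phi psi) chi = lin_sect a (br phi chi) (br psi chi);
  br_skew : forall phi psi, smooth_sect phi -> smooth_sect psi ->
    br psi phi = (fun x => - br phi psi x);
  br_Leibniz : forall phi psi f,
    smooth_sect phi -> smooth_sect psi -> smooth f ->
    br phi (scale_sect f psi) =
    (fun x => vder (anchor x (phi x)) f *: psi x + f x *: br phi psi x);
  br_anchor : forall phi psi f x,
    smooth_sect phi -> smooth_sect psi -> smooth f ->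
    vder (anchor x (br phi psi x)) f =
    vder (anchor x (phi x)) (fun y => vder (anchor y (psi y)) f) -
    vder (anchor x (psi x)) (fun y => vder (anchor y (phi y)) f)
}.

Section Algebroid.
Variables (R : realType) (n : nat) (M : manifold R n).
Variable A : almost_Lie_algebroid M.

(* im rho has constant rank *)
Definition regular := exists r : nat, forall x, \dim (limg (anchor A x)) = r.

Definition kerF (x : M) : vectType R := subvs_of (lker (anchor A x)).

Definition sectF := forall x, kerF x.

Definition incl (x : M) (v : kerF x) : A x := vsval v.

(* The inverse of [incl] on the kernel of the anchor. *)
Definition toF (x : M) (a : A x) : kerF x := vsproj (lker (anchor A x)) a.

Definition t_sect (v : sectF) : sect A := fun x => incl (v x).

Definition smooth_sectF_on (U : set M) (v : sectF) := smooth_sect_on U (t_sect v).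

Definition smooth_sectF (v : sectF) := smooth_sectF_on setT v.

(* rho(phi)[f] *)
Definition rho_der (phi : sect A) (f : M -> R) : M -> R :=
  fun x => vder (anchor A x (phi x)) f.

Definition nabla (phi : sect A) (v : sectF) : sectF :=
  fun x => toF (br phi (t_sect v) x).

Definition Jacobiator (phi psi chi : sect A) : sect A := fun x =>
  br phi (br psi chi) x + br psi (br chi phi) x + br chi (br phi psi) x.

(* Cochains.  An element of wedge^p A_x^* (x) S^q F_x^* is represented as a
   (p+q)-linear form which is alternating in p arguments in A_x and symmetric
   in q arguments in F_x.  An inhomogeneous cochain is a single function which
   takes the two lists of arguments, p and q being their lengths. *)
Definition cform := forall x : M, seq (A x) -> seq (kerF x) -> R.

Definition evs (ps : seq (sect A)) (x : M) : seq (A x) :=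
  [seq p x | p <- ps].

Definition evsF (vs : seq sectF) (x : M) : seq (kerF x) :=
  [seq v x | v <- vs].

Definition multilinear (g : cform) :=
  (forall x (k : R) (a b : A x) s1 s2 vs,
     g x (s1 ++ (k *: a + b) :: s2) vs =
     k * g x (s1 ++ a :: s2) vs + g x (s1 ++ b :: s2) vs) /\
  (forall x (k : R) (a b : kerF x) ps s1 s2,
     g x ps (s1 ++ (k *: a + b) :: s2) =
     k * g x ps (s1 ++ a :: s2) + g x ps (s1 ++ b :: s2)).

Definition alternating (g : cform) :=
  forall x (a : A x) s1 s2 s3 vs, g x (s1 ++ a :: s2 ++ a :: s3) vs = 0.

Definition symmetric_form (g : cform) :=
  forall x ps (vs ws : seq (kerF x)), perm_eq vs ws -> g x ps vs = g x ps ws.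

Definition smooth_form (g : cform) :=
  forall (U : set M) (ps : seq (sect A)) (vs : seq sectF), open U ->
    (forall i, (i < size ps)%N -> smooth_sect_on U (nth (fun=> 0) ps i)) ->
    (forall i, (i < size vs)%N -> smooth_sectF_on U (nth (fun=> 0) vs i)) ->
    smooth_on U (fun x => g x (evs ps x) (evsF vs x)).

Definition concentrated_in (P : nat -> nat -> bool) (g : cform) :=
  forall x ps vs, ~~ P (size ps) (size vs) -> g x ps vs = 0.

(* C^. (the bound N expresses that elements of a direct sum have finitely many
   components) and C^k. *)
Definition cochain (g : cform) :=
  [/\ multilinear g, alternating g, symmetric_form g, smooth_form g &
      exists N, concentrated_in (fun p q => p + 2 * q <= N)%N g].

Definition cochain_deg (k : nat) (g : cform) :=
  cochain g /\ concentrated_in (fun p q => p + 2 * q == k)%N g.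

Definition form0 : cform := fun _ _ _ => 0.

Definition form_add (g1 g2 : cform) : cform :=
  fun x ps vs => g1 x ps vs + g2 x ps vs.

Definition form_scale (a : R) (g : cform) : cform :=
  fun x ps vs => a * g x ps vs.

(* The ways of splitting a list into two complementary subsequences, with the
   number of transpositions needed to move the first one in front. *)
Fixpoint unshuffles (T : Type) (s : seq T) : seq (nat * (seq T * seq T)) :=
  if s is a :: s' then
    [seq (u.1, (a :: u.2.1, u.2.2)) | u <- unshuffles s'] ++
    [seq ((u.1 + size u.2.1)%N, (u.2.1, a :: u.2.2)) | u <- unshuffles s']
  else [:: (0%N, ([::], [::]))].

(* The product of C^.: on A it is the wedge product of the convention
   (a1 /\ a2)(p1, p2) = a1(p1) a2(p2) - a1(p2) a2(p1), and on F it is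
   (b1 b2)(v1, v2) = b1(v1) b2(v2) + b1(v2) b2(v1). *)
Definition form_mul (g1 g2 : cform) : cform := fun x ps vs =>
  \sum_(u <- unshuffles ps) \sum_(w <- unshuffles vs)
    (-1) ^+ u.1 * (g1 x u.2.1 w.2.1 * g2 x u.2.2 w.2.2).

(* The generators of C^. *)
Definition dual_sect (alpha : forall x, A x -> R) :=
  (forall x k a b, alpha x (k *: a + b) = k * alpha x a + alpha x b) /\
  (forall (U : set M) (psi : sect A), open U -> smooth_sect_on U psi ->
     smooth_on U (fun x => alpha x (psi x))).

Definition dual_sectF (beta : forall x, kerF x -> R) :=
  (forall x k v w, beta x (k *: v + w) = k * beta x v + beta x w) /\
  (forall (U : set M) (v : sectF), open U -> smooth_sectF_on U v ->
     smooth_on U (fun x => beta x (v x))).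

Definition gen_fun (f : M -> R) : cform := fun x ps vs =>
  if (ps, vs) is ([::], [::]) then f x else 0.

Definition gen_A (alpha : forall x, A x -> R) : cform := fun x ps vs =>
  if (ps, vs) is ([:: a], [::]) then alpha x a else 0.

Definition gen_F (beta : forall x, kerF x -> R) : cform := fun x ps vs =>
  if (ps, vs) is ([::], [:: v]) then beta x v else 0.

Definition t_dual (alpha : forall x, A x -> R) : forall x, kerF x -> R :=
  fun x v => alpha x (incl v).

Definition odd_derivative (X : cform -> cform) :=
  [/\ forall k g, cochain_deg k g -> cochain_deg k.+1 (X g),
      forall a g1 g2, cochain g1 -> cochain g2 ->
        X (form_add (form_scale a g1) g2) =
        form_add (form_scale a (X g1)) (X g2) &
      forall k g1 g2, cochain_deg k g1 -> cochain g2 ->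
        X (form_mul g1 g2) =
        form_add (form_mul (X g1) g2)
                 (form_scale ((-1) ^+ k) (form_mul g1 (X g2)))].

(* An odd derivative matters only through its values on cochains, where it is
   determined by its values on the generators. *)
Definition is_hatdelta (X : cform -> cform) :=
  [/\ odd_derivative X,
      forall f, smooth f -> X (gen_fun f) = form0,
      forall alpha, dual_sect alpha -> X (gen_A alpha) = gen_F (t_dual alpha) &
      forall beta, dual_sectF beta -> X (gen_F beta) = form0].

Definition hatdelta : cform -> cform := the id is_hatdelta.

(* g is the 3-form <beta, J> *)
Definition is_pairing_J (beta : forall x, kerF x -> R) (g : cform) :=
  concentrated_in (fun p q => (p == 3) && (q == 0))%N g /\
  forall phi psi chi x,
    smooth_sect phi -> smooth_sect psi -> smooth_sect chi ->
    g x [:: phi x; psi x; chi x] [::] =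
    beta x (toF (Jacobiator phi psi chi x)).

Definition is_hatJ (X : cform -> cform) :=
  [/\ odd_derivative X,
      forall f, smooth f -> X (gen_fun f) = form0,
      forall alpha, dual_sect alpha -> X (gen_A alpha) = form0 &
      forall beta, dual_sectF beta -> is_pairing_J beta (X (gen_F beta))].

Definition hatJ : cform -> cform := the id is_hatJ.

(* Sections of S^. F^*, and the extension of nabla to them.  On symmetric forms
   the Leibniz rule (lemma [nablaS_mul] below) amounts to
   (nabla_phi s)(v_1,...,v_q) = rho(phi)[s(v_1,...,v_q)]
                        - sum_j s(v_1,...,nabla_phi v_j,...,v_q). *)
Definition symF := forall x : M, seq (kerF x) -> R.

Definition nablaS (phi : sect A) (s : symF) (vs : seq sectF) : M -> R :=
  fun x =>
    rho_der phi (fun y => s y (evsF vs y)) x -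
    \sum_(j < size vs)
      s x (evsF (set_nth (fun=> 0) vs j (nabla phi (nth (fun=> 0) vs j))) x).

Definition symF_mul (s1 s2 : symF) : symF := fun x vs =>
  \sum_(w <- unshuffles vs) s1 x w.2.1 * s2 x w.2.2.

Lemma unshuffles_map (T T' : Type) (f : T -> T') (s : seq T) :
  unshuffles (map f s) =
  [seq (u.1, (map f u.2.1, map f u.2.2)) | u <- unshuffles s].
Proof.
elim: s => //= a s ->; rewrite map_cat -!map_comp; congr (_ ++ _).
by apply: eq_map => u /=; rewrite size_map.
Qed.

Lemma sum_unshuffles_upd (T : Type) (d : T) (h : T -> T) (s : seq T)
    (G : seq T -> seq T -> R) :
  let upd (j : nat) s := set_nth d s j (h (nth d s j)) in
  \sum_(j < size s) \sum_(u <- unshuffles (upd j s)) G u.2.1 u.2.2 =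
  \sum_(u <- unshuffles s)
    (\sum_(j < size u.2.1) G (upd j u.2.1) u.2.2 +
     \sum_(j < size u.2.2) G u.2.1 (upd j u.2.2)).
Proof.
move=> upd; elim: s G => [|a s IH] G.
  by rewrite big_ord0 big_seq1 /= !big_ord0 addr0.
have E j : \sum_(u <- unshuffles (upd j.+1 (a :: s))) G u.2.1 u.2.2 =
    \sum_(u <- unshuffles (upd j s)) G (a :: u.2.1) u.2.2 +
    \sum_(u <- unshuffles (upd j s)) G u.2.1 (a :: u.2.2).
  by rewrite /= big_cat !big_map.
have E0 : \sum_(u <- unshuffles (upd 0%N (a :: s))) G u.2.1 u.2.2 =
    \sum_(u <- unshuffles s) G (h a :: u.2.1) u.2.2 +
    \sum_(u <- unshuffles s) G u.2.1 (h a :: u.2.2).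
  by rewrite /= big_cat !big_map.
rewrite big_ord_recl [X in X + _]E0.
rewrite (eq_bigr _ (fun (j : 'I_(size s)) _ => E j)) big_split /=.
rewrite (IH (fun p q => G (a :: p) q)) (IH (fun p q => G p (a :: q))).
rewrite big_cat !big_map /= addrACA.
congr (_ + _); rewrite -big_split; apply: eq_bigr => u _ /=.
  by rewrite big_ord_recl /= addrA.
by rewrite big_ord_recl /= addrCA.
Qed.

Lemma smooth_differentiable (f : M -> R) (x : M) : smooth f ->
  differentiable (fun y => f (cinv (chart_at x) y)) (cmap (chart_at x) x).
Proof.
move=> /(_ (chart_at x) 1%N) [+ _]; apply.
by exists x => //; split=> //; exact: chart_atP.
Qed.

Lemma rho_der_sum_mul (T : Type) (s : seq T) (f g : T -> M -> R)
    (phi : sect A) (x : M) :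
  List.Forall (fun u => smooth (f u) /\ smooth (g u)) s ->
  rho_der phi (fun y => \sum_(u <- s) f u y * g u y) x =
  \sum_(u <- s) (rho_der phi (f u) x * g u x + f u x * rho_der phi (g u) x).
Proof.
set c := chart_at x; set p := cmap c x; pose F u y := f u (cinv c y).
pose G u y := g u (cinv c y); pose S s y := \sum_(u <- s) F u y * G u y.
have Fx u : F u p = f u x by rewrite /F cmapK //; exact: chart_atP.
have Gx u : G u p = g u x by rewrite /G cmapK //; exact: chart_atP.
suff H : List.Forall (fun u => smooth (f u) /\ smooth (g u)) s ->
    differentiable (S s) p /\ forall v, 'd (S s) p v =
      \sum_(u <- s) ('d (F u) p v * G u p + F u p * 'd (G u) p v).
  move=> /H[_ HS]; rewrite /rho_der /vder -/c -/p [LHS]HS.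
  by apply: eq_bigr => u _; rewrite Fx Gx.
elim: s => [_|u s IH Hs].
  have -> : S [::] = cst 0 by apply/funext => y; rewrite /S big_nil.
  by split=> [|v]; [exact: differentiable_cst | rewrite diff_cst big_nil].
have [[/smooth_differentiable df /smooth_differentiable dg] /IH[dS ES]] :
    (smooth (f u) /\ smooth (g u)) /\
    List.Forall (fun u => smooth (f u) /\ smooth (g u)) s by inversion Hs.
have dM : differentiable (F u * G u) p.
  exact: differentiableM (df x) (dg x).
have -> : S (u :: s) = F u * G u + S s.
  by apply/funext => y; rewrite /S big_cons.
split=> [|v]; first exact: differentiableD.
rewrite big_cons (diffD dM dS) /= ES; congr (_ + _).
by rewrite (diffM (df x) (dg x)) /= addrC mulrC.
Qed.

Lemma nablaS_mul (phi : sect A) (s1 s2 : symF) (vs : seq sectF) (x : M) :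
  List.Forall (fun u => smooth (fun y => s1 y (evsF u.2.1 y)) /\
                        smooth (fun y => s2 y (evsF u.2.2 y)))
    (unshuffles vs) ->
  nablaS phi (symF_mul s1 s2) vs x =
  \sum_(u <- unshuffles vs)
    (nablaS phi s1 u.2.1 x * s2 x (evsF u.2.2 x) +
     s1 x (evsF u.2.1 x) * nablaS phi s2 u.2.2 x).
Proof.
move=> Hs; rewrite /nablaS.
have ev ws y : symF_mul s1 s2 (evsF ws y) =
    \sum_(u <- unshuffles ws) s1 y (evsF u.2.1 y) * s2 y (evsF u.2.2 y).
  by rewrite /symF_mul /evsF unshuffles_map big_map.
under eq_fun do rewrite ev.
rewrite (rho_der_sum_mul phi x Hs) (eq_bigr _ (fun (j : 'I_(size vs)) _ => ev _ x)).
rewrite (sum_unshuffles_upd (fun=> 0) (nabla phi) vs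
  (fun p q => s1 x (evsF p x) * s2 x (evsF q x))) -sumrB.
apply: eq_bigr => u _; rewrite mulrBl mulrBr mulr_suml mulr_sumr.
by rewrite opprD addrACA.
Qed.

Definition rem_at (T : Type) (i : nat) (s : seq T) : seq T :=
  take i s ++ drop i.+1 s.

(* The value of D g at the sections ps = (psi_0, ..., psi_p) of A and
   vs = (v_1, ..., v_q) of F. *)
Definition D_formula (g : cform) (ps : seq (sect A)) (vs : seq sectF) (x : M) :
    R :=
  let psi i := nth (fun=> 0) ps i in
  \sum_(i < size ps) (-1) ^+ i *
     nablaS (psi i) (fun y => g y (evs (rem_at i ps) y)) vs x +
  \sum_(j < size ps) \sum_(i < j) (-1) ^+ (i + j) *
     g x (evs (br (psi i) (psi j) :: rem_at i (rem_at j ps)) x) (evsF vs x).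

Definition is_D (g h : cform) :=
  cochain h /\
  forall ps vs x,
    (forall i, (i < size ps)%N -> smooth_sect (nth (fun=> 0) ps i)) ->
    (forall i, (i < size vs)%N -> smooth_sectF (nth (fun=> 0) vs i)) ->
    h x (evs ps x) (evsF vs x) = D_formula g ps vs x.

Definition D (g : cform) : cform := the form0 (is_D g).

Definition dd (g : cform) : cform :=
  form_add (form_add (D g) (hatJ g)) (hatdelta g).

End Algebroid.

(* Main.v *)
Require Import Defs.
From HB Require Import structures.
From mathcomp Require Import all_boot all_order all_algebra.
From mathcomp Require Import ring zify.
From mathcomp Require Import all_classical all_reals.
From mathcomp Require Import topology normedtype landau derive sequences realfun.
From mathcomp Require Import exp interval_inference.

Set Implicit Arguments.
Unset Strict Implicit.
Unset Printing Implicit Defensive.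

Import Order.TTheory GRing.Theory Num.Theory.
Import numFieldNormedType.Exports.

Local Open Scope classical_set_scope.
Local Open Scope ring_scope.

(* Over the ring C of smooth functions, the smooth sections of A and of F form
   modules SA and SF, and C^. is identified with the C-multilinear forms on SA and
   SF which are alternating in SA and symmetric in SF.  There D, J^ and delta^ are
   given by recursion on the list of arguments in SA: Cartan's formula
   i_a D = L_a - D i_a and its analogues with J and t.  Since a recursively defined
   operator whose steps are derivations is a derivation, each of them is odd.
   The square of d = D + J^ + delta^ is then a derivation, and it vanishes on the
   generators: on functions because rho is compatible with the brackets, on
   Gamma(A^* ) because the Jacobiator appears with opposite signs in D^2 and in
   J^ delta^, on Gamma(F^* ) by the formula for the curvature of nabla and by the
   second Bianchi identity D J = 0.  Locally, up to a bump function, A and F have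
   dual bases, so by Euler's identity a derivation is determined by its values on
   generators; this gives d^2 = 0 and also identifies J^ and delta^ with the
   operators above. *)

(** The obstacle is that D differentiates: it is not linear over functions, so nothing can be
    computed inside one fibre. This forces the detour through global sections. On lists of sections
    D is a plain recursion, and fibres are recovered by extending vectors to sections ([extA],
    [extF]) and by tensoriality ([tens_ev]). The operators are defined on all functions of two
    lists, tensorial or not. Their derivation property is then pure combinatorics of unshuffles,
    while tensoriality is a separate check in which the derivatives of the coefficients must cancel.
    Since [D], [hatJ] and [hatdelta] are introduced by descriptions, each has to be identified with
    its recursive operator on cochains: [D] from its formula, the other two from their values on
    generators. Regularity enters through a smooth projector onto ker rho, which supplies local
    generators of F with coordinates. Local statements are combined through functions [chiM x] that
    do not vanish at x: a function whose product with each of them is zero is itself zero. *)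

(* Identities in abelian groups, by reflection. *)
Inductive zterm := ZVar of nat | ZZero | ZAdd of zterm & zterm | ZOpp of zterm.

Section ZTerm.
Variable V : zmodType.

Fixpoint zeval (e : seq V) (t : zterm) : V :=
  match t with
  | ZVar i => nth 0 e i
  | ZZero => 0
  | ZAdd t1 t2 => zeval e t1 + zeval e t2
  | ZOpp t1 => - zeval e t1
  end.

Fixpoint zcoef (t : zterm) (i : nat) : int :=
  match t with
  | ZVar j => (j == i)%:Z
  | ZZero => 0
  | ZAdd t1 t2 => zcoef t1 i + zcoef t2 i
  | ZOpp t1 => - zcoef t1 i
  end.

Lemma zevalE (e : seq V) (t : zterm) :
  zeval e t = \sum_(i < size e) e`_i *~ zcoef t i.
Proof.
elim: t => [i||t1 IH1 t2 IH2|t IH] /=.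
- have [lt_ie|le_ei] := ltnP i (size e); last first.
    rewrite nth_default// big1// => j _; case: eqP => [ij|]; last by rewrite mulr0z.
    by have := ltn_ord j; rewrite -ij ltnNge le_ei.
  rewrite (bigD1 (Ordinal lt_ie))//= eqxx big1 ?addr0// => j ji.
  by case: eqP => [ij|]; rewrite ?mulr0z//; case/eqP: ji; apply: val_inj.
- by rewrite big1// => i _; rewrite mulr0z.
- by rewrite IH1 IH2 -big_split; apply: eq_bigr => i _; rewrite mulrzDr.
- by rewrite IH -sumrN; apply: eq_bigr => i _; rewrite mulrNz.
Qed.

(** A term is the sum of its atoms weighted by integer coefficients, so equality of coefficients, a
    computation in [int], suffices. This serves identities between sections and between forms, where
    only the additive structure is involved. *)
Lemma zmod_eqP (e : seq V) (t1 t2 : zterm) :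
  all (fun i => zcoef t1 i == zcoef t2 i) (iota 0 (size e)) ->
  zeval e t1 = zeval e t2.
Proof.
move=> /allP E; rewrite !zevalE; apply: eq_bigr => i _.
by rewrite (eqP (E i _))// mem_iota add0n ltn_ord.
Qed.

End ZTerm.

Ltac zindex e x k :=
  lazymatch e with
  | cons ?y ?e' => first [ first [constr_eq x y | unify x y]; k O |
                           zindex e' x ltac:(fun i => k (S i)) ]
  end.
Ltac zatoms e t k :=
  lazymatch t with
  | (?a + ?b)%R => zatoms e a ltac:(fun e' => zatoms e' b k)
  | (- ?a)%R => zatoms e a k
  | 0%R => k e
  | _ => first [ zindex e t ltac:(fun _ => k e) | k (cons t e) ]
  end.
Ltac zreify e t k :=
  lazymatch t with
  | (?a + ?b)%R => zreify e a ltac:(fun a' => zreify e b ltac:(fun b' => k (ZAdd a' b')))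
  | (- ?a)%R => zreify e a ltac:(fun a' => k (ZOpp a'))
  | 0%R => k ZZero
  | _ => zindex e t ltac:(fun i => k (ZVar i))
  end.
Ltac zmodule :=
  match goal with
  | |- @eq ?T ?x ?y =>
    zatoms (@nil T) x ltac:(fun e1 => zatoms e1 y ltac:(fun e =>
      zreify e x ltac:(fun tx => zreify e y ltac:(fun ty =>
        let H := fresh in
        (have H := @zmod_eqP _ e tx ty);
        (lapply H; [clear H; move=> H | vm_compute; reflexivity]);
        (cbn [zeval nth] in H); (refine (eq_trans (eq_trans _ H) _); reflexivity)))))
  end.

(** * Forms with arguments in two modules *)

Section Forms.
Variables (C : comPzRingType) (TA TF : Type).

(** No linearity or symmetry is built in: the operators below are defined, and shown to be
    derivations, on arbitrary functions of two lists. *)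
Definition sform := seq TA -> seq TF -> C.
Local Notation form := sform.

Implicit Types (G H : form) (c : C).

Definition insA (a : TA) G : form := fun ps vs => G (a :: ps) vs.
Definition insF (v : TF) G : form := fun ps vs => G ps (v :: vs).
Definition fscale c G : form := fun ps vs => c * G ps vs.
(** The parity automorphism. As p + 2q and p have the same parity, it multiplies a form of degree k
    by (-1)^k, so graded Leibniz rules can be stated for inhomogeneous forms. *)
Definition bar G : form := fun ps vs => (-1) ^+ size ps * G ps vs.
Definition sbar (e : bool) G : form := if e then bar G else G.

Definition fmul G H : form := fun ps vs =>
  \sum_(u <- unshuffles ps) \sum_(w <- unshuffles vs)
    (-1) ^+ u.1 * (G u.2.1 w.2.1 * H u.2.2 w.2.2).

Lemma formP G H : (forall ps vs, G ps vs = H ps vs) -> G = H.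
Proof. by move=> E; apply/funext => ps; apply/funext => vs. Qed.

Lemma addfE G H ps vs : (G + H) ps vs = G ps vs + H ps vs. Proof. by []. Qed.
Lemma oppfE G ps vs : (- G) ps vs = - G ps vs. Proof. by []. Qed.
Lemma zerofE ps vs : (0 : form) ps vs = 0. Proof. by []. Qed.

Definition fE := (addfE, oppfE, zerofE).

Lemma insA_add a G H : insA a (G + H) = insA a G + insA a H. Proof. by []. Qed.
Lemma insF_add a G H : insF a (G + H) = insF a G + insF a H. Proof. by []. Qed.
Lemma insA_opp a G : insA a (- G) = - insA a G. Proof. by []. Qed.
Lemma insF_opp a G : insF a (- G) = - insF a G. Proof. by []. Qed.
Lemma insA_scale a c G : insA a (fscale c G) = fscale c (insA a G).
Proof. by []. Qed.
Lemma insF_scale a c G : insF a (fscale c G) = fscale c (insF a G).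
Proof. by []. Qed.
Lemma insF_bar a G : insF a (bar G) = bar (insF a G). Proof. by []. Qed.
Lemma insA_bar a G : insA a (bar G) = - bar (insA a G).
Proof. by apply: formP => ps vs; rewrite /insA /bar oppfE /= exprS; ring. Qed.

Lemma fscaleDr c G H : fscale c (G + H) = fscale c G + fscale c H.
Proof. by apply: formP => ps vs; rewrite /fscale !addfE mulrDr. Qed.
Lemma fscaleA c d G : fscale c (fscale d G) = fscale (c * d) G.
Proof. by apply: formP => ps vs; rewrite /fscale mulrA. Qed.
Lemma fscale1 G : fscale 1 G = G.
Proof. by apply: formP => ps vs; rewrite /fscale mul1r. Qed.
Lemma fscaleN1 G : fscale (-1) G = - G.
Proof. by apply: formP => ps vs; rewrite /fscale mulN1r. Qed.
Lemma fscale_bar c G : fscale c (bar G) = bar (fscale c G).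
Proof. by apply: formP => ps vs; rewrite /fscale /bar; ring. Qed.
Lemma barD G H : bar (G + H) = bar G + bar H.
Proof. by apply: formP => ps vs; rewrite /bar !addfE mulrDr. Qed.
Lemma barK G : bar (bar G) = G.
Proof. by apply: formP => ps vs; rewrite /bar mulrA -signr_odd -signr_addb addbb mul1r. Qed.

Lemma fmul_nil G H vs :
  fmul G H [::] vs = \sum_(w <- unshuffles vs) G [::] w.2.1 * H [::] w.2.2.
Proof.
by rewrite /fmul big_seq1; apply: eq_bigr => w _ /=; rewrite expr0 mul1r.
Qed.

Lemma fmul_nil2 G H : fmul G H [::] [::] = G [::] [::] * H [::] [::].
Proof. by rewrite fmul_nil big_seq1. Qed.

(** The head a goes to either half of an unshuffle. In the second case it has crossed the
    [size u.2.1] arguments of the first half, a sign which [bar] absorbs into G. *)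
Lemma insA_mul a G H :
  insA a (fmul G H) = fmul (insA a G) H + fmul (bar G) (insA a H).
Proof.
apply: formP => ps vs; rewrite addfE /insA /fmul /= big_cat !big_map /=.
congr (_ + _); apply: eq_bigr => u _; apply: eq_bigr => w _ /=.
by rewrite exprD /bar; ring.
Qed.

Lemma insF_mul v G H :
  insF v (fmul G H) = fmul (insF v G) H + fmul G (insF v H).
Proof.
apply: formP => ps vs; rewrite addfE /insF /fmul -big_split /=.
by apply: eq_bigr => u _; rewrite big_cat !big_map.
Qed.

Lemma fmulDl G1 G2 H : fmul (G1 + G2) H = fmul G1 H + fmul G2 H.
Proof.
apply: formP => ps vs; rewrite addfE /fmul -big_split /=.
apply: eq_bigr => u _; rewrite -big_split /=.
by apply: eq_bigr => w _; rewrite addfE; ring.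
Qed.

Lemma fmulDr G H1 H2 : fmul G (H1 + H2) = fmul G H1 + fmul G H2.
Proof.
apply: formP => ps vs; rewrite addfE /fmul -big_split /=.
apply: eq_bigr => u _; rewrite -big_split /=.
by apply: eq_bigr => w _; rewrite addfE; ring.
Qed.

Lemma fmulZl c G H : fmul (fscale c G) H = fscale c (fmul G H).
Proof.
apply: formP => ps vs; rewrite /fscale /fmul mulr_sumr.
apply: eq_bigr => u _; rewrite mulr_sumr.
by apply: eq_bigr => w _; ring.
Qed.

Lemma fmulZr c G H : fmul G (fscale c H) = fscale c (fmul G H).
Proof.
apply: formP => ps vs; rewrite /fscale /fmul mulr_sumr.
apply: eq_bigr => u _; rewrite mulr_sumr.
by apply: eq_bigr => w _; ring.
Qed.

Lemma fmulNl G H : fmul (- G) H = - fmul G H.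
Proof. by rewrite -!fscaleN1 fmulZl. Qed.
Lemma fmulNr G H : fmul G (- H) = - fmul G H.
Proof. by rewrite -!fscaleN1 fmulZr. Qed.
Lemma fmul0l G : fmul 0 G = 0.
Proof. by apply: (addrI (fmul 0 G)); rewrite -fmulDl !addr0. Qed.
Lemma fmul0r G : fmul G 0 = 0.
Proof. by apply: (addrI (fmul G 0)); rewrite -fmulDr !addr0. Qed.

(* The operator T determined by [insA a (T G) = S a G + (-1)^e T (insA a G)] and
   by the vanishing of T G without arguments in A. *)
Fixpoint recA (e : bool) (S : TA -> form -> form) G (ps : seq TA) (vs : seq TF) :
    C :=
  if ps is a :: ps' then S a G ps' vs + (-1) ^+ e * recA e S (insA a G) ps' vs
  else 0.

Lemma insA_recA e S a G :
  insA a (recA e S G) = S a G + fscale ((-1) ^+ e) (recA e S (insA a G)).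
Proof. by []. Qed.

Lemma recA_add e S : (forall a G H, S a (G + H) = S a G + S a H) ->
  forall G H, recA e S (G + H) = recA e S G + recA e S H.
Proof.
move=> SD G H; apply: formP => ps; elim: ps G H => [|a ps IH] G H vs /=.
  by rewrite addfE addr0.
by rewrite addfE insA_add IH SD !addfE mulrDr addrACA.
Qed.

Lemma recA_scale c e S : (forall a G, S a (fscale c G) = fscale c (S a G)) ->
  forall G, recA e S (fscale c G) = fscale c (recA e S G).
Proof.
move=> SZ G; apply: formP => ps; elim: ps G => [|a ps IH] G vs /=.
  by rewrite /fscale mulr0.
by rewrite insA_scale IH SZ /fscale /=; ring.
Qed.

Section Derivations.
Variable cst : C -> Prop.

(** Linearity is required over [cst] only, because D is linear over constants but not over C. The
    law for [bar] records the parity e of T. *)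
Definition is_der (e : bool) (T : form -> form) :=
  [/\ forall G H, T (G + H) = T G + T H,
      forall c G, cst c -> T (fscale c G) = fscale c (T G),
      forall G, T (bar G) = fscale ((-1) ^+ e) (bar (T G)) &
      forall G H, T (fmul G H) = fmul (T G) H + fmul (sbar e G) (T H)].

Lemma der0 e T : is_der e T -> T 0 = 0.
Proof. by case=> TD _ _ _; apply: (addrI (T 0)); rewrite -TD !addr0. Qed.

(** The relation i_a T = S_a + (-1)^e T i_a makes both sides of each law satisfy the same recursion
    on the arguments in A, and T vanishes when there are none. Since i_a is odd, [S a] must have the
    parity opposite to that of T. *)
Lemma der_recA e (S : TA -> form -> form) :
  (forall a, is_der (~~ e) (S a)) -> is_der e (recA e S).
Proof.
move=> Sd; set T := recA e S.
have T0 G vs : T G [::] vs = 0 by [].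
have Ts G a ps vs :
  T G (a :: ps) vs = S a G ps vs + (-1) ^+ e * T (insA a G) ps vs by [].
(* From here on T is opaque and known only through its two recursion equations. *)
move: T T0 Ts => T T0 Ts.
have TD G H : T (G + H) = T G + T H.
  apply: formP => ps; elim: ps G H => [|a ps IH] G H vs.
    by rewrite addfE !T0 addr0.
  rewrite addfE !Ts insA_add IH; case: (Sd a) => -> _ _ _.
  by rewrite !addfE mulrDr addrACA.
have TZ c G : cst c -> T (fscale c G) = fscale c (T G).
  move=> cc; apply: formP => ps; elim: ps G => [|a ps IH] G vs.
    by rewrite /fscale !T0 mulr0.
  rewrite [RHS]/fscale !Ts insA_scale IH; case: (Sd a) => _ -> // _ _.
  by rewrite /fscale; ring.
have TN G : T (- G) = - T G.
  have T00 : T 0 = 0 by apply: (addrI (T 0)); rewrite -TD !addr0.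
  by apply: (addrI (T G)); rewrite -TD !subrr T00.
have Tb G : T (bar G) = fscale ((-1) ^+ e) (bar (T G)).
  apply: formP => ps; elim: ps G => [|a ps IH] G vs.
    by rewrite /fscale /bar !T0; ring.
  rewrite !Ts insA_bar TN oppfE IH; case: (Sd a) => _ _ -> _.
  by rewrite /fscale /bar Ts /= exprS; case: e {Ts IH Sd} => /=; ring.
split=> // G H.
apply: formP => ps; elim: ps G H => [|a ps IH] G H vs.
  rewrite addfE !T0 !fmul_nil !big1 ?addr0 // => w _; rewrite T0 ?mul0r//.
  by rewrite mulr0.
rewrite Ts insA_mul TD !addfE !IH; case: (Sd a) => _ _ _ ->.
rewrite -[RHS]/(insA a (fmul (T G) H + fmul (sbar e G) (T H)) ps vs).
have insT H' : insA a (T H') = S a H' + fscale ((-1) ^+ e) (T (insA a H')).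
  by apply: formP => qs ws; rewrite /insA Ts.
rewrite insA_add !insA_mul !insT !(fmulDl, fmulDr) !fmulZl !fmulZr Tb.
rewrite !addfE; case: e {Ts Tb IH Sd TN insT} => /=;
  rewrite ?barK ?insA_bar ?fmulNl ?fmulZl /fscale ?addfE ?oppfE /=.
  by ring.
by rewrite !expr0; ring.
Qed.

End Derivations.
End Forms.

(** * Generators of the algebra of forms *)

Section Generators.
Variables (C : comPzRingType) (TA TF : Type).
Local Notation form := (sform C TA TF).

Definition genfun (c : C) : form := fun ps vs =>
  if (ps, vs) is ([::], [::]) then c else 0.
Definition genA (th : TA -> C) : form := fun ps vs =>
  if (ps, vs) is ([:: a], [::]) then th a else 0.
Definition genF (be : TF -> C) : form := fun ps vs =>
  if (ps, vs) is ([::], [:: v]) then be v else 0.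

Lemma insA_genfun a c : insA a (genfun c) = 0. Proof. by []. Qed.
Lemma insF_genfun v c : insF v (genfun c) = 0.
Proof. by apply: formP => -[]. Qed.
Lemma insA_genA a th : insA a (genA th) = genfun (th a).
Proof. by apply: formP => -[|b ps] []. Qed.
Lemma insF_genA v th : insF v (genA th) = 0.
Proof. by apply: formP => -[|b []]. Qed.
Lemma insA_genF a be : insA a (genF be) = 0. Proof. by []. Qed.
Lemma insF_genF v be : insF v (genF be) = genfun (be v).
Proof. by apply: formP => -[|b ps] []. Qed.
End Generators.

(** * Alternating-symmetric tensors *)

Section Tensorial.
Variables (C : comPzRingType) (SA SF : lmodType C).
Local Notation form := (sform C SA SF).
Implicit Types (G H : form) (c : C).

Record tens G : Prop := Tens {
  tens_linA : forall c a b s1 s2 vs, G (s1 ++ (c *: a + b) :: s2) vs =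
    c * G (s1 ++ a :: s2) vs + G (s1 ++ b :: s2) vs;
  tens_linF : forall c v w ps s1 s2, G ps (s1 ++ (c *: v + w) :: s2) =
    c * G ps (s1 ++ v :: s2) + G ps (s1 ++ w :: s2);
  tens_alt : forall a s1 s2 vs, G (s1 ++ a :: a :: s2) vs = 0;
  tens_sym : forall v w ps s1 s2,
    G ps (s1 ++ v :: w :: s2) = G ps (s1 ++ w :: v :: s2) }.

Lemma tens_add G H : tens G -> tens H -> tens (G + H).
Proof.
case=> l1 l2 l3 l4 [m1 m2 m3 m4]; split=> *; rewrite !addfE.
- by rewrite l1 m1; ring.
- by rewrite l2 m2; ring.
- by rewrite l3 m3 addr0.
- by rewrite l4 m4.
Qed.

Lemma tens_scale c G : tens G -> tens (fscale c G).
Proof.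
case=> l1 l2 l3 l4; split=> *; rewrite /fscale.
- by rewrite l1; ring.
- by rewrite l2; ring.
- by rewrite l3 mulr0.
- by rewrite l4.
Qed.

Lemma tens0 : tens 0.
Proof. by split=> *; rewrite ?zerofE; ring. Qed.

Lemma tens_insA a G : tens G -> tens (insA a G).
Proof.
case=> l1 l2 l3 l4; split=> *; rewrite /insA.
- by rewrite -!cat_cons l1.
- by rewrite l2.
- by rewrite -!cat_cons l3.
- by rewrite l4.
Qed.

Lemma tens_insF a G : tens G -> tens (insF a G).
Proof.
case=> l1 l2 l3 l4; split=> *; rewrite /insF.
- by rewrite l1.
- by rewrite -!cat_cons l2.
- by rewrite l3.
- by rewrite -!cat_cons l4.
Qed.

Lemma tens_bar G : tens G -> tens (bar G).
Proof.
case=> l1 l2 l3 l4; split=> *; rewrite /bar.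
- by rewrite l1 !size_cat /=; ring.
- by rewrite l2; ring.
- by rewrite l3 mulr0.
- by rewrite l4.
Qed.

Lemma insA_lin c a b G : tens G ->
  insA (c *: a + b) G = fscale c (insA a G) + insA b G.
Proof. by move=> tG; apply: formP => ps vs; exact: (tens_linA tG c a b [::]). Qed.

Lemma insF_lin c a b G : tens G ->
  insF (c *: a + b) G = fscale c (insF a G) + insF b G.
Proof. by move=> tG; apply: formP => ps vs; exact: (tens_linF tG c a b ps [::]). Qed.

Lemma insAA a G : tens G -> insA a (insA a G) = 0.
Proof. by move=> tG; apply: formP => ps vs; exact: (tens_alt tG a [::]). Qed.

Lemma insFC a b G : tens G -> insF a (insF b G) = insF b (insF a G).
Proof. by move=> tG; apply: formP => ps vs; exact: (tens_sym tG _ _ ps [::]). Qed.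

Lemma insAD a b G : tens G -> insA (a + b) G = insA a G + insA b G.
Proof. by move=> tG; rewrite -{1}[a]scale1r insA_lin// fscale1. Qed.

Lemma insFD a b G : tens G -> insF (a + b) G = insF a G + insF b G.
Proof. by move=> tG; rewrite -{1}[a]scale1r insF_lin// fscale1. Qed.

Lemma insA0 G : tens G -> insA 0 G = 0.
Proof. by move=> tG; apply: (addrI (insA 0 G)); rewrite -insAD// !addr0. Qed.

Lemma insF0 G : tens G -> insF 0 G = 0.
Proof. by move=> tG; apply: (addrI (insF 0 G)); rewrite -insFD// !addr0. Qed.

Lemma insAZ c a G : tens G -> insA (c *: a) G = fscale c (insA a G).
Proof. by move=> tG; rewrite -[c *: a]addr0 insA_lin// insA0// addr0. Qed.

Lemma insFZ c a G : tens G -> insF (c *: a) G = fscale c (insF a G).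
Proof. by move=> tG; rewrite -[c *: a]addr0 insF_lin// insF0// addr0. Qed.

Lemma insAN a G : tens G -> insA (- a) G = - insA a G.
Proof. by move=> tG; rewrite -scaleN1r insAZ// fscaleN1. Qed.

Lemma insAC a b G : tens G -> insA a (insA b G) = - insA b (insA a G).
Proof.
move=> tG; apply/eqP; rewrite -addr_eq0; apply/eqP.
have := insAA (a + b) tG.
rewrite insAD; last exact: tens_insA.
rewrite !insAD//.
by rewrite !insA_add !insAA// add0r addr0.
Qed.

(** Each law is brought to the head of the list by inserting the prefix s1, which turns a product
    into a sum of products of tensors. *)
Lemma tens_mul G H : tens G -> tens H -> tens (fmul G H).
Proof.
have mulA G' H' a s vs : fmul G' H' (a :: s) vs = insA a (fmul G' H') s vs by [].
have mulF G' H' v s vs : fmul G' H' vs (v :: s) = insF v (fmul G' H') vs s by [].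
move=> tG tH; split.
- move=> c a b s1 s2 vs; elim: s1 G H tG tH => [|x s1 IH] G H tG tH.
    rewrite !cat0s !mulA !insA_mul !insA_lin// fmulDl fmulDr fmulZl fmulZr.
    by rewrite !addfE /fscale; ring.
  rewrite !cat_cons !mulA !insA_mul !addfE !IH; try exact: tens_insA; try exact: tens_bar; auto.
  by ring.
- move=> c a b ps s1 s2; elim: s1 G H tG tH => [|x s1 IH] G H tG tH.
    rewrite !cat0s !mulF !insF_mul !insF_lin// fmulDl fmulDr fmulZl fmulZr.
    by rewrite !addfE /fscale; ring.
  rewrite !cat_cons !mulF !insF_mul !addfE !IH; try exact: tens_insF; auto.
  by ring.
- move=> a s1 s2 vs; elim: s1 G H tG tH => [|x s1 IH] G H tG tH.
    (* The two mixed terms i_a G . i_a H cancel, because [insA a] anticommutes with [bar]. *)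
    rewrite !cat0s mulA -[LHS]/(insA a (insA a (fmul G H)) s2 vs).
    rewrite insA_mul insA_add !insA_mul insAA// insAA// fmul0l fmul0r.
    by rewrite insA_bar !fmulNl !addfE oppfE !zerofE; ring.
  rewrite !cat_cons !mulA !insA_mul !addfE !IH ?addr0//; try exact: tens_insA; exact: tens_bar.
- move=> v w ps s1 s2; elim: s1 G H tG tH => [|x s1 IH] G H tG tH.
    rewrite !cat0s -[LHS]/(insF w (insF v (fmul G H)) ps s2).
    rewrite -[RHS]/(insF v (insF w (fmul G H)) ps s2).
    rewrite !(insF_mul, insF_add) (insFC v w)// (insFC v w)//.
    by rewrite !addfE; ring.
  by rewrite !cat_cons !mulF !insF_mul !addfE !IH//; exact: tens_insF.
Qed.

(** Past the head, every law follows by recursion from the tensoriality of [S a]. What must be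
    checked for each operator is the behaviour in the leading arguments, where the linearity of S in
    a meets the recursion. *)
Lemma tens_recA e (S : SA -> form -> form) :
  (forall a G, tens G -> tens (S a G)) ->
  (forall c a b G, tens G -> insA (c *: a + b) (recA e S G) =
     fscale c (insA a (recA e S G)) + insA b (recA e S G)) ->
  (forall a G, tens G -> insA a (insA a (recA e S G)) = 0) ->
  forall G, tens G -> tens (recA e S G).
Proof.
move=> tS Tl Ta G tG.
have T0 H vs : recA e S H [::] vs = 0 by [].
have Ts H a ps vs : recA e S H (a :: ps) vs =
  S a H ps vs + (-1) ^+ e * recA e S (insA a H) ps vs by [].
split.
- move=> c a b s1 s2 vs; elim: s1 G tG => [|x s1 IH] G tG.
    by have /(congr1 (fun F => F s2 vs)) := Tl c a b G tG.
  rewrite !cat_cons !Ts IH; last exact: tens_insA.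
  by rewrite (tens_linA (tS x _ tG)); ring.
- move=> c a b ps s1 s2; elim: ps G tG => [|x ps IH] G tG.
    by rewrite !T0 mulr0 addr0.
  rewrite !Ts IH; last exact: tens_insA.
  by rewrite (tens_linF (tS x _ tG)); ring.
- move=> a s1 s2 vs; elim: s1 G tG => [|x s1 IH] G tG.
    by have /(congr1 (fun F => F s2 vs)) := Ta a G tG.
  rewrite !cat_cons !Ts IH; last exact: tens_insA.
  by rewrite (tens_alt (tS x _ tG)) mulr0 addr0.
- move=> v w ps s1 s2; elim: ps G tG => [|x ps IH] G tG.
    by rewrite !T0.
  rewrite !Ts IH; last exact: tens_insA.
  by rewrite (tens_sym (tS x _ tG)).
Qed.

End Tensorial.

(** A Lie-Rinehart pair without Jacobi identity, together with a submodule SF killed by the anchor.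
    [nab] and [Jac] are data pinned down by their images under the injection [tinc], so identities
    in SF are proved after applying it. [lbr_aa] is separate from skew-symmetry because C may have
    2-torsion. *)
Record almost_Lie_Rinehart (C : comPzRingType) (SA SF : lmodType C) := ALR {
  rho : SA -> C -> C;
  lbr : SA -> SA -> SA;
  tinc : SF -> SA;
  nab : SA -> SF -> SF;
  Jac : SA -> SA -> SA -> SF;
  rho_add : forall a f g, rho a (f + g) = rho a f + rho a g;
  rho_mul : forall a f g, rho a (f * g) = rho a f * g + f * rho a g;
  rho_lin : forall c a b f, rho (c *: a + b) f = c * rho a f + rho b f;
  lbrDl : forall a b c, lbr (a + b) c = lbr a c + lbr b c;
  lbr_skew : forall a b, lbr b a = - lbr a b;
  lbr_aa : forall a, lbr a a = 0;
  lbrZr : forall a b f, lbr a (f *: b) = rho a f *: b + f *: lbr a b;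
  rho_lbr : forall a b f, rho (lbr a b) f = rho a (rho b f) - rho b (rho a f);
  tinc_lin : forall c v w, tinc (c *: v + w) = c *: tinc v + tinc w;
  tinc_inj : injective tinc;
  rho_tinc : forall v f, rho (tinc v) f = 0;
  tinc_nab : forall a v, tinc (nab a v) = lbr a (tinc v);
  tinc_Jac : forall a b c,
    tinc (Jac a b c) = lbr a (lbr b c) + lbr b (lbr c a) + lbr c (lbr a b) }.

(** * The differential over a commutative ring *)

Section Differential.
Variables (C : comPzRingType) (SA SF : lmodType C).
Variable L : almost_Lie_Rinehart SA SF.
Local Notation form := (sform C SA SF).
Implicit Types (G H : form) (c : C).

Local Notation rho := (rho L).
Local Notation lbr := (lbr L).
Local Notation tinc := (tinc L).
Local Notation nab := (nab L).
Local Notation Jac := (Jac L).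

Definition rho_const c := forall a, rho a c = 0.
Local Notation is_der := (is_der rho_const).

Lemma rho0 a : rho a 0 = 0.
Proof. by apply: (addrI (rho a 0)); rewrite -rho_add !addr0. Qed.

Lemma rhoN a f : rho a (- f) = - rho a f.
Proof. by apply: (addrI (rho a f)); rewrite -rho_add !subrr rho0. Qed.

Lemma rhoDl a b f : rho (a + b) f = rho a f + rho b f.
Proof. by rewrite -{1}[a]scale1r rho_lin mul1r. Qed.

Lemma rho0l f : rho 0 f = 0.
Proof. by apply: (addrI (rho 0 f)); rewrite -rhoDl !addr0. Qed.

Lemma rhoZl c a f : rho (c *: a) f = c * rho a f.
Proof. by rewrite -[c *: a]addr0 rho_lin rho0l addr0. Qed.

Lemma lbrDr a b d : lbr a (b + d) = lbr a b + lbr a d.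
Proof. by rewrite lbr_skew lbrDl opprD -!lbr_skew. Qed.

Lemma lbr0r a : lbr a 0 = 0.
Proof. by apply: (addrI (lbr a 0)); rewrite -lbrDr !addr0. Qed.

Lemma lbrNr a b : lbr a (- b) = - lbr a b.
Proof. by apply: (addrI (lbr a b)); rewrite -lbrDr !subrr lbr0r. Qed.

Lemma lbrNl a b : lbr (- a) b = - lbr a b.
Proof. by rewrite lbr_skew lbrNr -lbr_skew lbr_skew opprK. Qed.

Lemma lbrZl a b f : lbr (f *: a) b = f *: lbr a b - rho b f *: a.
Proof. by rewrite lbr_skew lbrZr (lbr_skew _ a b) opprD scalerN opprK addrC. Qed.

Lemma tincD v w : tinc (v + w) = tinc v + tinc w.
Proof. by rewrite -[v]scale1r tinc_lin !scale1r. Qed.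

Lemma tinc0 : tinc 0 = 0.
Proof. by apply: (addrI (tinc 0)); rewrite -tincD !addr0. Qed.

Lemma tincZ c v : tinc (c *: v) = c *: tinc v.
Proof. by rewrite -[c *: v]addr0 tinc_lin tinc0 addr0. Qed.

Lemma tincN v : tinc (- v) = - tinc v.
Proof. by rewrite -scaleN1r tincZ scaleN1r. Qed.

Lemma nabDr a v w : nab a (v + w) = nab a v + nab a w.
Proof. by apply: (@tinc_inj _ _ _ L); rewrite tinc_nab !tincD lbrDr !tinc_nab. Qed.

Lemma nabDl a b v : nab (a + b) v = nab a v + nab b v.
Proof. by apply: (@tinc_inj _ _ _ L); rewrite tinc_nab tincD lbrDl !tinc_nab. Qed.

Lemma nabZr a c v : nab a (c *: v) = rho a c *: v + c *: nab a v.
Proof.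
by apply: (@tinc_inj _ _ _ L); rewrite tinc_nab tincD !tincZ lbrZr tinc_nab.
Qed.

(** The Leibniz term of [lbrZl] is rho (t v) c, which vanishes because F lies in the kernel of the
    anchor. Thus [nab] is a genuine A-connection on F. *)
Lemma nabZl a c v : nab (c *: a) v = c *: nab a v.
Proof.
apply: (@tinc_inj _ _ _ L).
by rewrite tinc_nab tincZ lbrZl rho_tinc scale0r subr0 tinc_nab.
Qed.

Lemma JacDl a a' b d : Jac (a + a') b d = Jac a b d + Jac a' b d.
Proof.
apply: (@tinc_inj _ _ _ L); rewrite tincD !tinc_Jac !(lbrDl, lbrDr).
by rewrite [X in X + _ = _]addrACA [LHS]addrACA.
Qed.

(** The second derivatives of c, all multiplying a, cancel by [rho_lbr]; the first derivatives
    cancel in pairs, by skew-symmetry. *)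
Lemma JacZl c a b d : Jac (c *: a) b d = c *: Jac a b d.
Proof.
apply: (@tinc_inj _ _ _ L); rewrite tincZ !tinc_Jac.
rewrite !lbrZl rho_lbr lbrZr !lbrDr lbrNr !lbrZr.
rewrite !scalerBl !scalerDr !opprB.
rewrite (lbr_skew L a b) !scalerN ?opprD ?opprK.
by zmodule.
Qed.

Lemma Jac_cycle a b d : Jac a b d = Jac b d a.
Proof.
by apply: (@tinc_inj _ _ _ L); rewrite !tinc_Jac -addrA addrC.
Qed.

Lemma Jac_aac a d : Jac a a d = 0.
Proof.
apply: (@tinc_inj _ _ _ L); rewrite tinc_Jac tinc0 lbr_aa lbr0r addr0.
by rewrite (lbr_skew L d a) lbrNr addNr.
Qed.

Lemma Jac_caa a d : Jac d a a = 0.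
Proof. by rewrite Jac_cycle Jac_aac. Qed.

Lemma Jac_lin1 c a a' b d :
  Jac (c *: a + a') b d = c *: Jac a b d + Jac a' b d.
Proof. by rewrite JacDl JacZl. Qed.

Lemma Jac_lin2 c a a' b d :
  Jac b (c *: a + a') d = c *: Jac b a d + Jac b a' d.
Proof. by rewrite Jac_cycle Jac_lin1 !(Jac_cycle b). Qed.

Lemma Jac_lin3 c a a' b d :
  Jac b d (c *: a + a') = c *: Jac b d a + Jac b d a'.
Proof. by rewrite -Jac_cycle Jac_lin1 (Jac_cycle a) (Jac_cycle a'). Qed.

(* The Lie derivative [lie a], which acts by [rho a] on values, by [lbr a] on
   the arguments in A and by [nab a] on those in F. *)
Fixpoint lieF (a : SA) (g : seq SF -> C) (vs : seq SF) : C :=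
  if vs is v :: vs' then lieF a (fun ws => g (v :: ws)) vs' - g (nab a v :: vs')
  else rho a (g [::]).

Fixpoint lie (a : SA) G (ps : seq SA) (vs : seq SF) : C :=
  if ps is b :: ps' then lie a (insA b G) ps' vs - G (lbr a b :: ps') vs
  else lieF a (G [::]) vs.

Lemma insA_lie a b G : insA b (lie a G) = lie a (insA b G) - insA (lbr a b) G.
Proof. by []. Qed.

Lemma insF_lie a v G : insF v (lie a G) = lie a (insF v G) - insF (nab a v) G.
Proof.
apply: formP => ps; elim: ps G => [|b ps IH] G vs //.
have := IH (insA b G) vs; rewrite /insF /= => ->.
by rewrite !fE /insA /=; ring.
Qed.

Lemma lie_nilS a G v vs :
  lie a G [::] (v :: vs) = lie a (insF v G) [::] vs - G [::] (nab a v :: vs).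
Proof. by []. Qed.

Lemma lie_add a G H : lie a (G + H) = lie a G + lie a H.
Proof.
apply: formP => ps; elim: ps G H => [|b ps IH] G H vs; last first.
  by rewrite /= insA_add IH !fE /= opprD addrACA.
elim: vs G H => [|v vs IH] G H; first exact: rho_add.
by rewrite addfE !lie_nilS insF_add IH !fE; ring.
Qed.

Lemma lie_scale a c G :
  lie a (fscale c G) = fscale (rho a c) G + fscale c (lie a G).
Proof.
apply: formP => ps; elim: ps G => [|b ps IH] G vs; last first.
  by rewrite /= insA_scale IH !fE /fscale /= /insA; ring.
elim: vs G => [|v vs IH] G; first exact: rho_mul.
by rewrite addfE /fscale !lie_nilS insF_scale IH addfE /fscale /insF; ring.
Qed.

Lemma lieN a G : lie a (- G) = - lie a G.
Proof.
have L0 : lie a 0 = 0 by apply: (addrI (lie a 0)); rewrite -lie_add !addr0.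
by apply: (addrI (lie a G)); rewrite -lie_add !subrr L0.
Qed.

Lemma lie_bar a G : lie a (bar G) = bar (lie a G).
Proof.
apply: formP => ps; elim: ps G => [|b ps IH] G vs; last first.
  by rewrite /= insA_bar lieN oppfE IH /bar /= exprS; ring.
rewrite /bar expr0 mul1r; elim: vs G => [|v vs IH] G.
  by rewrite /= expr0 mul1r.
by rewrite !lie_nilS insF_bar IH /bar expr0 mul1r.
Qed.

(** Inserting all arguments reduces the claim to empty lists, where it is the Leibniz rule of
    [rho a] on C. *)
Lemma lie_mul a G H : lie a (fmul G H) = fmul (lie a G) H + fmul G (lie a H).
Proof.
apply: formP => ps; elim: ps G H => [|b ps IH] G H vs; last first.
  rewrite -[LHS]/(insA b (lie a (fmul G H)) ps vs).
  rewrite -[RHS]/(insA b (fmul (lie a G) H + fmul G (lie a H)) ps vs).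
  rewrite insA_lie insA_add !insA_mul lie_add !fE !IH !insA_lie -lie_bar.
  by rewrite !fmulDl !fmulDr !fmulNl !fmulNr !fE; ring.
elim: vs G H => [|v vs IH] G H.
  by rewrite addfE !fmul_nil2 /= fmul_nil2 rho_mul.
rewrite -[LHS]/(insF v (lie a (fmul G H)) [::] vs).
rewrite -[RHS]/(insF v (fmul (lie a G) H + fmul G (lie a H)) [::] vs).
rewrite insF_lie insF_add !insF_mul lie_add !fE !IH !insF_lie.
by rewrite !fmulDl !fmulDr !fmulNl !fmulNr !fE; ring.
Qed.

Lemma lie_der a : is_der false (lie a).
Proof.
split; [exact: lie_add | | |exact: lie_mul].
- move=> c G cc; rewrite lie_scale cc; apply: formP => ps vs.
  by rewrite addfE /fscale mul0r add0r.
- by move=> G; rewrite expr0 fscale1 lie_bar.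
Qed.

Lemma lie0 a : lie a 0 = 0.
Proof. exact: der0 (lie_der a). Qed.

Lemma insF_der (v : SF) : is_der false (insF v : form -> form).
Proof.
split=> //; last by move=> G H; exact: insF_mul.
by move=> G; rewrite expr0 fscale1.
Qed.

(* [recA true] turns Cartan's formula [insA a (Dop G) = lie a G - Dop (insA a G)]
   into a definition. *)
Definition Dop : form -> form := recA true lie.

(* [hatJop G] sums over the triples of arguments in A, which are replaced by
   their Jacobiator as a first argument in F. *)
Definition hatJ1 (a b : SA) : form -> form :=
  recA true (fun d => insF (Jac a b d)).
Definition hatJ2 (a : SA) : form -> form := recA false (hatJ1 a).
Definition hatJop : form -> form := recA true hatJ2.

(** The recursion runs on F, since delta turns an argument in A into one in F: it sums over j the
    value of G at t v_j, with v_j removed. Putting t v_j in first position gives the sign fixed by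
    the convention on alpha1 wedge alpha2. *)
Fixpoint delta_aux G (ps : seq SA) (vs : seq SF) : C :=
  if vs is v :: vs' then G (tinc v :: ps) vs' + delta_aux (insF v G) ps vs'
  else 0.
Definition deltaop : form -> form := delta_aux.

Lemma Dop_der : is_der true Dop.
Proof. by apply: der_recA => a; exact: lie_der. Qed.

Lemma hatJ1_der a b : is_der true (hatJ1 a b).
Proof. by apply: der_recA => d; exact: insF_der. Qed.

Lemma hatJ2_der a : is_der false (hatJ2 a).
Proof. by apply: der_recA => d; exact: hatJ1_der. Qed.

Lemma hatJop_der : is_der true hatJop.
Proof. by apply: der_recA => d; exact: hatJ2_der. Qed.

Lemma insF_delta v G :
  insF v (deltaop G) = insA (tinc v) G + deltaop (insF v G).
Proof. by []. Qed.

Lemma delta_add G H : deltaop (G + H) = deltaop G + deltaop H.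
Proof.
apply: formP => ps vs; elim: vs G H => [|v vs IH] G H; rewrite addfE /= ?addr0//.
by have := IH (insF v G) (insF v H); rewrite addfE /= insF_add => ->; rewrite addfE; ring.
Qed.

Lemma delta_scale c G : deltaop (fscale c G) = fscale c (deltaop G).
Proof.
apply: formP => ps vs; elim: vs G => [|v vs IH] G; rewrite /fscale /= ?mulr0//.
by have := IH (insF v G); rewrite /fscale /= insF_scale => ->; ring.
Qed.

(** [der_recA] concerns recursions on A, so the induction here is on vs. The [bar] of the Leibniz
    rule comes from inserting t v into a product. *)
Lemma delta_der : is_der true deltaop.
Proof.
have db G : deltaop (bar G) = - bar (deltaop G).
  apply: formP => ps vs; elim: vs G => [|v vs IH] G.
    by rewrite oppfE /bar /= mulr0 oppr0.
  rewrite oppfE /bar /=; have := IH (insF v G); rewrite oppfE /bar /= => ->.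
  by rewrite exprS; ring.
split; [exact: delta_add | by move=> c G _; exact: delta_scale | |].
- by move=> G; rewrite db expr1 fscaleN1.
- move=> G H /=; apply: formP => ps vs; elim: vs G H => [|v vs IH] G H.
    rewrite addfE /fmul /= !big1 ?addr0// => u _; rewrite big_seq1 /=; ring.
  rewrite -[LHS]/(insF v (deltaop (fmul G H)) ps vs).
  rewrite -[RHS]/(insF v (fmul (deltaop G) H + fmul (bar G) (deltaop H)) ps vs).
  rewrite insF_delta insF_add insA_mul !insF_mul delta_add !fE !IH.
  by rewrite !insF_delta !fmulDl !fmulDr !fE insF_bar; ring.
Qed.

(** * Tensoriality of the operators *)

Lemma fscaleN c G : fscale c (- G) = - fscale c G.
Proof. by apply: formP => ps vs; rewrite !fE /fscale !fE mulrN. Qed.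

Lemma tens_lie a G : tens G -> tens (lie a G).
Proof.
have lA G' b s vs : lie a G' (b :: s) vs =
    (lie a (insA b G') - insA (lbr a b) G') s vs by [].
have lF G' v ps s : lie a G' ps (v :: s) =
    (lie a (insF v G') - insF (nab a v) G') ps s by rewrite -insF_lie.
move=> tG; split.
- move=> c b b' s1 s2 vs; elim: s1 G tG => [|x s1 IH] G tG.
    (* The term rho a c produced by [lie_scale] is offset by the Leibniz term of the bracket. *)
    rewrite !cat0s !lA lbrDr lbrZr insA_lin// insAD// insAD// !insAZ//.
    by rewrite lie_add lie_scale !fE /fscale; ring.
  rewrite !cat_cons !lA !fE IH; last exact: tens_insA.
  by rewrite (tens_linA (tens_insA _ tG)); ring.
- move=> c b b' ps s1 s2; elim: s1 G tG => [|x s1 IH] G tG.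
    rewrite !cat0s !lF nabDr nabZr insF_lin// insFD// insFD// !insFZ//.
    by rewrite lie_add lie_scale !fE /fscale; ring.
  rewrite !cat_cons !lF !fE IH; last exact: tens_insF.
  by rewrite (tens_linF (tens_insF _ tG)); ring.
- move=> b s1 s2 vs; elim: s1 G tG => [|x s1 IH] G tG.
    rewrite !cat0s -[LHS]/(insA b (insA b (lie a G)) s2 vs).
    rewrite insA_lie insA_add insA_lie insA_opp insAA// lie0 insAC//.
    by rewrite !fE; ring.
  rewrite !cat_cons !lA !fE IH; last exact: tens_insA.
  by rewrite (tens_alt (tens_insA _ tG)) subrr.
- move=> v w ps s1 s2; elim: s1 G tG => [|x s1 IH] G tG.
    rewrite !cat0s -[LHS]/(insF w (insF v (lie a G)) ps s2).
    rewrite -[RHS]/(insF v (insF w (lie a G)) ps s2).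
    rewrite !(insF_lie, insF_add, insF_opp) (insFC w v)//.
    by rewrite (insFC w (nab a v))// (insFC (nab a w) v)// !fE; ring.
  rewrite !cat_cons !lF !fE IH; last exact: tens_insF.
  by rewrite (tens_sym (tens_insF _ tG)).
Qed.

Lemma lie_addl a a' G : tens G -> lie (a + a') G = lie a G + lie a' G.
Proof.
move=> tG; apply: formP => ps; elim: ps G tG => [|b ps IH] G tG vs; last first.
  rewrite /= lbrDl IH; last exact: tens_insA.
  have := congr1 (fun F => F ps vs) (insAD (lbr a b) (lbr a' b) tG).
  by rewrite !fE /= /insA => ->; ring.
elim: vs G tG => [|v vs IH] G tG; first by rewrite !fE /= rhoDl.
rewrite !fE !lie_nilS nabDl IH; last exact: tens_insF.
have := congr1 (fun F => F [::] vs) (insFD (nab a v) (nab a' v) tG).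
by rewrite !fE /insF => ->; ring.
Qed.

(** Exterior multiplication by dc, the form b |-> rho b c. It is the defect of C-linearity both of
    [lie] in its direction and of [Dop] in its argument. *)
Definition dwedge c : form -> form := recA true (fun b G => fscale (rho b c) G).

Lemma insA_dwedge c a G :
  insA a (dwedge c G) = fscale (rho a c) G - dwedge c (insA a G).
Proof. by rewrite insA_recA fscaleN1. Qed.

Lemma insA_Dop a G : insA a (Dop G) = lie a G - Dop (insA a G).
Proof. by rewrite insA_recA fscaleN1. Qed.

Lemma dwedge_opp c G : dwedge c (- G) = - dwedge c G.
Proof.
by rewrite -!fscaleN1; apply: recA_scale => a H; rewrite !fscaleA mulrC.
Qed.

Lemma lie_scalel c a G : tens G ->
  lie (c *: a) G = fscale c (lie a G) + dwedge c (insA a G).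
Proof.
move=> tG; apply: formP => ps; elim: ps G tG => [|b ps IH] G tG vs; last first.
  rewrite -[LHS]/((lie (c *: a) (insA b G) - insA (lbr (c *: a) b) G) ps vs).
  rewrite -[RHS]/((fscale c (insA b (lie a G)) + insA b (dwedge c (insA a G))) ps vs).
  rewrite insA_dwedge insA_lie lbrZl insAD// insAN// !insAZ// insAC//.
  rewrite !fE IH; last exact: tens_insA.
  by rewrite dwedge_opp /fscale !fE; ring.
rewrite fE addr0.
elim: vs G tG => [|v vs IH] G tG; first by rewrite /fscale /= rhoZl.
rewrite /fscale !lie_nilS nabZl IH; last exact: tens_insF.
have := congr1 (fun F => F [::] vs) (insFZ c (nab a v) tG).
by rewrite /insF /fscale => ->; ring.
Qed.

Lemma Dop_scale c G : Dop (fscale c G) = fscale c (Dop G) + dwedge c G.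
Proof.
apply: formP => ps; elim: ps G => [|b ps IH] G vs.
  by rewrite fE; change (0 = c * 0 + 0); ring.
rewrite -[LHS]/(insA b (Dop (fscale c G)) ps vs).
rewrite -[RHS]/((fscale c (insA b (Dop G)) + insA b (dwedge c G)) ps vs).
by rewrite insA_dwedge !insA_Dop lie_scale insA_scale !fE IH /fscale !fE; ring.
Qed.

Lemma Dop_add G H : Dop (G + H) = Dop G + Dop H.
Proof. by case: Dop_der. Qed.

Lemma tens_Dop G : tens G -> tens (Dop G).
Proof.
apply: tens_recA; first exact: tens_lie.
(* The two [dwedge] terms, from [lie_scalel] and from [Dop_scale], cancel in i_a D = L_a - D i_a. *)
- move=> c a b {}G tG; rewrite -/(Dop G) !insA_Dop insA_lin//.
  rewrite lie_addl// lie_scalel// Dop_add Dop_scale fscaleDr fscaleN.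
  set x1 := dwedge _ _; set x2 := Dop _; set x3 := fscale _ _; set x4 := lie _ _.
  by zmodule.
- move=> a {}G tG; rewrite -/(Dop G) insA_Dop insA_add insA_lie insA_opp.
  rewrite insA_Dop insAA// lbr_aa insA0//.
  have -> : Dop 0 = 0 by exact: der0 Dop_der.
  by zmodule.
Qed.

Lemma recA_linS e (S : SA -> SA -> form -> form) c a a' G :
  (forall d H, tens H ->
     S (c *: a + a') d H = fscale c (S a d H) + S a' d H) ->
  tens G ->
  recA e (S (c *: a + a')) G = fscale c (recA e (S a) G) + recA e (S a') G.
Proof.
move=> Sl tG; apply: formP => ps; elim: ps G tG => [|d ps IH] G tG vs.
  by rewrite !fE /fscale /=; ring.
rewrite /= Sl// IH; last exact: tens_insA.
by rewrite !fE /fscale /=; ring.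
Qed.

Lemma hatJ1_add a b G H : hatJ1 a b (G + H) = hatJ1 a b G + hatJ1 a b H.
Proof. by rewrite /hatJ1 recA_add. Qed.
Lemma hatJ1_scale c a b G : hatJ1 a b (fscale c G) = fscale c (hatJ1 a b G).
Proof. by rewrite /hatJ1 recA_scale. Qed.
Lemma hatJ2_add a G H : hatJ2 a (G + H) = hatJ2 a G + hatJ2 a H.
Proof. by rewrite /hatJ2 recA_add// => *; exact: hatJ1_add. Qed.
Lemma hatJ2_scale c a G : hatJ2 a (fscale c G) = fscale c (hatJ2 a G).
Proof. by rewrite /hatJ2 recA_scale// => *; exact: hatJ1_scale. Qed.
Lemma hatJ_add G H : hatJop (G + H) = hatJop G + hatJop H.
Proof. by rewrite /hatJop recA_add// => *; exact: hatJ2_add. Qed.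
Lemma hatJ_scale c G : hatJop (fscale c G) = fscale c (hatJop G).
Proof. by rewrite /hatJop recA_scale// => *; exact: hatJ2_scale. Qed.

Lemma hatJ1_0 a b : hatJ1 a b 0 = 0.
Proof. exact: der0 (hatJ1_der a b). Qed.
Lemma hatJ2_0 a : hatJ2 a 0 = 0.
Proof. exact: der0 (hatJ2_der a). Qed.
Lemma hatJ_0 : hatJop 0 = 0.
Proof. exact: der0 hatJop_der. Qed.

Lemma insA_hatJ1 a b d G :
  insA d (hatJ1 a b G) = insF (Jac a b d) G - hatJ1 a b (insA d G).
Proof. by rewrite insA_recA fscaleN1. Qed.
Lemma insA_hatJ2 a b G :
  insA b (hatJ2 a G) = hatJ1 a b G + hatJ2 a (insA b G).
Proof. by rewrite insA_recA fscale1. Qed.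
Lemma insA_hatJ a G : insA a (hatJop G) = hatJ2 a G - hatJop (insA a G).
Proof. by rewrite insA_recA fscaleN1. Qed.

Lemma hatJ1_linr c a b b' G : tens G ->
  hatJ1 a (c *: b + b') G = fscale c (hatJ1 a b G) + hatJ1 a b' G.
Proof.
apply: (@recA_linS true (fun b d => insF (Jac a b d)) c b b') => d H tH.
by rewrite Jac_lin2 insF_lin.
Qed.

Lemma hatJ1_linl c a a' b G : tens G ->
  hatJ1 (c *: a + a') b G = fscale c (hatJ1 a b G) + hatJ1 a' b G.
Proof.
apply: (@recA_linS true (fun a d => insF (Jac a b d)) c a a') => d H tH.
by rewrite Jac_lin1 insF_lin.
Qed.

Lemma hatJ2_lin c a a' G : tens G ->
  hatJ2 (c *: a + a') G = fscale c (hatJ2 a G) + hatJ2 a' G.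
Proof. by apply: recA_linS => d H; exact: hatJ1_linl. Qed.

Lemma hatJ1_aa a G : tens G -> hatJ1 a a G = 0.
Proof.
move=> tG; apply: formP => ps; elim: ps G tG => [|d ps IH] G tG vs //.
rewrite -[LHS]/(insA d (hatJ1 a a G) ps vs) insA_hatJ1 !fE IH; last exact: tens_insA.
by rewrite Jac_aac insF0// !fE; ring.
Qed.

Lemma tens_hatJ1 a b G : tens G -> tens (hatJ1 a b G).
Proof.
apply: tens_recA; first by move=> d H; exact: tens_insF.
- move=> c d d' {}G tG; rewrite -/(hatJ1 a b G) !insA_hatJ1 insA_lin// Jac_lin3.
  by rewrite insF_lin// hatJ1_add hatJ1_scale fscaleDr fscaleN; zmodule.
- move=> d {}G tG; rewrite -/(hatJ1 a b G) insA_hatJ1 insA_add insA_opp.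
  by rewrite insA_hatJ1 insAA// hatJ1_0; zmodule.
Qed.

Lemma tens_hatJ2 a G : tens G -> tens (hatJ2 a G).
Proof.
apply: tens_recA; first by move=> d H; exact: tens_hatJ1.
- move=> c d d' {}G tG; rewrite -/(hatJ2 a G) !insA_hatJ2 insA_lin//.
  by rewrite hatJ1_linr// hatJ2_add hatJ2_scale fscaleDr; zmodule.
- move=> d {}G tG; rewrite -/(hatJ2 a G) insA_hatJ2 insA_add.
  rewrite insA_hatJ2 insA_hatJ1 Jac_caa insAA// hatJ2_0 insF0//.
  by zmodule.
Qed.

Lemma tens_hatJ G : tens G -> tens (hatJop G).
Proof.
apply: tens_recA; first by move=> d H; exact: tens_hatJ2.
- move=> c d d' {}G tG; rewrite -/(hatJop G) !insA_hatJ insA_lin//.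
  by rewrite hatJ2_lin// hatJ_add hatJ_scale fscaleDr fscaleN; zmodule.
- move=> d {}G tG; rewrite -/(hatJop G) insA_hatJ insA_add insA_opp.
  rewrite insA_hatJ insA_hatJ2 hatJ1_aa// insAA// hatJ_0.
  by zmodule.
Qed.

Lemma tens_delta G : tens G -> tens (deltaop G).
Proof.
move=> tG; split.
- move=> c a b s1 s2 vs; elim: vs G tG => [|v vs IH] G tG /=; first by ring.
  have := IH _ (tens_insF v tG); rewrite /deltaop => ->.
  by rewrite -!cat_cons (tens_linA tG); ring.
- move=> c a b ps s1 s2; elim: s1 G tG => [|v s1 IH] G tG.
    rewrite !cat0s -[LHS]/(insF (c *: a + b) (deltaop G) ps s2).
    rewrite insF_delta tinc_lin insF_lin// insA_lin// delta_add delta_scale.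
    rewrite -[X in _ = c * X + _]/(insF a (deltaop G) ps s2).
    rewrite -[X in _ = _ + X]/(insF b (deltaop G) ps s2).
    by rewrite !insF_delta !fE /fscale; ring.
  rewrite /=; have := IH _ (tens_insF v tG); rewrite /deltaop => ->.
  by rewrite (tens_linF tG); ring.
- move=> a s1 s2 vs; elim: vs G tG => [|v vs IH] G tG //=.
  have := IH _ (tens_insF v tG); rewrite /deltaop => ->.
  by rewrite -cat_cons (tens_alt tG) addr0.
- move=> v w ps s1 s2; elim: s1 G tG => [|x s1 IH] G tG.
    rewrite !cat0s -[LHS]/(insF w (insF v (deltaop G)) ps s2).
    rewrite -[RHS]/(insF v (insF w (deltaop G)) ps s2).
    rewrite !(insF_delta, insF_add) (insFC v w)//.
    by rewrite !fE /insA /insF; ring.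
  rewrite /=; have := IH _ (tens_insF x tG); rewrite /deltaop => ->.
  by rewrite (tens_sym tG).
Qed.

(** * Bidegrees and total degree of the operators *)

Definition vanish (p q : nat) G :=
  forall ps vs, size ps = p -> size vs = q -> G ps vs = 0.

Lemma vanish_lie p q a G : vanish p q G -> vanish p q (lie a G).
Proof.
move=> G0 ps; elim: ps p G G0 => [|b ps IH] p G G0 vs /= sp sv; last first.
  rewrite G0// subr0 (IH (size ps) _ _ vs)// => qs ws s1 s2.
  by apply: G0; rewrite //= s1.
have {G0} : forall ws, size ws = q -> G [::] ws = 0 by move=> ws; exact: G0.
move: (G [::]) => g g0; elim: vs q sv g g0 => [|v vs IH] q sv g g0 /=.
  by rewrite g0// rho0.
rewrite g0// subr0 (IH (size vs))// => ws s1; apply: g0.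
by rewrite /= s1.
Qed.

Lemma recA_low e (S : SA -> form -> form) r :
  (forall a H ps vs, (size ps < r)%N -> S a H ps vs = 0) ->
  forall H ps vs, (size ps < r.+1)%N -> recA e S H ps vs = 0.
Proof.
move=> S0 H ps; elim: ps H => [//|a ps IH] H vs /= lt.
by rewrite S0// IH ?mulr0 ?addr0//; exact: ltnW.
Qed.

(** If each [S a] raises the number of arguments in A by r, then [recA] raises it by r + 1. The
    hypothesis on short lists covers p = 0, where inserting an argument into G leaves no bidegree to
    recurse on. *)
Lemma recA_vanish e (S : SA -> form -> form) r q q' :
  (forall a H ps vs, (size ps < r)%N -> S a H ps vs = 0) ->
  (forall p a H, vanish p q H -> vanish (p + r) q' (S a H)) ->
  forall p G, vanish p q G -> vanish (p + r.+1) q' (recA e S G).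
Proof.
move=> low S0 p G G0 ps; elim: ps p G G0 => [|a ps IH] p G G0 vs //=.
rewrite addnS => -[sp] sv; rewrite (S0 p)// add0r.
case: p G0 sp => [|p] G0 sp.
  by rewrite (@recA_low _ _ r)// ?mulr0//; rewrite sp.
rewrite (IH p)// ?mulr0//; last by rewrite sp addnS addSn.
by move=> ? ? s1 s2; apply: G0 => //=; rewrite s1.
Qed.

Lemma vanish_Dop p q G : vanish p q G -> vanish p.+1 q (Dop G).
Proof.
rewrite -addn1; apply: recA_vanish => // p' a H H0.
by rewrite addn0; exact: vanish_lie.
Qed.

Lemma hatJ_low H ps vs : (size ps < 3)%N -> hatJop H ps vs = 0.
Proof.
apply: recA_low => a {}H {}ps {}vs; apply: recA_low => b {}H {}ps {}vs.
exact: recA_low.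
Qed.

Lemma vanish_hatJ p q G : vanish p q.+1 G -> vanish (p + 3) q (hatJop G).
Proof.
apply: recA_vanish => [a H ps vs|{}p a {}G].
  by apply: recA_low => b {}H {}ps {}vs; apply: recA_low.
apply: recA_vanish => [b H ps vs|{}p b {}G]; first exact: recA_low.
apply: recA_vanish => // {}p d {}G G0 ps vs sp sv; apply: G0 => //=.
  by rewrite sp addn0.
by rewrite sv.
Qed.

Lemma vanish_delta p q G : vanish p.+1 q G -> vanish p q.+1 (deltaop G).
Proof.
move=> G0 ps vs sp; elim: vs q G G0 => [|v vs IH] q G G0 // [sv].
rewrite -[LHS]/(G (tinc v :: ps) vs + deltaop (insF v G) ps vs).
rewrite G0//=; last by rewrite sp.
case: q sv G0 => [|q] sv G0; first by rewrite add0r (size0nil sv).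
rewrite (IH q)// ?addr0// => ? ? s1 s2; apply: G0 => //=.
by rewrite s2.
Qed.

Definition dop G : form := Dop G + hatJop G + deltaop G.

Lemma dop_der : is_der true dop.
Proof.
case: Dop_der => D1 D2 D3 D4; case: hatJop_der => J1 J2 J3 J4.
case: delta_der => d1 d2 d3 d4; split; rewrite /dop.
- by move=> G H; rewrite D1 J1 d1; zmodule.
- by move=> c G cc; rewrite D2// J2// d2// !fscaleDr.
- by move=> G; rewrite D3 J3 d3 !fscale_bar -barD -barD !fscaleDr.
- by move=> G H; rewrite D4 J4 d4 !fmulDl !fmulDr; zmodule.
Qed.

Lemma tens_dop G : tens G -> tens (dop G).
Proof.
by move=> tG; apply: tens_add;
  [apply: tens_add; [exact: tens_Dop|exact: tens_hatJ]|exact: tens_delta].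
Qed.

(** A predicate on the total degree covers homogeneity ([pred1 k]) and boundedness (at most N) by
    the same lemmas. *)
Definition supported (P : pred nat) G :=
  forall ps vs, ~~ P (size ps + 2 * size vs)%N -> G ps vs = 0.

Lemma supported_Dop (P Q : pred nat) G : (forall n, P n -> Q n.+1) ->
  supported P G -> supported Q (Dop G).
Proof.
move=> PQ sG [|a ps] vs // nQ; apply: (vanish_Dop (p := size ps) (q := size vs)) => //.
by move=> qs ws sq sw; apply: sG; rewrite sq sw; apply: contra nQ => /PQ; rewrite addSn.
Qed.

Lemma supported_hatJ (P Q : pred nat) G : (forall n, P n -> Q n.+1) ->
  supported P G -> supported Q (hatJop G).
Proof.
move=> PQ sG ps vs nQ; have [lt|ge] := ltnP (size ps) 3; first exact: hatJ_low.
apply: (vanish_hatJ (p := size ps - 3) (q := size vs)) => //; last by rewrite subnK.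
move=> qs ws sq sw; apply: sG; rewrite sq sw; apply: contra nQ => /PQ.
by congr Q; lia.
Qed.

Lemma supported_delta (P Q : pred nat) G : (forall n, P n -> Q n.+1) ->
  supported P G -> supported Q (deltaop G).
Proof.
move=> PQ sG ps [|v vs] // nQ.
apply: (vanish_delta (p := size ps) (q := size vs)) => //.
move=> qs ws sq sw; apply: sG; rewrite sq sw; apply: contra nQ => /PQ.
by congr Q; rewrite /=; lia.
Qed.

Lemma supported_add P G H : supported P G -> supported P H -> supported P (G + H).
Proof. by move=> sG sH ps vs n; rewrite fE sG// sH// addr0. Qed.

Lemma supported_dop (P Q : pred nat) G : (forall n, P n -> Q n.+1) ->
  supported P G -> supported Q (dop G).
Proof.
move=> PQ sG; apply: supported_add; last exact: supported_delta sG.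
by apply: supported_add; [exact: supported_Dop sG|exact: supported_hatJ sG].
Qed.

(** * Values on the generators, and vanishing of the square there *)

Lemma formP_A G H : (forall vs, G [::] vs = H [::] vs) ->
  (forall a, insA a G = insA a H) -> G = H.
Proof.
move=> E0 EA; apply: formP => -[|a ps] vs; first exact: E0.
by have := congr1 (fun F => F ps vs) (EA a).
Qed.

Lemma lie_genfun a c : lie a (genfun c) = genfun (rho a c).
Proof.
apply: formP_A => [|b]; last by rewrite insA_lie !insA_genfun lie0 subrr.
case=> [|v vs] //; rewrite lie_nilS insF_genfun lie0 /genfun.
by rewrite zerofE subr0.
Qed.

Lemma lie_genA a th :
  lie a (genA th) = genA (fun b => rho a (th b) - th (lbr a b)).
Proof.
apply: formP_A => [|b].
  case=> [|v vs]; first by rewrite /= rho0.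
  by rewrite lie_nilS insF_genA lie0 zerofE subr0.
rewrite insA_lie !insA_genA lie_genfun; apply: formP => ps vs.
by rewrite !fE; case: ps vs => [|? ?] [|? ?]//=; rewrite subr0.
Qed.

Lemma lie_genF a be :
  lie a (genF be) = genF (fun v => rho a (be v) - be (nab a v)).
Proof.
apply: formP_A => [|b]; last by rewrite insA_lie !insA_genF lie0 subrr.
case=> [|v vs]; first by rewrite /= rho0.
rewrite lie_nilS insF_genF lie_genfun.
by case: vs => [|w vs] //=; rewrite /genfun /= subr0.
Qed.

Lemma Dop0 : Dop 0 = 0. Proof. exact: der0 Dop_der. Qed.
Lemma delta0 : deltaop 0 = 0. Proof. exact: der0 delta_der. Qed.

Lemma Dop_genfun c : Dop (genfun c) = genA (fun a => rho a c).
Proof.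
apply: formP_A => [|a]; first by case.
by rewrite insA_Dop insA_genfun Dop0 subr0 lie_genfun insA_genA.
Qed.

Lemma hatJ_genfun c : hatJop (genfun c) = 0.
Proof.
apply: formP => ps vs; have [lt|] := ltnP (size ps) 3; first exact: hatJ_low.
move=> ge; apply: (@vanish_hatJ (size ps - 3) (size vs)) => //; last by rewrite subnK.
by move=> [|? ?] [].
Qed.

Lemma hatJ_genA th : hatJop (genA th) = 0.
Proof.
apply: formP => ps vs; have [lt|] := ltnP (size ps) 3; first exact: hatJ_low.
move=> ge; apply: (@vanish_hatJ (size ps - 3) (size vs)) => //; last by rewrite subnK.
by move=> [|? [|? ?]] [].
Qed.

Lemma delta_genfun c : deltaop (genfun c) = 0.
Proof.
apply: formP => ps [|v vs] //; apply: (@vanish_delta (size ps) (size vs)) => //.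
by move=> [].
Qed.

Lemma delta_genF be : deltaop (genF be) = 0.
Proof.
apply: formP => ps [|v vs] //; apply: (@vanish_delta (size ps) (size vs)) => //.
by move=> [].
Qed.

Lemma delta_genA th : deltaop (genA th) = genF (fun v => th (tinc v)).
Proof.
apply: formP => ps [|v vs]; first by case: ps.
rewrite -[LHS]/(insF v (deltaop (genA th)) ps vs) insF_delta insF_genA delta0.
by rewrite insA_genA addr0; case: ps vs => [|? ?] [].
Qed.

Lemma dop_genfun c : dop (genfun c) = genA (fun a => rho a c).
Proof. by rewrite /dop Dop_genfun hatJ_genfun delta_genfun !addr0. Qed.

(** The bidegree (2, 0) part vanishes by [rho_lbr], and the (0, 1) part, which is dc restricted to
    F, by [rho_tinc]. *)
Lemma dop2_genfun c : dop (dop (genfun c)) = 0.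
Proof.
rewrite dop_genfun /dop hatJ_genA addr0 delta_genA.
have -> : genF (fun v => rho (tinc v) c) = 0 :> form.
  by apply: formP => -[|? ?] [|v []]//=; rewrite /genF rho_tinc.
rewrite addr0; apply: formP_A => [vs|a] //.
rewrite insA_Dop insA_genA lie_genA Dop_genfun; apply: formP => ps vs.
rewrite !fE; case: ps vs => [|b [|? ?]] [|? ?] /=; rewrite /genA /= ?subrr//.
by rewrite rho_lbr /insA zerofE; ring.
Qed.

(** The usual exterior derivative of the 1-form th, evaluated at a and b. *)
Definition dA (th : SA -> C) (a b : SA) : C :=
  rho a (th b) - th (lbr a b) - rho b (th a).

Lemma insA_Dop_genA th a : insA a (Dop (genA th)) = genA (dA th a).
Proof.
rewrite insA_Dop insA_genA lie_genA Dop_genfun; apply: formP => ps vs.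
by rewrite fE oppfE; case: ps vs => [|b [|? ?]] [|? ?] //=; rewrite /genA ?subrr.
Qed.

Section GenA.
Variable th : SA -> C.
Hypothesis th_lin : forall c a b, th (c *: a + b) = c * th a + th b.

Let thD a b : th (a + b) = th a + th b.
Proof. by rewrite -[a]scale1r th_lin mul1r scale1r. Qed.
Let th0 : th 0 = 0.
Proof. by apply: (addrI (th 0)); rewrite -thD !addr0. Qed.
Let thN a : th (- a) = - th a.
Proof. by apply: (addrI (th a)); rewrite -thD !subrr. Qed.

(** All anchor terms cancel by [rho_lbr]; the three double brackets survive and add up to the
    Jacobiator. *)
Lemma Dop2_genA a b d :
  Dop (Dop (genA th)) [:: a; b; d] [::] = - th (tinc (Jac a b d)).
Proof.
rewrite -[LHS]/(insA b (insA a (Dop (Dop (genA th)))) [:: d] [::]).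
rewrite insA_Dop insA_Dop_genA insA_add insA_opp insA_lie !insA_Dop_genA.
rewrite lie_genA !fE /genA /dA tinc_Jac.
rewrite !(rho_add, rhoN) !rho_lbr !(thD, thN).
rewrite (lbr_skew _ d (lbr a b)) (lbr_skew _ a d) !lbrNr !thN.
by ring.
Qed.

End GenA.

Lemma insA_hatJ_genF a be : insA a (hatJop (genF be)) = hatJ2 a (genF be).
Proof. by rewrite insA_hatJ insA_genF hatJ_0 subr0. Qed.

Lemma insA_hatJ2_genF a b be :
  insA b (hatJ2 a (genF be)) = genA (fun d => be (Jac a b d)).
Proof.
rewrite insA_hatJ2 insA_genF hatJ2_0 addr0; apply: formP_A => [vs|d]; first by case: vs.
by rewrite insA_hatJ1 insA_genF hatJ1_0 subr0 insF_genF insA_genA.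
Qed.

Definition dF (be : SF -> C) (a : SA) (v : SF) : C := rho a (be v) - be (nab a v).

Lemma insA_Dop_genF be a : insA a (Dop (genF be)) = genF (dF be a).
Proof. by rewrite insA_Dop insA_genF Dop0 subr0 lie_genF. Qed.

(** Degree 3 consists of the bidegrees (3, 0) and (1, 1). In (3, 0), D^2 th cancels J^ delta th. In
    (1, 1), D and delta anticommute on th, which is the identity [tinc_nab]. *)
Lemma dop2_genA th :
  (forall c a b, th (c *: a + b) = c * th a + th b) ->
  dop (dop (genA th)) = 0.
Proof.
move=> thl; set X := dop (genA th).
have EX : X = Dop (genA th) + genF (fun v => th (tinc v)).
  by rewrite /X /dop hatJ_genA addr0 delta_genA.
have sX : supported (pred1 3) (dop X).
  apply: (@supported_dop (pred1 2)) => [n /eqP -> //|].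
  apply: (@supported_dop (pred1 1)) => [n /eqP -> //|].
  by move=> [|a [|? ?]] [|? ?].
apply: formP => ps vs; rewrite zerofE.
have [sz|/sX //] := boolP (pred1 3 (size ps + 2 * size vs)%N).
rewrite EX /dop !(Dop_add, hatJ_add, delta_add) delta_genF addr0 !fE.
have : ((size ps == 3) && (size vs == 0)) || ((size ps == 1) && (size vs == 1)).
  by move: sz => /=; lia.
case: ps vs {sz} => [//|a [|b [|d [|? ?]]]] [|v [|? ?]] //= _.
- rewrite -[X in X + _ + _]/((insA a (Dop (Dop (genA th))) [::] [:: v]) +
    insA a (Dop (genF (fun v => th (tinc v)))) [::] [:: v]).
  rewrite insA_Dop_genF !hatJ_low// -[X in _ + X]/(deltaop (Dop (genA th)) [:: a] [:: v]).
  rewrite -[deltaop _ _ _]/(insA (tinc v) (Dop (genA th)) [:: a] [::] + 0).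
  rewrite insA_Dop_genA.
  have -> : insA a (Dop (Dop (genA th))) [::] [:: v] = 0.
    by apply: (@vanish_Dop 0 1 (Dop (genA th)) _ [:: a]) => // -[].
  rewrite /genF /genA /dF /dA rho_tinc tinc_nab (lbr_skew _ a).
  have thN x : th (- x) = - th x.
    have th0 : th 0 = 0.
      apply: (addrI (th 0)); rewrite -{1}[th 0]mul1r -thl !addr0.
      by rewrite scaler0.
    by rewrite -[- x]addr0 -scaleN1r thl th0 addr0 mulN1r.
  by rewrite thN; ring.
- rewrite (Dop2_genA thl).
  rewrite -[Dop (genF _) _ _]/(insA a (Dop (genF (fun v => th (tinc v)))) [:: b; d] [::]).
  rewrite insA_Dop_genF -[hatJop (genF _) _ _]/(insA b (insA a
    (hatJop (genF (fun v => th (tinc v))))) [:: d] [::]).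
  rewrite insA_hatJ_genF insA_hatJ2_genF.
  have -> : hatJop (Dop (genA th)) [:: a; b; d] [::] = 0.
    by apply: (@vanish_hatJ 0 0) => // -[].
  by rewrite /genF /genA; ring.
Qed.

Lemma nab_tincC v w : nab (tinc v) w = - nab (tinc w) v.
Proof. by apply: (@tinc_inj _ _ _ L); rewrite tincN !tinc_nab lbr_skew. Qed.

(** Under [tinc] the curvature of [nab] becomes a sum of double brackets, namely the Jacobiator with
    one argument in F. *)
Lemma nab_curvature a b v :
  nab a (nab b v) - nab b (nab a v) - nab (lbr a b) v = Jac (tinc v) a b.
Proof.
apply: (@tinc_inj _ _ _ L); rewrite !(tincD, tincN) tinc_Jac !tinc_nab.
by rewrite (lbr_skew _ (tinc v) (lbr a b)) (lbr_skew _ a (tinc v)) lbrNr; zmodule.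
Qed.

(* The covariant exterior derivative of the Jacobiator vanishes, without any
   assumption on the bracket beside skew-symmetry. *)
Lemma Jac_closed a b d e :
  nab a (Jac b d e) - nab b (Jac a d e) + nab d (Jac a b e) - nab e (Jac a b d)
  - Jac (lbr a b) d e + Jac (lbr a d) b e - Jac (lbr a e) b d
  - Jac (lbr b d) a e + Jac (lbr b e) a d - Jac (lbr d e) a b = 0.
Proof.
apply: (@tinc_inj _ _ _ L); rewrite !(tincD, tincN) tinc0 !tinc_nab !tinc_Jac.
(* Skew-symmetry puts every iterated bracket into one chosen order, so that the remaining identity
   only involves common atoms. *)
rewrite !lbrDr (lbr_skew _ b e) (lbr_skew _ a e) (lbr_skew _ a d).
rewrite (lbr_skew _ d (lbr a b)) (lbr_skew _ b (lbr a d)) (lbr_skew _ b (lbr a e)).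
rewrite (lbr_skew _ a (lbr b d)) (lbr_skew _ a (lbr b e)) (lbr_skew _ a (lbr d e)).
rewrite (lbr_skew _ (lbr a b) (lbr d e)) (lbr_skew _ (lbr a d) (lbr b e)).
rewrite (lbr_skew _ (lbr a e) (lbr b d)) !(lbrNr, lbrNl, opprK).
by zmodule.
Qed.

Lemma Jac_skew a b d : Jac b a d = - Jac a b d.
Proof.
apply: (@tinc_inj _ _ _ L); rewrite tincN !tinc_Jac.
rewrite (lbr_skew _ d a) (lbr_skew _ b d) (lbr_skew _ a b) !lbrNr !opprD.
by zmodule.
Qed.

Lemma insA_sub a G H : insA a (G - H) = insA a G - insA a H.
Proof. by []. Qed.

(** Three arguments are pulled out and the fourth is kept, so that on [genF] the formulas for forms
    with few arguments apply. The same holds for [insA3_hatJ]. *)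
Lemma insA3_Dop a b d G :
  insA d (insA b (insA a (Dop G))) =
  lie a (insA d (insA b G)) - insA (lbr a d) (insA b G)
  - insA d (insA (lbr a b) G) - (lie b (insA d (insA a G)) -
  insA (lbr b d) (insA a G) - insA d (Dop (insA b (insA a G)))).
Proof.
rewrite insA_Dop (insA_sub _ (lie a G)) insA_lie insA_Dop.
by rewrite (insA_sub d (lie a (insA b G) - insA (lbr a b) G)).
Qed.

Lemma insA3_hatJ a b d G :
  insA d (insA b (insA a (hatJop G))) =
  insF (Jac a b d) G - hatJ1 a b (insA d G) + (hatJ1 a d (insA b G) +
  hatJ2 a (insA d (insA b G))) - insA d (insA b (hatJop (insA a G))).
Proof.
rewrite insA_hatJ (insA_sub _ (hatJ2 a G)) insA_hatJ2.
rewrite (insA_sub d (hatJ1 a b G + hatJ2 a (insA b G))) (insA_add d (hatJ1 a b G)).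
by rewrite insA_hatJ1 insA_hatJ2.
Qed.

Section GenF.
Variable be : SF -> C.
Hypothesis be_lin : forall c v w, be (c *: v + w) = c * be v + be w.

Let beD v w : be (v + w) = be v + be w.
Proof. by rewrite -[v]scale1r be_lin mul1r scale1r. Qed.
Let be0 : be 0 = 0.
Proof. by apply: (addrI (be 0)); rewrite -beD !addr0. Qed.
Let beN v : be (- v) = - be v.
Proof. by apply: (addrI (be v)); rewrite -beD !subrr. Qed.

Lemma Dop2_genF a b v :
  Dop (Dop (genF be)) [:: a; b] [:: v] = - be (Jac (tinc v) a b).
Proof.
rewrite -[LHS]/(insA b (insA a (Dop (Dop (genF be)))) [::] [:: v]).
rewrite insA_Dop insA_Dop_genF insA_add insA_opp insA_lie !insA_Dop_genF.
rewrite lie_genF !fE /genF /dF -nab_curvature !(beD, beN) !(rho_add, rhoN).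
by rewrite rho_lbr; ring.
Qed.

(** The derivatives of the functions be (Jac ...) cancel between the two terms, and what is left is
    be applied to the identity [Jac_closed]. *)
Lemma Dop_hatJ_genF a b d e :
  Dop (hatJop (genF be)) [:: a; b; d; e] [::] +
  hatJop (Dop (genF be)) [:: a; b; d; e] [::] = 0.
Proof.
rewrite -[X in X + _]/(insA d (insA b (insA a (Dop (hatJop (genF be))))) [:: e] [::]).
rewrite -[X in _ + X]/(insA d (insA b (insA a (hatJop (Dop (genF be))))) [:: e] [::]).
have Y2 be' x y : insA y (insA x (hatJop (genF be'))) = genA (fun z => be' (Jac x y z)).
  by rewrite insA_hatJ_genF insA_hatJ2_genF.
rewrite insA3_Dop insA3_hatJ !Y2 !insA_Dop_genF !insA_genF !Y2.
rewrite hatJ2_0 !lie_genA insA_Dop_genA.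
have J1 be' x y : hatJ1 x y (genF be') [:: e] [::] = be' (Jac x y e).
  rewrite -[LHS]/(insA e (hatJ1 x y (genF be')) [::] [::]) insA_hatJ1.
  by rewrite insA_genF hatJ1_0 subr0 insF_genF.
have FD x : insF x (Dop (genF be)) [:: e] [::] = dF be e x.
  by rewrite -[LHS]/(insA e (Dop (genF be)) [::] [:: x]) insA_Dop_genF.
rewrite !fE FD !J1 /genA /dA /dF.
have := congr1 be (Jac_closed a b d e); rewrite !(beD, beN, be0) => E.
(* Inner brackets are moved to the first slot of [Jac], as they stand in [Jac_closed]; the
   right-hand side 0 is then replaced by be of that sum. *)
rewrite (Jac_cycle b d (lbr a e)) (Jac_cycle d (lbr a e)).
rewrite (Jac_cycle a d (lbr b e)) (Jac_cycle d (lbr b e)).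
rewrite (Jac_cycle a b (lbr d e)) (Jac_cycle b (lbr d e)).
rewrite (Jac_skew (lbr a d)) (Jac_skew (lbr b d)) !beN -[RHS]E.
by ring.
Qed.

(** Degree 4 has three bidegrees: (4, 0) is the Bianchi identity, (2, 1) the cancellation of the
    curvature D^2 against delta J^, and (0, 2) is delta D, which vanishes by [nab_tincC]. *)
Lemma dop2_genF : dop (dop (genF be)) = 0.
Proof.
set X := dop (genF be).
have EX : X = Dop (genF be) + hatJop (genF be).
  by rewrite /X /dop delta_genF addr0.
have sX : supported (pred1 4) (dop X).
  apply: (@supported_dop (pred1 3)) => [n /eqP -> //|].
  apply: (@supported_dop (pred1 2)) => [n /eqP -> //|].
  by move=> [|a [|? ?]] [|? [|? ?]].
apply: formP => ps vs; rewrite zerofE.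
have [sz|/sX //] := boolP (pred1 4 (size ps + 2 * size vs)%N).
rewrite EX /dop !(Dop_add, hatJ_add, delta_add) !fE.
have Dv : vanish 2 0 (Dop (genF be)) by apply: vanish_Dop => -[|? [|? ?]] [].
have : [|| (size ps == 4) && (size vs == 0),
           (size ps == 2) && (size vs == 1) |
           (size ps == 0) && (size vs == 2)].
  by move: sz => /=; lia.
case: ps vs {sz} => [|a [|b [|d [|e [|? ?]]]]] [|v [|w [|? ?]]] // _.
- rewrite -[deltaop (Dop _) _ _]/(insA (tinc v) (Dop (genF be)) [::] [:: w] +
    (insA (tinc w) (Dop (genF be)) [::] [:: v] + 0)).
  rewrite -[deltaop (hatJop _) _ _]/(hatJop (genF be) [:: tinc v] [:: w] +
    (hatJop (genF be) [:: tinc w] [:: v] + 0)).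
  have D0 G' ws : Dop G' [::] ws = 0 by [].
  rewrite !D0 !hatJ_low// !insA_Dop_genF /genF /dF !rho_tinc nab_tincC beN.
  by ring.
- rewrite Dop2_genF !hatJ_low//.
  have -> : Dop (hatJop (genF be)) [:: a; b] [:: v] = 0.
    by apply: (@vanish_Dop 1 1) => // ? ? s1 _; rewrite hatJ_low ?s1.
  rewrite -[deltaop (Dop _) _ _]/(Dop (genF be) [:: tinc v; a; b] [::] + 0).
  rewrite -[deltaop (hatJop _) _ _]/(insA a (insA (tinc v) (hatJop (genF be))) [:: b] [::] + 0).
  rewrite insA_hatJ_genF insA_hatJ2_genF.
  have -> : Dop (genF be) [:: tinc v; a; b] [::] = 0.
    by apply: (@vanish_Dop 2 0) => // -[|? [|? ?]] [].
  by rewrite /genA; ring.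
- have -> : Dop (Dop (genF be)) [:: a; b; d; e] [::] = 0.
    apply: (@vanish_Dop 3 0) => //; apply: vanish_Dop.
    by move=> [|? [|? ?]] [].
  have -> : hatJop (hatJop (genF be)) [:: a; b; d; e] [::] = 0.
    by apply: (@vanish_hatJ 1 0) => // ? ? s1 _; rewrite hatJ_low ?s1.
  rewrite -[deltaop (Dop _) _ _]/(0 : C) -[deltaop (hatJop _) _ _]/(0 : C).
  by have E := Dop_hatJ_genF a b d e; rewrite !addr0 add0r E.
Qed.

End GenF.

(** * Euler identities and reduction to generators *)

Lemma fmul_genfun c G : fmul (genfun c) G = fscale c G.
Proof.
apply: formP => ps vs; rewrite /fscale.
elim: ps G => [|a ps IH] G; last first.
  rewrite -[LHS]/(insA a (fmul (genfun c) G) ps vs) insA_mul insA_genfun fmul0l add0r.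
  have -> : bar (genfun c) = genfun c :> form.
    by apply: formP => -[|? ?] ws; rewrite /bar ?expr0 ?mul1r// mulr0.
  exact: IH.
elim: vs G => [|v vs IH] G; first by rewrite fmul_nil2.
rewrite -[LHS]/(insF v (fmul (genfun c) G) [::] vs) insF_mul insF_genfun fmul0l add0r.
exact: IH.
Qed.

Lemma insA_fmul_genA a th H :
  insA a (fmul (genA th) H) = fscale (th a) H - fmul (genA th) (insA a H).
Proof.
rewrite insA_mul insA_genA fmul_genfun; congr (_ + _).
have -> : bar (genA th) = - genA th :> form.
  apply: formP => -[|? [|? ?]] ws; rewrite /bar !fE /= ?expr0 ?expr1 ?mul1r ?oppr0 ?mulN1r ?mulr0 ?oppr0//.
by rewrite fmulNl.
Qed.

Lemma insF_fmul_genF v be H :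
  insF v (fmul (genF be) H) = fscale (be v) H + fmul (genF be) (insF v H).
Proof. by rewrite insF_mul insF_genF fmul_genfun. Qed.

Lemma sumfE (I : Type) (r : seq I) (F : I -> form) ps vs :
  (\sum_(i <- r) F i) ps vs = \sum_(i <- r) F i ps vs.
Proof. by elim: r => [|i r IH]; rewrite ?big_nil// !big_cons fE IH. Qed.

Lemma tens_sumA I (r : seq I) (c : I -> C) (s : I -> SA) G ps vs : tens G ->
  G (\sum_(i <- r) c i *: s i :: ps) vs = \sum_(i <- r) c i * G (s i :: ps) vs.
Proof.
move=> tG; elim: r => [|i r IH].
  by rewrite !big_nil; have /(congr1 (fun F => F ps vs)) := insA0 tG.
by rewrite !big_cons -IH; exact: (tens_linA tG _ _ _ [::]).
Qed.

Lemma tens_sumF I (r : seq I) (c : I -> C) (s : I -> SF) G ps vs : tens G ->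
  G ps (\sum_(i <- r) c i *: s i :: vs) = \sum_(i <- r) c i * G ps (s i :: vs).
Proof.
move=> tG; elim: r => [|i r IH].
  by rewrite !big_nil; have /(congr1 (fun F => F ps vs)) := insF0 tG.
by rewrite !big_cons -IH; exact: (tens_linF tG _ _ _ _ [::]).
Qed.

Definition Clin (V : lmodType C) (th : V -> C) :=
  forall c a b, th (c *: a + b) = c * th a + th b.

(* The factor c, in geometry a bump function, makes a local frame suffice. *)
Record dual_basis (V : lmodType C) (c : C) := DualBasis {
  db_rank : nat;
  db_form : 'I_db_rank -> V -> C;
  db_vec : 'I_db_rank -> V;
  db_lin : forall i, Clin (db_form i);
  db_sum : forall s, c *: s = \sum_i db_form i s *: db_vec i }.
Arguments db_form {V c} d i s.
Arguments db_vec {V c} d i.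
Arguments db_lin {V c} d i.
Arguments db_sum {V c} d s.

(** Inserting a into the sum gives sum_i th_i(a) i_{e_i} G, which is chi i_a G, plus the same sum
    for i_a G: the sign of moving a past th_i cancels the sign of moving it past e_i. Each argument
    thus contributes one chi G. *)
Lemma Euler_A (chi : C) (b : dual_basis SA chi) G : tens G ->
  forall ps vs, (\sum_i fmul (genA (db_form b i)) (insA (db_vec b i) G)) ps vs =
                (size ps)%:R * (chi * G ps vs).
Proof.
move=> tG ps vs; rewrite sumfE; elim: ps G tG => [|a ps IH] G tG.
  rewrite mul0r big1// => u _; rewrite fmul_nil big1// => w _.
  by rewrite /genA mul0r.
under eq_bigr => u _.
  rewrite -[fmul _ _ _ _]/(insA a (fmul (genA (db_form b u)) (insA (db_vec b u) G)) ps vs).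
  rewrite insA_fmul_genA insAC// fmulNr fE oppfE opprK /fscale.
  over.
rewrite big_split /= IH; last exact: tens_insA.
rewrite -(tens_sumA _ (fun u => db_form b u a) (db_vec b))// -db_sum.
have /(congr1 (fun F => F ps vs)) := insAZ chi a tG; rewrite /insA /fscale => ->.
by rewrite -natr1; ring.
Qed.

Lemma Euler_F (chi : C) (b : dual_basis SF chi) G : tens G ->
  forall ps vs, (\sum_i fmul (genF (db_form b i)) (insF (db_vec b i) G)) ps vs =
                (size vs)%:R * (chi * G ps vs).
Proof.
move=> tG ps vs; rewrite sumfE; elim: vs G tG => [|a vs IH] G tG.
  rewrite mul0r big1// => u _; rewrite /fmul big1// => w _.
  by rewrite big_seq1 /= /genF; case: w.2.1 => [|? ?]; rewrite ?mul0r ?mulr0.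
under eq_bigr => u _.
  rewrite -[fmul _ _ _ _]/(insF a (fmul (genF (db_form b u)) (insF (db_vec b u) G)) ps vs).
  rewrite insF_fmul_genF insFC// fE /fscale.
  over.
rewrite big_split /= IH; last exact: tens_insF.
rewrite -(tens_sumF _ (fun u => db_form b u a) (db_vec b))// -db_sum.
have /(congr1 (fun F => F ps vs)) := insFZ chi a tG; rewrite /insF /fscale => ->.
by rewrite -natr1; ring.
Qed.

Definition acochain G :=
  tens G /\ exists N, supported (fun n => (n <= N)%N) G.

Definition bihom (p q : nat) G :=
  tens G /\ forall ps vs, ~~ ((size ps == p) && (size vs == q)) -> G ps vs = 0.

Lemma bihom_supported p q G : bihom p q G -> supported (pred1 (p + 2 * q)) G.
Proof.
move=> [_ G0] ps vs n; apply: G0; apply: contra n => /andP[/eqP -> /eqP ->].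
exact: eqxx.
Qed.

Lemma bihom_acochain p q G : bihom p q G -> acochain G.
Proof.
move=> bG; split; first by case: bG.
exists (p + 2 * q)%N => ps vs n; apply: (bihom_supported bG).
by apply: contra n => /= /eqP ->.
Qed.

Lemma bihom_insA p q a G : bihom p.+1 q G -> bihom p q (insA a G).
Proof.
by case=> tG G0; split; [exact: tens_insA|move=> ps vs n; apply: G0].
Qed.

Lemma bihom_insF p q a G : bihom p q.+1 G -> bihom p q (insF a G).
Proof.
by case=> tG G0; split; [exact: tens_insF|move=> ps vs n; apply: G0].
Qed.

Definition component (p q : nat) G : form := fun ps vs =>
  if (size ps == p) && (size vs == q) then G ps vs else 0.

Lemma bihom_component p q G : tens G -> bihom p q (component p q G).
Proof.
case=> l1 l2 l3 l4; split; last by move=> ps vs /negbTE n; rewrite /component n.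
split=> *; rewrite /component !size_cat /=; case: ifP => _ //;
  by rewrite ?l1 ?l2 ?l3 ?l4 ?mulr0 ?addr0.
Qed.

Lemma component_sum N G : supported (fun n => (n <= N)%N) G ->
  G = \sum_(p < N.+1) \sum_(q < N.+1) component p q G.
Proof.
move=> sG; apply: formP => ps vs; rewrite sumfE.
have [le|lt] := leqP (size ps + 2 * size vs) N; last first.
  rewrite sG -?ltnNge// big1// => p _; rewrite sumfE big1// => q _.
  by rewrite /component; case: ifP => // _; rewrite sG// -ltnNge.
have lp : (size ps < N.+1)%N by lia.
have lq : (size vs < N.+1)%N by lia.
rewrite (bigD1 (Ordinal lp))//= [X in _ + X]big1 ?addr0 => [|p np]; last first.
  rewrite sumfE big1// => q _; rewrite /component.
  case: eqP => //= E; case/eqP: np; exact: val_inj.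
rewrite sumfE (bigD1 (Ordinal lq))//= [X in _ + X]big1 ?addr0 => [|q np]; last first.
  rewrite /component andbC; case: eqP => //= E; case/eqP: np; exact: val_inj.
by rewrite /component /= !eqxx.
Qed.

Lemma acochain0 : acochain 0.
Proof. by split; [exact: tens0|exists 0%N]. Qed.

Lemma acochain_add G H : acochain G -> acochain H -> acochain (G + H).
Proof.
move=> [tG [N sG]] [tH [N' sH]]; split; first exact: tens_add.
exists (maxn N N') => ps vs n; rewrite fE sG ?sH ?addr0//.
  by apply: contra n => n; rewrite leq_max n orbT.
by apply: contra n => n; rewrite leq_max n.
Qed.

Lemma acochain_sum I (r : seq I) (F : I -> form) :
  (forall i, acochain (F i)) -> acochain (\sum_(i <- r) F i).
Proof.
move=> aF; elim: r => [|i r IH]; first by rewrite big_nil; exact: acochain0.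
by rewrite big_cons; exact: acochain_add.
Qed.

Lemma tens_genfun c : tens (genfun c : form).
Proof.
split.
- by move=> k a b [|? ?] *; rewrite /genfun /= mulr0 addr0.
- by move=> k a b [|? ?] [|? ?] *; rewrite /genfun /= mulr0 addr0.
- by move=> a [|? ?].
- by move=> a b [|? ?] [|? ?].
Qed.

Lemma tens_genA (th : SA -> C) : Clin th -> tens (genA th : form).
Proof.
move=> l; split.
- by move=> k a b [|? [|? ?]] [|? ?] [|? ?]; rewrite /genA /= ?mulr0 ?addr0//.
- by move=> k a b [|? [|? ?]] [|? ?] *; rewrite /genA /= mulr0 addr0.
- by move=> a [|? [|? ?]].
- by move=> a b [|? [|? ?]] [|? ?].
Qed.

Lemma tens_genF (be : SF -> C) : Clin be -> tens (genF be : form).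
Proof.
move=> l; split.
- by move=> k a b [|? ?] *; rewrite /genF /= mulr0 addr0.
- by move=> k a b [|? ?] [|? [|? ?]] [|? ?]; rewrite /genF /= ?mulr0 ?addr0//.
- by move=> a [|? ?].
- by move=> a b [|? ?] [|? [|? ?]].
Qed.

Lemma bihom_genfun c : bihom 0 0 (genfun c).
Proof. by split; [exact: tens_genfun|move=> [|? ?] [|? ?]]. Qed.

Lemma bihom_genA th : Clin th -> bihom 1 0 (genA th).
Proof. by split; [exact: tens_genA|move=> [|? [|? ?]] [|? ?]]. Qed.

Lemma bihom_genF be : Clin be -> bihom 0 1 (genF be).
Proof. by split; [exact: tens_genF|move=> [|? ?] [|? [|? ?]]]. Qed.

(** Inserting an argument shifts the degree predicates, by 1 for an argument in A and by 2 for one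
    in F; hence P, Q and R vary in the induction. *)
Lemma supported_mul (P Q R : pred nat) G H :
  (forall m n, P m -> Q n -> R (m + n)%N) ->
  supported P G -> supported Q H -> supported R (fmul G H).
Proof.
move=> PQR sG sH ps vs; elim: ps P Q R PQR G H sG sH => [|a ps IH] P Q R PQR G H sG sH nR.
  elim: vs P Q R PQR G H sG sH nR => [|v vs IH] P Q R PQR G H sG sH nR.
    rewrite fmul_nil2; have [P0|nP] := boolP (P 0%N); last by rewrite sG ?mul0r.
    have [Q0|nQ] := boolP (Q 0%N); last by rewrite sH ?mulr0.
    by rewrite (PQR _ _ P0 Q0) in nR.
  rewrite -[LHS]/(insF v (fmul G H) [::] vs) insF_mul fE.
  have nR' : ~~ R (size ([::] : seq SA) + 2 * size vs).+2.
    by move: nR => /=; rewrite !add0n mulnS.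
  rewrite (IH (fun n => P n.+2) Q (fun n => R n.+2)) ?add0r//.
  - rewrite (IH P (fun n => Q n.+2) (fun n => R n.+2))//.
      by move=> m n Pm Qn; have := PQR _ _ Pm Qn; rewrite !addnS.
    by move=> qs ws n; apply: sH; rewrite /= mulnS add2n !addnS.
  - by move=> m n Pm Qn; have := PQR _ _ Pm Qn; rewrite !addSn.
  - by move=> qs ws n; apply: sG; rewrite /= mulnS add2n !addnS.
rewrite -[LHS]/(insA a (fmul G H) ps vs) insA_mul fE.
rewrite (IH (fun n => P n.+1) Q (fun n => R n.+1)) ?add0r//.
- rewrite (IH P (fun n => Q n.+1) (fun n => R n.+1))//.
    by move=> m n Pm Qn; have := PQR _ _ Pm Qn; rewrite addnS.
    by move=> qs ws n; rewrite /bar sG ?mulr0.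
  by move=> qs ws n; exact: sH.
- by move=> m n Pm Qn; have := PQR _ _ Pm Qn; rewrite addSn.
- by move=> qs ws n; exact: sG.
Qed.

Lemma acochain_mul G H : acochain G -> acochain H -> acochain (fmul G H).
Proof.
move=> [tG [N sG]] [tH [N' sH]]; split; first exact: tens_mul.
by exists (N + N')%N; apply: supported_mul sG sH => m n; exact: leq_add.
Qed.

(* A C-linear map on cochains which vanishes on functions and which commutes,
   up to scalars, with the product by a generator vanishes: by Euler's identity
   every cochain of bidegree (p, q) <> (0, 0) is locally, up to the factor p
   or q, a sum of products of generators with cochains of lower degree. *)
Lemma cochain_map_eq0 (I : Type) (chi : I -> C)
    (bA : forall i, dual_basis SA (chi i)) (bF : forall i, dual_basis SF (chi i))
    (X : form -> form) :
  (forall c, (forall i, chi i * c = 0) -> c = 0) ->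
  (forall n (c : C), n.+1%:R * c = 0 -> c = 0) ->
  (forall G H, acochain G -> acochain H -> X (G + H) = X G + X H) ->
  (forall c, X (genfun c) = 0) ->
  (forall c H, acochain H -> X (fmul (genfun c) H) = fmul (genfun c) (X H)) ->
  (forall th H, Clin th -> acochain H -> X H = 0 -> X (fmul (genA th) H) = 0) ->
  (forall be H, Clin be -> acochain H -> X H = 0 -> X (fmul (genF be) H) = 0) ->
  forall G, acochain G -> X G = 0.
Proof.
move=> chi0 charC XD Xf Xc XA XF.
have X0 : X 0 = 0.
  by apply: (addrI (X 0)); rewrite -XD ?addr0; try exact: acochain0.
have Xsum (J : Type) (r : seq J) (F : J -> form) : (forall j, acochain (F j)) ->
    X (\sum_(j <- r) F j) = \sum_(j <- r) X (F j).
  move=> aF; elim: r => [|j r IH]; first by rewrite !big_nil.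
  by rewrite !big_cons XD ?IH//; exact: acochain_sum.
(* X commutes with multiplication by functions, so the Euler factor (n + 1) chi_i passes through X;
   [charC] then removes the integer. *)
have Xcancel n i G : acochain G -> X (fscale (n.+1%:R * chi i) G) = 0 ->
    forall ps vs, chi i * X G ps vs = 0.
  move=> aG; rewrite -fmul_genfun Xc// fmul_genfun => E ps vs.
  by apply: (charC n); have := congr1 (fun F => F ps vs) E; rewrite /fscale mulrA.
(* Induction on the number p + q of arguments, which every insertion lowers by one; Euler's identity
   is used in A if p > 0 and in F otherwise. *)
have Xbi n p q G : (p + q = n)%N -> bihom p q G -> X G = 0.
  elim: n p q G => [|n IH] p q G.
    case: p q => [|p] [|q]// _ [_ G0].
    rewrite -(_ : genfun (G [::] [::]) = G) ?Xf//.
    by apply: formP => -[|? ?] [|? ?] //; rewrite [RHS]G0.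
  move=> pqn bG; have aG := bihom_acochain bG; have [tG G0] := bG.
  case: p pqn bG G0 => [|p] pqn bG G0; last first.
    apply: formP => ps vs; apply: chi0 => i; apply: (@Xcancel p) => //.
    (* Euler's identity has the factor [size qs]; it may be replaced by p + 1 since G vanishes on
       lists of any other length. *)
    have -> : fscale (p.+1%:R * chi i) G =
        \sum_j fmul (genA (db_form (bA i) j)) (insA (db_vec (bA i) j) G).
      apply: formP => qs ws; rewrite Euler_A// /fscale mulrA.
      have [/eqP <- //|nq] := boolP (size qs == p.+1).
      by rewrite G0 ?(negbTE nq)// !mulr0.
    have biA j := bihom_insA (db_vec (bA i) j) bG.
    rewrite Xsum; last first.
      move=> j; apply: acochain_mul; last exact: bihom_acochain (biA j).
      exact: bihom_acochain (bihom_genA (db_lin (bA i) j)).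
    rewrite big1// => j _; apply: XA; first exact: db_lin.
      exact: bihom_acochain (biA j).
    by apply: IH (biA j); case: pqn.
  case: q pqn bG G0 => [|q] pqn bG G0; first by [].
  apply: formP => ps vs; apply: chi0 => i; apply: (@Xcancel q) => //.
  have -> : fscale (q.+1%:R * chi i) G =
      \sum_j fmul (genF (db_form (bF i) j)) (insF (db_vec (bF i) j) G).
    apply: formP => qs ws; rewrite Euler_F// /fscale mulrA.
    have [/eqP <- //|nq] := boolP (size ws == q.+1).
    by rewrite G0 ?(negbTE nq) ?andbF// !mulr0.
  have biF j := bihom_insF (db_vec (bF i) j) bG.
  rewrite Xsum; last first.
    move=> j; apply: acochain_mul; last exact: bihom_acochain (biF j).
    exact: bihom_acochain (bihom_genF (db_lin (bF i) j)).
  rewrite big1// => j _; apply: XF; first exact: db_lin.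
    exact: bihom_acochain (biF j).
  by apply: IH (biF j); move: pqn; rewrite !add0n => -[].
move=> G [tG [N sG]]; rewrite (component_sum sG).
have aC p q := bihom_acochain (bihom_component p q tG).
rewrite Xsum => [|p]; last by apply: acochain_sum => q; exact: aC.
rewrite big1// => p _; rewrite Xsum// big1// => q _.
exact: Xbi (bihom_component p q tG).
Qed.

(** * Agreement of the recursion with the global formula for D *)

Definition Dcov (a : SA) G (ps : seq SA) (vs : seq SF) : C :=
  rho a (G ps vs) -
  \sum_(j < size vs) G ps (set_nth 0 vs j (nab a (nth 0 vs j))).

Lemma lieE a G ps vs : lie a G ps vs =
  Dcov a G ps vs - \sum_(i < size ps) G (set_nth 0 ps i (lbr a (nth 0 ps i))) vs.
Proof.
elim: ps G => [|b ps IH] G.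
  rewrite big_ord0 subr0 /Dcov /=; move: (G [::]) => {}G.
  elim: vs G => [|v vs IH] G /=; first by rewrite big_ord0 subr0.
  by rewrite IH big_ord_recl /=; ring.
rewrite -[LHS]/(lie a (insA b G) ps vs - G (lbr a b :: ps) vs) IH /Dcov.
by rewrite [in RHS]big_ord_recl /= /insA; ring.
Qed.

(** Bringing the i-th argument to the front takes i transpositions. *)
Lemma set_nth_rem G ps i x vs : tens G -> (i < size ps)%N ->
  G (set_nth 0 ps i x) vs = (-1) ^+ i * G (x :: rem_at i ps) vs.
Proof.
elim: ps i G => [|b ps IH] [|i] G tG //= lt.
  by rewrite expr0 mul1r /rem_at /= drop0.
rewrite -[LHS]/(insA b G (set_nth 0 ps i x) vs) (IH i)//; last exact: tens_insA.
have := congr1 (fun F => F (rem_at i ps) vs) (insAC x b tG).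
by rewrite fE /insA exprS /= => ->; ring.
Qed.

Definition Dform G (ps : seq SA) (vs : seq SF) : C :=
  \sum_(i < size ps) (-1) ^+ i * Dcov (nth 0 ps i) G (rem_at i ps) vs +
  \sum_(j < size ps) \sum_(i < j) (-1) ^+ (i + j) *
     G (lbr (nth 0 ps i) (nth 0 ps j) :: rem_at i (rem_at j ps)) vs.

(** Terms in which the first argument a is differentiated along or bracketed add up to [lie a G];
    the others form minus the same formula for [insA a G]. This is Cartan's recursion. *)
Lemma DformE G ps vs : tens G -> Dform G ps vs = Dop G ps vs.
Proof.
elim: ps G => [|a ps IH] G tG; first by rewrite /Dform !big_ord0 addr0.
rewrite -[RHS]/(insA a (Dop G) ps vs) insA_Dop fE oppfE -IH; last exact: tens_insA.
rewrite /Dform lieE; set n := size ps.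
have rem0 (s : seq SA) b : rem_at 0 (b :: s) = s by rewrite /rem_at /= drop0.
have -> : \sum_(i < n.+1) (-1) ^+ i *
    Dcov (nth 0 (a :: ps) i) G (rem_at i (a :: ps)) vs = Dcov a G ps vs -
    \sum_(i < n) (-1) ^+ i * Dcov (nth 0 ps i) (insA a G) (rem_at i ps) vs.
  rewrite big_ord_recl -sumrN expr0 mul1r rem0; congr (_ + _).
  by apply: eq_bigr => i _; rewrite lift0 exprS /Dcov /rem_at /insA /=; ring.
have -> : \sum_(i < n) G (set_nth 0 ps i (lbr a (nth 0 ps i))) vs =
    \sum_(i < n) (-1) ^+ i * G (lbr a (nth 0 ps i) :: rem_at i ps) vs.
  by apply: eq_bigr => i _; rewrite set_nth_rem.
(* j = 0 has no i below it. For j > 0 the index i = 0 gives the brackets with a; for i > 0, a stands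
   behind the bracket, and moving it to the front costs the sign of [insAC]. *)
have -> : \sum_(j < n.+1) \sum_(i < j) (-1) ^+ (i + j) *
     G (lbr (nth 0 (a :: ps) i) (nth 0 (a :: ps) j) ::
        rem_at i (rem_at j (a :: ps))) vs =
    - (\sum_(i < n) (-1) ^+ i * G (lbr a (nth 0 ps i) :: rem_at i ps) vs) -
    \sum_(j < n) \sum_(i < j) (-1) ^+ (i + j) *
     insA a G (lbr (nth 0 ps i) (nth 0 ps j) :: rem_at i (rem_at j ps)) vs.
  rewrite big_ord_recl big_ord0 add0r -!sumrN -big_split; apply: eq_bigr => j _.
  rewrite lift0 big_ord_recl add0n; congr (_ + _).
    by rewrite exprS -[rem_at _ (a :: ps)]/(a :: rem_at j ps) rem0 /=; ring.
  rewrite -sumrN; apply: eq_bigr => i _; rewrite lift0 addSn addnS !exprS.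
  have := congr1 (fun F => F (rem_at i (rem_at j ps)) vs)
    (insAC (lbr (nth 0 ps i) (nth 0 ps j)) a tG).
  by rewrite oppfE /insA => E; rewrite E /rem_at /=; ring.
ring.
Qed.

(** * The square of the differential, and uniqueness of derivations *)

Section Square.
Variables (I : Type) (chi : I -> C).
Variables (bA : forall i, dual_basis SA (chi i)) (bF : forall i, dual_basis SF (chi i)).
Hypothesis chi0 : forall c, (forall i, chi i * c = 0) -> c = 0.
Hypothesis charC : forall n (c : C), n.+1%:R * c = 0 -> c = 0.

(** The cross terms bar(dG) dH and d(bar G) dH are opposite, because d anticommutes with [bar]. *)
Lemma dop2_gen_mul G H : dop (dop G) = 0 ->
  dop (dop (fmul G H)) = fmul G (dop (dop H)).
Proof.
case: dop_der => dD _ db dM G0.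
rewrite dM dD !dM G0 /= db fmul0l add0r expr1 fscaleN1 fmulNl barK.
by rewrite addrA subrr add0r.
Qed.

Lemma dop2_eq0 G : acochain G -> dop (dop G) = 0.
Proof.
move: G; apply: (cochain_map_eq0 (X := fun G => dop (dop G)) bA bF chi0 charC).
- by move=> {}G H _ _; case: dop_der => dD _ _ _; rewrite !dD.
- by move=> c; exact: dop2_genfun.
- by move=> c H _; rewrite dop2_gen_mul// dop2_genfun.
- by move=> th H thl _ E; rewrite dop2_gen_mul ?E ?fmul0r//; exact: dop2_genA.
- by move=> be H thl _ E; rewrite dop2_gen_mul ?E ?fmul0r//; exact: dop2_genF.
Qed.

(** Weaker than [is_der]: only what an [odd_derivative], constrained on cochains alone, transfers
    to. For bidegree (p, q) the Leibniz sign is (-1)^p. *)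
Record aderivation (X : form -> form) : Prop := ADerivation {
  ad_add : forall G H, acochain G -> acochain H -> X (G + H) = X G + X H;
  ad_mul : forall p q G H, bihom p q G -> acochain H ->
    X (fmul G H) = fmul (X G) H + fscale ((-1) ^+ p) (fmul G (X H)) }.

(** X - Y is C-linear as both maps kill functions, and it commutes up to sign with products by
    generators on which X and Y agree, so [cochain_map_eq0] applies. *)
Lemma aderivation_eq X Y : aderivation X -> aderivation Y ->
  (forall c, X (genfun c) = 0) -> (forall c, Y (genfun c) = 0) ->
  (forall th, Clin th -> X (genA th) = Y (genA th)) ->
  (forall be, Clin be -> X (genF be) = Y (genF be)) ->
  forall G, acochain G -> X G = Y G.
Proof.
move=> [XD XM] [YD YM] X0 Y0 EA EF G aG; apply/eqP; rewrite -subr_eq0; apply/eqP.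
move: G aG; apply: (cochain_map_eq0 (X := fun G => X G - Y G) bA bF chi0 charC).
- by move=> G H aG aH; rewrite XD// YD//; zmodule.
- by move=> c; rewrite X0 Y0 subrr.
- move=> c H aH; rewrite (XM _ _ _ _ (bihom_genfun c) aH).
  rewrite (YM _ _ _ _ (bihom_genfun c) aH) X0 Y0 fmul0l !add0r expr0 !fscale1.
  by rewrite fmulDr fmulNr.
- move=> th H thl aH E; rewrite (XM _ _ _ _ (bihom_genA thl) aH).
  rewrite (YM _ _ _ _ (bihom_genA thl) aH) EA// -(subrK (Y H) (X H)) E add0r.
  by rewrite subrr.
- move=> be H bel aH E; rewrite (XM _ _ _ _ (bihom_genF bel) aH).
  rewrite (YM _ _ _ _ (bihom_genF bel) aH) EF// -(subrK (Y H) (X H)) E add0r.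
  by rewrite subrr.
Qed.

End Square.

End Differential.
Arguments db_form {C V c} d i s.
Arguments db_vec {C V c} d i.
Arguments db_lin {C V c} d i.
Arguments db_sum {C V c} d s.

(** * Smooth functions *)

Section DiffLocal.
Variables (R : realType) (V W : normedModType R).

(** Locality of the differential reduces to this case: functions that agree near x differ by one
    vanishing near x. *)
Lemma is_diff_near0 (h : V -> W) (x : V) : (\forall y \near x, h y = 0) ->
  is_diff x h 0.
Proof.
(* The differential of a constant serves as the zero map already equipped with its linear
   structure. *)
move=> h0; pose z := 'd (cst (0 : W)) x.
have z0 : z = 0 :> (V -> W) by exact: diff_cst.
have zc : continuous z by rewrite z0 => y; exact: cvg_cst.
have E : h \o shift x = cst (h x) + z +o_ 0 id.
  apply/eqaddoP => e e0; rewrite /= !fctE (nbhs_singleton h0).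
  have : \forall y \near (0 : V), h (y + x) = 0.
    by have := h0; rewrite (near_shift 0) subr0.
  apply: filterS => y /= hy; rewrite z0 /cst hy.
  by rewrite (_ : (0 : V -> W) y = 0)// addr0 subrr normr0 mulr_ge0// ltW.
have dh : 'd h x = z :> (V -> W) by exact: diff_unique.
by split; [apply/diff_locallyP; rewrite dh|rewrite dh z0].
Qed.

Lemma near_is_diff (f g : V -> W) (x : V) : (\forall y \near x, f y = g y) ->
  differentiable f x -> is_diff x g ('d f x).
Proof.
move=> fg df; have -> : g = f + (g - f) by rewrite addrC subrK.
have dh : is_diff x (g - f) 0.
  by apply: is_diff_near0; apply: filterS fg => y fgy; rewrite !fctE fgy subrr.
have H := is_diffD (differentiableP df) dh.
by split; [exact: (@ex_diff _ _ _ _ _ _ _ H)|rewrite (@diff_val _ _ _ _ _ _ _ H) addr0].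
Qed.

Lemma near_diffE (f g : V -> W) (x : V) : (\forall y \near x, f y = g y) ->
  differentiable f x -> 'd g x = 'd f x :> (V -> W).
Proof. by move=> fg df; have [] := near_is_diff fg df. Qed.

End DiffLocal.

Section DiffReal.
Variables (R : realType) (V : normedModType R).
Implicit Types (f g : V -> R).

Lemma diff_addE f g x v : differentiable f x -> differentiable g x ->
  'd (fun y => f y + g y) x v = 'd f x v + 'd g x v.
Proof. by move=> df dg; rewrite -[X in diff _ X]/(f + g) diffD. Qed.

Lemma diff_mulE f g x v : differentiable f x -> differentiable g x ->
  'd (fun y => f y * g y) x v = f x * 'd g x v + g x * 'd f x v.
Proof. by move=> df dg; rewrite -[X in diff _ X]/(f * g) diffM. Qed.

Lemma diff_invE f x v : differentiable f x -> f x != 0 ->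
  'd (fun y => (f y)^-1) x v = - 1 * ((f x)^-1 * (f x)^-1 * 'd f x v).
Proof.
move=> df f0; rewrite diffV//= mulN1r -scaleNr.
by rewrite expr2 invfM.
Qed.

End DiffReal.

Lemma diff_coordE (R : realType) n (y v : 'rV[R]_n) j :
  'd (fun z : 'rV[R]_n => z 0 j) y v = v 0 j.
Proof.
have @f : {linear 'rV[R]_n -> R}.
  by exists (fun N : 'rV[R]_n => N 0 j); do 2![eexists]; do ?[constructor];
     rewrite ?mxE// => ? *; rewrite ?mxE//; move=> ?; rewrite !mxE.
by rewrite (@diff_lin _ _ _ f)//; exact: coord_continuous.
Qed.

Section ClassC.
Variables (R : realType) (n : nat).
Implicit Types (k : nat) (V W : set 'rV[R]_n) (f g : 'rV[R]_n -> R).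

(** [class_C] only speaks of f and its iterated derivatives, functions on the whole space, at the
    points of V; so it is pointwise in V and V may be any set. *)
Lemma class_C_local k V f :
  (forall y, V y -> exists W, W y /\ class_C k W f) -> class_C k V f.
Proof.
elim: k f => [|k IH] f H; first by move=> y /H[W [Wy Wc]]; exact: Wc.
split=> [y /H[W [Wy [dW _]]]|v]; first exact: dW.
by apply: IH => y /H[W [Wy [_ dW]]]; exists W; split=> //; exact: dW.
Qed.

Lemma class_C_sub k V W f : V `<=` W -> class_C k W f -> class_C k V f.
Proof. by move=> VW Wf; apply: class_C_local => y /VW Wy; exists W. Qed.

Lemma class_C_ext k V f g : open V -> (forall y, V y -> f y = g y) ->
  class_C k V f -> class_C k V g.
Proof.
move=> oV; elim: k f g => [|k IH] f g fg; have nfg y : V y -> \forall z \near y, f z = g z.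
- by move=> Vy; apply: (filterS fg); exact: open_nbhs_nbhs.
- move=> fc y Vy; have H := fc y Vy; rewrite /prop_for /continuous_at -(fg y Vy).
  exact: (cvg_trans (near_eq_cvg (nfg y Vy)) H).
- by move=> Vy; apply: (filterS fg); exact: open_nbhs_nbhs.
case=> df Cf; split=> [y Vy|v]; first by case: (near_is_diff (nfg _ Vy) (df y Vy)).
apply: IH (Cf v) => y Vy.
exact/esym/(congr1 (@^~ v))/(near_diffE (nfg _ Vy) (df y Vy)).
Qed.

Lemma class_C_pred k V f : class_C k.+1 V f -> class_C k V f.
Proof.
elim: k f => [|k IH] f [df Cf].
  by move=> y /df; exact: differentiable_continuous.
by split=> // v; exact: IH (Cf v).
Qed.

Lemma class_C_cst k V (c : R) : open V -> class_C k V (cst c).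
Proof.
move=> oV; elim: k c => [|k IH] c; first by move=> y _; exact: cst_continuous.
split=> [y _|v]; first exact: differentiable_cst.
by apply: class_C_ext (IH 0) => // y _; rewrite diff_cst.
Qed.

Lemma class_C_add k V f g : open V -> class_C k V f -> class_C k V g ->
  class_C k V (fun y => f y + g y).
Proof.
move=> oV; elim: k f g => [|k IH] f g.
  by move=> fc gc y Vy; apply: continuousD; [exact: fc|exact: gc].
move=> [df Cf] [dg Cg]; split=> [y Vy|v].
  by apply: differentiableD; [exact: df|exact: dg].
apply: class_C_ext (IH _ _ (Cf v) (Cg v)) => // y Vy.
exact: esym (diff_addE v (df y Vy) (dg y Vy)).
Qed.

Lemma class_C_mul k V f g : open V -> class_C k V f -> class_C k V g ->
  class_C k V (fun y => f y * g y).
Proof.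
move=> oV; elim: k f g => [|k IH] f g.
  by move=> fc gc y Vy; apply: continuousM; [exact: fc|exact: gc].
move=> fC gC; have [[df Cf] [dg Cg]] := (fC, gC); split=> [y Vy|v].
  by apply: differentiableM; [exact: df|exact: dg].
apply: class_C_ext (class_C_add oV (IH _ _ (class_C_pred fC) (Cg v))
                              (IH _ _ (class_C_pred gC) (Cf v))) => // y Vy.
exact: esym (diff_mulE v (df y Vy) (dg y Vy)).
Qed.

Lemma class_C_sum k V (I : Type) (r : seq I) (F : I -> 'rV[R]_n -> R) : open V ->
  (forall i, class_C k V (F i)) -> class_C k V (fun y => \sum_(i <- r) F i y).
Proof.
move=> oV CF; elim: r => [|i r IH].
  by apply: class_C_ext (class_C_cst k 0 oV) => // y _; rewrite big_nil.
by apply: class_C_ext (class_C_add oV (CF i) IH) => // y _; rewrite big_cons.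
Qed.

Lemma class_C_coord k V (j : 'I_n) : open V -> class_C k V (fun y => y 0 j).
Proof.
move=> oV; case: k => [|k]; first by move=> y _; exact: coord_continuous.
split=> [y _|v]; first exact: differentiable_coord.
apply: class_C_ext (class_C_cst k (v 0 j) oV) => // y _.
by rewrite diff_coordE.
Qed.

Lemma class_C_inv k V f : open V -> (forall y, V y -> f y != 0) ->
  class_C k V f -> class_C k V (fun y => (f y)^-1).
Proof.
move=> oV f0; elim: k => [|k IH].
  by move=> fc y Vy; apply: continuousV; [exact: f0|exact: fc].
move=> fC; have [df Cf] := fC; split=> [y Vy|v].
  by apply: differentiableV; [exact: df|exact: f0].
have Ci := IH (class_C_pred fC).
apply: class_C_ext (class_C_mul oV (class_C_cst k (-1) oV)
  (class_C_mul oV (class_C_mul oV Ci Ci) (Cf v))) => // y Vy.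
exact: esym (diff_invE v (df y Vy) (f0 y Vy)).
Qed.

End ClassC.

Lemma diff_compE (R : realType) (U V W : normedModType R) (G : U -> V)
    (f : V -> W) y v : differentiable G y -> differentiable f (G y) ->
  'd (fun z => f (G z)) y v = 'd f (G y) ('d G y v).
Proof. by move=> dG df; have /(congr1 (@^~ v)) := diff_comp dG df. Qed.

Section RowValued.
Variables (R : realType) (V : normedModType R) (m : nat).

Lemma differentiable_row (G : V -> 'rV[R]_m) x :
  (forall j, differentiable (fun y => G y 0 j) x) -> differentiable G x.
Proof.
move=> dG; have -> : G = \sum_(j < m) (fun y => G y 0 j *: delta_mx 0 j).
  by apply/funext => y; rewrite fct_sumE -row_sum_delta.
by apply: differentiable_sum => j; apply: differentiableZl.
Qed.

Lemma diff_row_coord (G : V -> 'rV[R]_m) x v j : differentiable G x ->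
  ('d G x v) 0 j = 'd (fun y => G y 0 j) x v.
Proof.
move=> dG.
have @f : {linear 'rV[R]_m -> R}.
  by exists (fun N : 'rV[R]_m => N 0 j); do 2![eexists]; do ?[constructor];
     rewrite ?mxE// => ? *; rewrite ?mxE//; move=> ?; rewrite !mxE.
have fc : continuous f by exact: coord_continuous.
have := diff_comp dG (@linear_differentiable _ _ _ f (G x) fc).
by rewrite (diff_lin _ fc) => /(congr1 (@^~ v)) => ->.
Qed.

End RowValued.

Section DiffRow.
Variables (R : realType) (m : nat) (W : normedModType R).

Lemma diff_basis (f : 'rV[R]_m -> W) x v :
  'd f x v = \sum_j v 0 j *: 'd f x (delta_mx 0 j).
Proof.
by rewrite {1}[v]row_sum_delta linear_sum; apply: eq_bigr => j _; rewrite linearZ.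
Qed.
End DiffRow.

Section Composition.
Variables (R : realType) (n m : nat).

Lemma class_Coo_diff (V : set 'rV[R]_n) (f : 'rV[R]_n -> R) y :
  class_Coo V f -> V y -> differentiable f y.
Proof. by move=> /(_ 1%N)[df _]; exact: df. Qed.

(** By the chain rule, the derivative of f o G along v is the sum of the (dG_j v)(d_j f o G); the
    induction hypothesis covers the partial derivatives of f. *)
Lemma class_C_comp k (V : set 'rV[R]_n) (W : set 'rV[R]_m) (f : 'rV[R]_m -> R)
    (G : 'rV[R]_n -> 'rV[R]_m) : open V -> (forall y, V y -> W (G y)) ->
  (forall j, class_Coo V (fun y => G y 0 j)) -> class_C k W f ->
  class_C k V (fun y => f (G y)).
Proof.
move=> oV VW CG; have dG y : V y -> differentiable G y.
  by move=> Vy; apply: differentiable_row => j; exact: class_Coo_diff Vy.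
elim: k f => [|k IH] f.
  move=> fc y Vy; apply: continuous_comp; last exact: fc (VW _ Vy).
  exact: differentiable_continuous (dG y Vy).
move=> [df Cf]; split=> [y Vy|v].
  by apply: differentiable_comp; [exact: dG|exact: df (VW _ Vy)].
have C1 j : class_C k V (fun y => 'd (fun z => G z 0 j) y v).
  by have [_] := CG j k.+1; exact.
have C2 := class_C_sum (index_enum 'I_m) oV
  (fun j => class_C_mul oV (C1 j) (IH _ (Cf (delta_mx 0 j)))).
apply: class_C_ext C2 => // y Vy.
apply: etrans (esym (diff_compE v (dG y Vy) (df _ (VW _ Vy)))).
rewrite diff_basis; apply: eq_bigr => j _.
by rewrite diff_row_coord//; exact: dG.
Qed.

End Composition.

(** * Flat functions and bump functions *)

Section Flat.
Variable R : realType.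

(** t^(-k) exp(-1/t) for t > 0, extended by 0. All powers k are kept because derivatives of members
    of this family are combinations of members, which turns smoothness into an induction. *)
Definition flat_exp (k : nat) (t : R) : R :=
  if 0 < t then t^-1 ^+ k * expR (- t^-1) else 0.

(** From exp s >= s^(k+2) / (k+2)! at s = 1/t. The exponent 2 makes the function o(t), hence of zero
    derivative at 0. *)
Lemma flat_exp_bound k : exists K : R, 0 < K /\ forall t, `|flat_exp k t| <= K * t ^+ 2.
Proof.
exists (k.+2)`!%:R; split; first by rewrite ltr0n fact_gt0.
move=> t; rewrite /flat_exp; case: ifPn => [t0|_]; last first.
  by rewrite normr0 mulr_ge0// ?ler0n// sqr_ge0.
have s0 : 0 < t^-1 by rewrite invr_gt0.
rewrite ger0_norm; last by rewrite mulr_ge0 ?expR_ge0// exprn_ge0// ltW.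
have := expR_ge1Dxn k.+1 (ltW s0); rewrite expRN => E.
rewrite ler_pdivrMr ?expR_gt0//.
have F0 : 0 < (k.+2`!%:R : R) by rewrite ltr0n fact_gt0.
have E2 : t^-1 ^+ k.+2 <= k.+2`!%:R * expR t^-1.
  rewrite -ler_pdivrMl// mulrC; apply: le_trans E; rewrite lerDr.
  exact: ler01.
have -> : t^-1 ^+ k = t ^+ 2 * t^-1 ^+ k.+2.
  have tn : t != 0 by rewrite gt_eqF.
  by rewrite -[k.+2]addn2 exprD mulrCA -exprMn mulfV// expr1n mulr1.
have -> : k.+2`!%:R * t ^+ 2 * expR t^-1 = t ^+ 2 * (k.+2`!%:R * expR t^-1) by ring.
exact: ler_wpM2l (sqr_ge0 t) _ _ E2.
Qed.

Lemma is_derive_flat_exp k (t : R) :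
  is_derive t 1 (flat_exp k) (flat_exp k.+2 t - k%:R * flat_exp k.+1 t).
Proof.
have [t0|t0|<-] := ltgtP 0 t.
- rewrite /flat_exp t0.
  have tn : t != 0 by rewrite gt_eqF.
  have dI : is_derive t 1 (fun u : R => u^-1) (- t ^- 2).
    apply: DeriveDef; first exact: derivableV.
    by rewrite deriveV// derive_id; rewrite /GRing.scale /= mulr1.
  (* For t > 0 the function is s^k exp(-s) at s = 1/t. *)
  have dP (s : R) : is_derive s 1 (fun s : R => s ^+ k * expR (- s))
      (s ^+ k * - expR (- s) + expR (- s) * (k%:R * s ^+ k.-1)).
    have dN : is_derive s 1 (fun u : R => expR (- u)) (expR (- s) * - 1).
      exact: (@is_derive1_comp _ expR (fun u => - u)).
    have dX : is_derive s 1 (fun u : R => u ^+ k) (k%:R * s ^+ k.-1).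
      by apply: DeriveDef; [exact: exprn_derivable|rewrite exp_derive /GRing.scale /= mulr1].
    by rewrite -[- expR (- s)]mulrN1; exact: (is_deriveM dX dN).
  have H := @is_derive1_comp _ _ _ _ _ _ (dP t^-1) dI.
  have -> : t^-1 ^+ k.+2 * expR (- t^-1) - k%:R * (t^-1 ^+ k.+1 * expR (- t^-1)) =
    (t^-1 ^+ k * - expR (- t^-1) + expR (- t^-1) * (k%:R * t^-1 ^+ k.-1)) * - t ^- 2.
    rewrite -[t ^- 2]exprVn; case: k {H dP} => [|k] /=.
      by rewrite !exprS expr0 mul0r; ring.
    by rewrite !exprS; ring.
  apply: near_eq_is_derive H.
  have : \forall s \near t, 0 < s by exact: lt_nbhsr.
  by apply: filterS => s s0; rewrite /= s0.
- have -> : flat_exp k.+2 t - k%:R * flat_exp k.+1 t = 0.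
    by rewrite /flat_exp ltNge (ltW t0)/= mulr0 subr0.
  apply: (@near_eq_is_derive _ _ _ (cst 0)).
  have : \forall s \near t, s < 0 by exact: lt_nbhsl.
  by apply: filterS => s s0; rewrite /flat_exp ltNge (ltW s0).
(* At the origin the quadratic bound gives the expansion with zero linear part. *)
- have -> : flat_exp k.+2 0 - k%:R * flat_exp k.+1 0 = 0.
    by rewrite /flat_exp ltxx mulr0 subr0.
  have [K [K0 HK]] := flat_exp_bound k.
  pose z := 'd (cst (0 : R)) (0 : R).
  have z0 : z = 0 :> (R -> R) by exact: diff_cst.
  have zc : continuous z by rewrite z0 => y; exact: cvg_cst.
  have E : flat_exp k \o shift 0 = cst (flat_exp k 0) + z +o_ 0 id.
    apply/eqaddoP => e e0.
    have Hle : \forall h \near (0 : R), `|h| <= e / K by apply: nbhs0_le; exact: divr_gt0.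
    near=> h.
    rewrite z0 /cst /= addr0 (_ : flat_exp k 0 = 0); last by rewrite /flat_exp ltxx.
    rewrite (_ : (_ - _) h = flat_exp k h); last by rewrite /= !fctE !addr0 subr0.
    apply: le_trans (HK h) _; rewrite -real_normK ?num_real// expr2 mulrA ler_wpM2r//.
    rewrite mulrC -ler_pdivlMr//; near: h.
    exact: Hle.
  have dh : 'd (flat_exp k) 0 = z :> (R -> R) by exact: diff_unique.
  have df : differentiable (flat_exp k) 0 by apply/diff_locallyP; rewrite dh.
  split; first exact/derivable1_diffP.
  by rewrite deriveE// dh z0.
Unshelve. all: by end_near.
Qed.

End Flat.

Section FlatDiff.
Variables (R : realType) (V : normedModType R).

Lemma diff_flatE k (q : V -> R) y v : differentiable q y ->
  differentiable (fun z => flat_exp k (q z)) y /\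
  'd (fun z => flat_exp k (q z)) y v =
  (flat_exp k.+2 (q y) + - k%:R * flat_exp k.+1 (q y)) * 'd q y v.
Proof.
move=> dq; have H := is_derive_flat_exp k (q y).
have df : differentiable (flat_exp (R := R) k) (q y).
  by apply/derivable1_diffP; case: H.
split; first exact: differentiable_comp.
rewrite (diff_compE v dq df) diff1E// derive1E.
case: H => _ ->.
by rewrite mulNr [RHS]mulrC.
Qed.

End FlatDiff.

Section Bump.
Variables (R : realType) (n : nat).

Lemma class_C_flat k i (V : set 'rV[R]_n) q : open V -> class_Coo V q ->
  class_C k V (fun y => flat_exp i (q y)).
Proof.
move=> oV qC; elim: k i => [|k IH] i.
  move=> y Vy; apply: differentiable_continuous.
  by case: (diff_flatE i 0 (class_Coo_diff qC Vy)).
split=> [y Vy|v]; first by case: (diff_flatE i 0 (class_Coo_diff qC Vy)).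
have C1 : class_C k V (fun y => 'd q y v) by have [_] := qC k.+1; exact.
have C2 := class_C_mul oV (class_C_add oV (IH i.+2)
  (class_C_mul oV (class_C_cst k (- i%:R) oV) (IH i.+1))) C1.
apply: class_C_ext C2 => // y Vy.
by case: (diff_flatE i v (class_Coo_diff qC Vy)) => _ E; exact: esym E.
Qed.

(** The flat function is applied to e^2 minus the squared Euclidean distance to p, a polynomial;
    where that is positive, each coordinate of y - p is below e, which bounds the sup norm. *)
Lemma bump_row (p : 'rV[R]_n) (e : R) : 0 < e -> exists b : 'rV[R]_n -> R,
  [/\ class_Coo setT b, 0 < b p & forall y, b y != 0 -> `|p - y| <= e].
Proof.
move=> e0; pose q (y : 'rV[R]_n) := e ^+ 2 - \sum_j (y 0 j - p 0 j) ^+ 2.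
exists (fun y => flat_exp 0 (q y)); split.
- move=> k; apply: class_C_flat; first exact: openT.
  move=> {}k; have oT := @openT 'rV[R]_n.
  have C0 j : class_C k setT (fun y : 'rV[R]_n => y 0 j + - p 0 j).
    by apply: class_C_add => //; [exact: class_C_coord|exact: class_C_cst].
  apply: (class_C_ext oT (f := fun y => e ^+ 2 +
     -1 * \sum_j ((y 0 j + - p 0 j) * (y 0 j + - p 0 j)))).
    by move=> y _; rewrite /q mulN1r; congr (_ - _); apply: eq_bigr => j _.
  apply: class_C_add => //; first exact: class_C_cst.
  apply: class_C_mul => //; first exact: class_C_cst.
  by apply: class_C_sum => // j; exact: class_C_mul.
- rewrite /flat_exp /q big1 => [|j _]; last by rewrite subrr expr0n.
  by rewrite subr0 exprn_gt0// expr0 mul1r expR_gt0.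
- move=> y; rewrite /flat_exp /q; case: ifPn => [lt _|]; last by rewrite eqxx.
  rewrite [`|_|]mx_normrE; apply: bigmax_le; first exact: ltW.
  case=> i j _ /=; rewrite !mxE ord1 distrC.
  rewrite -(@ler_pXn2r _ 2)// ?nnegrE//; last exact: ltW.
  rewrite real_normK ?num_real//; apply: ltW.
  move: lt; rewrite subr_gt0; apply: le_lt_trans.
  rewrite (bigD1 j)//= lerDl; apply: sumr_ge0 => l _; exact: sqr_ge0.
Qed.

End Bump.

(** * Smooth functions on a manifold *)

Section SmoothOn.
Variables (R : realType) (n : nat) (M : manifold R n).
Implicit Types (U W : set M) (f g : M -> R) (i c : chart M).

Lemma open_cimg U i : open U -> open (cmap i @` (U `&` cdom i)).
Proof.
move=> oU; rewrite openE => y [x [Ux dx] <-].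
have Vy : (cmap i @` cdom i) (cmap i x) by exists x.
have cc := cinv_continuous Vy.
have N1 : nbhs (cmap i x) (cinv i @^-1` U).
  by apply: cc; rewrite cmapK//; exact: open_nbhs_nbhs.
have N2 : nbhs (cmap i x) (cmap i @` cdom i).
  by apply: open_nbhs_nbhs; split=> //; exact: cimg_open.
apply: filterS2 N1 N2 => z /= Uz [x' dx' zE]; exists x' => //; split=> //.
by move: Uz; rewrite -zE cmapK.
Qed.

Arguments open_cimg {U} i _.

Lemma smooth_on_local U f :
  (forall x, U x -> exists W, [/\ W x & smooth_on W f]) -> smooth_on U f.
Proof.
move=> H i k; apply: class_C_local => y [x [Ux dx] <-].
have [W [Wx /(_ i k) sW]] := H x Ux.
by exists (cmap i @` (W `&` cdom i)); split=> //; exists x.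
Qed.

Lemma smooth_on_sub U W f : U `<=` W -> smooth_on W f -> smooth_on U f.
Proof. by move=> UW sf; apply: smooth_on_local => x /UW Wx; exists W. Qed.

Lemma smooth_on_ext U f g : open U -> (forall x, U x -> f x = g x) ->
  smooth_on U f -> smooth_on U g.
Proof.
move=> oU fg sf i k; apply: class_C_ext (sf i k); first exact: open_cimg.
by move=> _ [x [Ux dx] <-]; rewrite cmapK// fg.
Qed.

Lemma smooth_on_cst U (a : R) : open U -> smooth_on U (fun=> a).
Proof. by move=> oU i k; apply: class_C_cst; exact: open_cimg. Qed.

Lemma smooth_on_add U f g : open U -> smooth_on U f -> smooth_on U g ->
  smooth_on U (fun x => f x + g x).
Proof. by move=> oU sf sg i k; exact (class_C_add (open_cimg i oU) (sf i k) (sg i k)). Qed.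

Lemma smooth_on_mul U f g : open U -> smooth_on U f -> smooth_on U g ->
  smooth_on U (fun x => f x * g x).
Proof. by move=> oU sf sg i k; exact (class_C_mul (open_cimg i oU) (sf i k) (sg i k)). Qed.

Lemma smooth_on_sum U (I : Type) (r : seq I) (F : I -> M -> R) : open U ->
  (forall j, smooth_on U (F j)) -> smooth_on U (fun x => \sum_(j <- r) F j x).
Proof.
move=> oU sF i k; apply: (class_C_sum r); first exact: open_cimg.
by move=> j; exact: sF.
Qed.

Lemma smooth_on_inv U f : open U -> (forall x, U x -> f x != 0) ->
  smooth_on U f -> smooth_on U (fun x => (f x)^-1).
Proof.
move=> oU f0 sf i k; apply: (class_C_inv (open_cimg i oU) _ (sf i k)).
by move=> _ [x [Ux dx] <-]; rewrite cmapK// f0.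
Qed.

(** In any other chart, f is its expression in c composed with a transition map, which is smooth by
    [chart_compat]. *)
Lemma smooth_on_chart U c f : open U -> U `<=` cdom c ->
  class_Coo (cmap c @` U) (fun y => f (cinv c y)) -> smooth_on U f.
Proof.
move=> oU Uc Cf i k.
have oV := open_cimg i oU.
apply: (class_C_ext oV (f := fun y => f (cinv c (cmap c (cinv i y))))).
  by move=> _ [x [Ux dx] <-]; rewrite cmapK// cmapK//; exact: Uc.
apply: (class_C_comp (G := fun y => cmap c (cinv i y)) oV _ _ (Cf k)).
  by move=> _ [x [Ux dx] <-]; rewrite cmapK//; exists x.
move=> j l; apply: class_C_sub (chart_compat i c j l).
by move=> _ [x [Ux dx] <-]; exists x => //; split=> //; exact: Uc.
Qed.

Lemma smooth_on_continuous U f x : open U -> U x -> smooth_on U f ->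
  {for x, continuous f}.
Proof.
move=> oU Ux sf; pose c := chart_at x; have dx := chart_atP x.
have Cf : {for cmap c x, continuous (fun y => f (cinv c y))}.
  by apply: (sf c 0%N); exists x.
have H : {for x, continuous (fun z => f (cinv c (cmap c z)))}.
  by apply: (@continuous_comp _ _ _ (cmap c) (fun y => f (cinv c y))); [exact: cmap_continuous|exact: Cf].
rewrite /prop_for /continuous_at -[in X in _ --> X](cmapK dx).
apply: (cvg_trans _ H); apply: near_eq_cvg.
have := open_nbhs_nbhs (conj (cdom_open c) dx).
by apply: filterS => z dz; rewrite cmapK.
Qed.

(* Since chi is only required not to vanish at x, no plateau is needed. *)
Lemma bump_manifold W x : open W -> W x -> exists (chi : M -> R) (K : set M),
  [/\ smooth chi, closed K, K `<=` W, chi x != 0 &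
      forall z, ~ K z -> chi z = 0].
Proof.
move=> oW Wx; pose c := chart_at x; have dx : cdom c x by exact: chart_atP.
pose p := cmap c x.
have oO := open_cimg c oW.
have Op : (cmap c @` (W `&` cdom c)) p by exists x.
have /nbhs_closedballP[e He] := open_nbhs_nbhs (conj oO Op).
have e0 : 0 < e%:num by [].
have [b [bC bp b0]] := bump_row p e0.
pose K := cinv c @` closed_ball p e%:num.
have KW : K `<=` W.
  by move=> _ [y /He[z [Wz dz] <-] <-]; rewrite cmapK.
have Kd : K `<=` cdom c.
  by move=> _ [y /He[z [Wz dz] <-] <-]; rewrite cmapK.
(* M being Hausdorff, the compact K is closed, so the chart domain and the complement of K form an
   open cover; [chi] is smooth on the first and zero on the second. *)
have Kc : compact K.
  apply: continuous_compact.
    apply: continuous_in_subspaceT => y; rewrite inE => /He[z [Wz dz] zy].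
    by apply: cinv_continuous; exists z.
  apply: bounded_closed_compact.
    exists (`|p| + e%:num); split; first exact: num_real.
    move=> m ltm y; rewrite /= closed_ballE// /closed_ball_ /= => le.
    apply: (le_trans _ (ltW ltm)); rewrite -[y in leLHS](subrK p) addrC.
    by apply: (le_trans (ler_normD _ _)); rewrite lerD2l distrC.
  exact: closed_ball_closed.
have Kcl : closed K by apply: compact_closed Kc; exact: m_hausdorff.
pose chi z := if pselect (cdom c z) then b (cmap c z) else 0.
have chiE z : cdom c z -> chi z = b (cmap c z).
  by rewrite /chi; case: pselect.
have chi0 z : ~ K z -> chi z = 0.
  move=> nK; rewrite /chi; case: pselect => // dz; apply/eqP.
  apply: contrapT => /negP /b0 le; apply: nK; exists (cmap c z); last exact: cmapK.
  by rewrite closed_ballE.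
exists chi, K; split=> //.
- apply: smooth_on_local => z _; have [dz|nKz] := pselect (cdom c z).
    exists (cdom c); split=> //; have oc := cdom_open c.
    apply: (smooth_on_chart (c := c) oc) => //.
    have oV : open (cmap c @` cdom c) by exact: cimg_open.
    move=> k; refine (@class_C_ext _ _ k _ b (fun y => chi (cinv c y)) oV _ _).
      by move=> _ [w dw <-]; rewrite cmapK// chiE.
    exact: class_C_sub (@subsetT _ _) (bC k).
  exists (~` K); split; first by move=> /Kd.
  apply: (smooth_on_ext (f := fun=> 0)); first exact: closed_openC.
    by move=> w /chi0 ->.
  by apply: smooth_on_cst; exact: closed_openC.
- by rewrite chiE// gt_eqF.
Qed.

End SmoothOn.
Arguments open_cimg {R n M U} i _.

Lemma diff_mul_at (R : realType) (V : normedModType R) (f g : V -> R) x v a b :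
  differentiable f x -> differentiable g x -> f x = a -> g x = b ->
  'd (fun y => f y * g y) x v = a * 'd g x v + b * 'd f x v.
Proof. by move=> df dg <- <-; exact: diff_mulE. Qed.

(** * Tangent vectors as derivations *)

Section Tangent.
Variables (R : realType) (n : nat) (M : manifold R n).
Implicit Types (U W : set M) (f g : M -> R) (i c : chart M).

Lemma smooth_on_cutoff W (K : set M) chi f : open W -> smooth chi -> closed K ->
  K `<=` W -> (forall z, ~ K z -> chi z = 0) -> smooth_on W f ->
  smooth (fun z => chi z * f z).
Proof.
move=> oW sc cK KW chi0 sf; apply: smooth_on_local => z _.
have [Wz|nWz] := pselect (W z).
  exists W; split=> //; apply: smooth_on_mul => //.
  exact: smooth_on_sub (@subsetT _ _) sc.
exists (~` K); split; first by move=> /KW.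
have oK : open (~` K) by exact: closed_openC.
apply: (smooth_on_ext (f := fun=> 0) oK); first by move=> w /chi0 ->; rewrite mul0r.
exact: smooth_on_cst.
Qed.

Lemma smooth_on_cmap i (j : 'I_n) : smooth_on (cdom i) (fun z => cmap i z 0 j).
Proof.
have oc := cdom_open i; apply: (smooth_on_chart (c := i) oc) => // k.
have oV : open (cmap i @` cdom i) by exact: cimg_open.
refine (@class_C_ext _ _ k _ (fun y => y 0 j) _ oV _ _).
  by move=> _ [w dw <-]; rewrite cmapK.
exact: class_C_coord.
Qed.

Lemma smooth_on_diff U f x i : open U -> U x -> cdom i x -> smooth_on U f ->
  differentiable (fun y => f (cinv i y)) (cmap i x).
Proof. by move=> oU Ux dx sf; have [df _] := sf i 1%N; apply: df; exists x. Qed.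

Lemma transition_diff i c x : cdom i x -> cdom c x ->
  differentiable (fun y => cmap i (cinv c y)) (cmap c x).
Proof.
move=> di dc; apply: differentiable_row => j.
by have [df _] := chart_compat c i j 1%N; apply: df; exists x.
Qed.

Lemma vderE U f x i (v : tangent x) : open U -> U x -> cdom i x ->
  smooth_on U f ->
  vder v f = 'd (fun y => f (cinv i y)) (cmap i x) (tcoord i v).
Proof.
move=> oU Ux di sf; rewrite /vder /tcoord.
set c := chart_at x; have dc : cdom c x by exact: chart_atP.
have df := smooth_on_diff oU Ux di sf.
have dG := transition_diff di dc.
have E : cmap i (cinv c (cmap c x)) = cmap i x by rewrite cmapK.
have df' : differentiable (fun y => f (cinv i y)) (cmap i (cinv c (cmap c x))).
  by rewrite E.
have E2 := diff_compE v dG df'; rewrite E in E2.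
apply: etrans E2.
have N : \forall y \near cmap c x, f (cinv i (cmap i (cinv c y))) = f (cinv c y).
  have O : open (cmap c @` (cdom i `&` cdom c)).
    by apply: open_cimg; exact: cdom_open.
  have Ox : (cmap c @` (cdom i `&` cdom c)) (cmap c x) by exists x.
  apply: filterS (open_nbhs_nbhs (conj O Ox)).
  by move=> _ [z [zi zc] <-]; rewrite cmapK// cmapK.
have dfg : differentiable (fun y => f (cinv i (cmap i (cinv c y)))) (cmap c x).
  exact: (differentiable_comp dG df').
exact (congr1 (@^~ v) (near_diffE N dfg)).
Qed.

Lemma smooth_on_vder U f (X : forall x, tangent x) : open U ->
  smooth_vfield_on U X -> smooth_on U f -> smooth_on U (fun x => vder (X x) f).
Proof.
move=> oU sX sf; apply: smooth_on_local => x Ux; pose i := chart_at x.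
have di : cdom i x by exact: chart_atP.
have oW : open (U `&` cdom i) by apply: openI => //; exact: cdom_open.
exists (U `&` cdom i); split=> //.
apply: (smooth_on_ext (f := fun z => \sum_j tcoord i (X z) 0 j *
   'd (fun y => f (cinv i y)) (cmap i z) (delta_mx 0 j)) oW).
  move=> z [Uz dz]; rewrite (vderE _ oU Uz dz sf).
  exact: esym (diff_basis _ _ _).
apply: smooth_on_sum => // j; refine (smooth_on_mul oW (sX i j) _).
apply: (smooth_on_chart (c := i) oW) => [z []//|k].
have oV := open_cimg i oU.
refine (@class_C_ext _ _ k _ (fun y => 'd (fun y => f (cinv i y)) y (delta_mx 0 j)) _ oV _ _).
  by move=> _ [w [Uw dw] <-]; rewrite cmapK.
by have [_] := sf i k.+1; exact.
Qed.

Lemma vderD x (v : tangent x) f g : smooth f -> smooth g ->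
  vder v (fun y => f y + g y) = vder v f + vder v g.
Proof.
move=> sf sg; apply: diff_addE; apply: (smooth_on_diff openT) => //; exact: chart_atP.
Qed.

Lemma vderM x (v : tangent x) f g : smooth f -> smooth g ->
  vder v (fun y => f y * g y) = vder v f * g x + f x * vder v g.
Proof.
move=> sf sg; have dx := chart_atP x.
have df := smooth_on_diff openT (I : setT x) dx sf.
have dg := smooth_on_diff openT (I : setT x) dx sg.
rewrite addrC [vder v f * _]mulrC.
exact (diff_mul_at v df dg (congr1 f (cmapK dx)) (congr1 g (cmapK dx))).
Qed.

Lemma vder_lin x (a : R) (v w : tangent x) f :
  vder (a *: v + w) f = a * vder v f + vder w f.
Proof. exact: linearP. Qed.

(** Testing v on chi and on chi x_j gives chi(x) v_j = 0. This turns equalities tested on functions,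
    such as those of the anchor, into equalities of tangent vectors. *)
Lemma vder_eq0 x (v : tangent x) : (forall f, smooth f -> vder v f = 0) -> v = 0.
Proof.
move=> v0; apply/rowP => j; rewrite mxE; pose c := chart_at x.
have dx : cdom c x by exact: chart_atP.
have [chi [K [sc cK KW chix chi0]]] := bump_manifold (cdom_open c) dx.
have := v0 _ (smooth_on_cutoff (cdom_open c) sc cK KW chi0 (smooth_on_cmap c j)).
have := v0 _ sc; rewrite /vder -/c => vc0.
have d1 := smooth_on_diff openT (I : setT x) dx sc.
have d2 := smooth_on_diff (cdom_open c) dx dx (smooth_on_cmap c j).
have E1 := diff_mul_at v d1 d2 (congr1 chi (cmapK dx)) erefl.
have N : \forall y \near cmap c x, (y : 'rV[R]_n) 0 j = cmap c (cinv c y) 0 j.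
  have O : open (cmap c @` cdom c) by exact: cimg_open.
  have Ox : (cmap c @` cdom c) (cmap c x) by exists x.
  by apply: filterS (open_nbhs_nbhs (conj O Ox)) => _ [z zc <-]; rewrite cmapK.
have dj : differentiable (fun y : 'rV[R]_n => y 0 j) (cmap c x).
  exact: differentiable_coord.
have E2 := congr1 (@^~ (v : 'rV[R]_n)) (near_diffE N dj).
have E3 : 'd (fun y : 'rV[R]_n => y 0 j) (cmap c x) (v : 'rV[R]_n) = (v : 'rV[R]_n) 0 j.
  exact: diff_coordE.
move=> H; have {}H := etrans (esym E1) H; rewrite vc0 mulr0 addr0 in H.
move/eqP: H; rewrite mulf_eq0 (negbTE chix) => /eqP H.
exact: etrans (esym E3) (etrans (esym E2) H).
Qed.

End Tangent.

(** * Smooth sections *)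

Section BundleSections.
Variables (R : realType) (n : nat) (M : manifold R n) (E : vector_bundle M).
Implicit Types (U W : set M) (s : sect E) (k l : triv E).

Lemma open_tdomI U k : open U -> open (U `&` tdom k).
Proof. by move=> oU; apply: openI => //; exact: tdom_open. Qed.

Lemma smooth_sect_local U s :
  (forall x, U x -> exists W, [/\ W x & smooth_sect_on W s]) -> smooth_sect_on U s.
Proof.
move=> H k j; apply: smooth_on_local => x [Ux kx].
by have [W [Wx sW]] := H x Ux; exists (W `&` tdom k); split.
Qed.

Lemma smooth_sect_sub U W s : U `<=` W -> smooth_sect_on W s -> smooth_sect_on U s.
Proof. by move=> UW sf; apply: smooth_sect_local => x /UW Wx; exists W. Qed.

Lemma smooth_sect_ext U s t : open U -> (forall x, U x -> s x = t x) ->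
  smooth_sect_on U s -> smooth_sect_on U t.
Proof.
move=> oU st sf k j; apply: smooth_on_ext (sf k j); first exact: open_tdomI.
by move=> x [Ux _]; rewrite st.
Qed.

Lemma smooth_sect0 U : open U -> smooth_sect_on U (fun=> 0 : E _).
Proof.
move=> oU k j; apply: (smooth_on_ext (f := fun=> 0)); first exact: open_tdomI.
  by move=> x _; rewrite linear0 mxE.
by apply: smooth_on_cst; exact: open_tdomI.
Qed.

Lemma smooth_sect_lin U f s t : open U -> smooth_on U f ->
  smooth_sect_on U s -> smooth_sect_on U t ->
  smooth_sect_on U (fun x => f x *: s x + t x).
Proof.
move=> oU sf ss st k j; have oW := open_tdomI k oU.
apply: (smooth_on_ext (f := fun x => f x * tmap k x (s x) 0 j + tmap k x (t x) 0 j) oW).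
  by move=> x _; rewrite linearP !mxE.
apply: (smooth_on_add oW); last exact: st.
apply: (smooth_on_mul oW); last exact: ss.
by apply: smooth_on_sub sf => x [].
Qed.

Lemma smooth_sect_scale U f s : open U -> smooth_on U f ->
  smooth_sect_on U s -> smooth_sect_on U (scale_sect f s).
Proof.
move=> oU sf ss; apply: (smooth_sect_ext oU (s := fun x => f x *: s x + 0)).
  by move=> x _; rewrite addr0.
by apply: smooth_sect_lin => //; exact: smooth_sect0.
Qed.

Lemma smooth_sect_cutoff W (K : set M) chi s : open W -> smooth chi -> closed K ->
  K `<=` W -> (forall z, ~ K z -> chi z = 0) -> smooth_sect_on W s ->
  smooth_sect (scale_sect chi s).
Proof.
move=> oW sc cK KW chi0 ss; apply: smooth_sect_local => z _.
have [Wz|nWz] := pselect (W z).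
  exists W; split=> //; apply: smooth_sect_scale => //.
  exact: smooth_on_sub (@subsetT _ _) sc.
exists (~` K); split; first by move=> /KW.
have oK : open (~` K) by exact: closed_openC.
apply: (smooth_sect_ext oK (s := fun=> 0)); last exact: smooth_sect0.
by move=> w /chi0 c0; rewrite /scale_sect c0 scale0r.
Qed.

Lemma smooth_sect_triv U k s : open U -> U `<=` tdom k ->
  (forall j, smooth_on U (fun x => tmap k x (s x) 0 j)) -> smooth_sect_on U s.
Proof.
move=> oU Uk ss l j; have oW := open_tdomI l oU.
have [g [sg tg]] := triv_compat k l.
apply: (smooth_on_ext (f := fun x => \sum_i tmap k x (s x) 0 i * g x i j) oW).
  by move=> x [Ux lx]; rewrite tg ?mxE//; split=> //; exact: Uk.
apply: smooth_on_sum => // i; apply: smooth_on_mul => //.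
  by apply: smooth_on_sub (ss i) => x [].
by apply: smooth_on_sub (sg i j) => x [/Uk].
Qed.

Definition tinv k x (r : 'rV[R]_(vb_rank E)) : E x := ((tmap k x)^-1)%VF r.

Lemma tinvK k x r : tdom k x -> tmap k x (tinv k x r) = r.
Proof.
move=> kx; have [g _ gK] := tmap_bij kx.
by apply: limg_lfunVK; rewrite -[r]gK memv_img// memvf.
Qed.

Lemma tmap_inj k x : tdom k x -> injective (tmap k x).
Proof. by move=> kx; have [g gK _] := tmap_bij kx; exact: can_inj gK. Qed.

Lemma smooth_sect_tinv U k (r : M -> 'rV[R]_(vb_rank E)) : open U ->
  U `<=` tdom k -> (forall j, smooth_on U (fun x => r x 0 j)) ->
  smooth_sect_on U (fun x => tinv k x (r x)).
Proof.
move=> oU Uk sr; apply: (smooth_sect_triv oU Uk) => j.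
by apply: smooth_on_ext (sr j) => // x /Uk kx; rewrite tinvK.
Qed.

Lemma smooth_on_tmap U k s j : U `<=` tdom k -> smooth_sect_on U s ->
  smooth_on U (fun x => tmap k x (s x) 0 j).
Proof. by move=> Uk ss; apply: smooth_on_sub (ss k j) => x Ux; split=> //; exact: Uk. Qed.

(* chi^2 s = \sum_j theta_j(s) e_j globally, with theta_j and e_j the
   cut-offs of the coordinates and of the frame of a trivialization. *)
Lemma local_dual_basis x : exists (chi : M -> R) (e : 'I_(vb_rank E) -> sect E)
    (th : 'I_(vb_rank E) -> forall y, E y -> R),
  [/\ smooth chi, chi x != 0, forall j, smooth_sect (e j),
      forall j s, smooth_sect s -> smooth (fun y => th j y (s y)) &
      (forall j y (c : R) (a b : E y), th j y (c *: a + b) = c * th j y a + th j y b)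
      /\ forall y (a : E y), chi y *: a = \sum_j th j y a *: e j y].
Proof.
have [k kx] := tdom_cover E x; have ok := tdom_open k.
have [chi [K [sc cK KW chix chi0]]] := bump_manifold ok kx.
exists (fun y => chi y * chi y), (fun j => scale_sect chi (fun y => tinv k y (delta_mx 0 j))).
exists (fun j y a => chi y * tmap k y a 0 j); split.
- by apply: smooth_on_mul => //; exact: openT.
- by rewrite mulf_neq0.
- move=> j; apply: (smooth_sect_cutoff ok sc cK KW chi0).
  apply: smooth_sect_tinv => // i.
  by apply: smooth_on_cst.
- move=> j s ss; apply: (smooth_on_cutoff ok sc cK KW chi0).
  by apply: smooth_on_tmap => //; exact: smooth_sect_sub (@subsetT _ _) ss.
- split=> [j y c a b|y a]; first by rewrite linearP !mxE; ring.
  have [Ky|/chi0 c0] := pselect (K y); last first.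
    by rewrite c0 mul0r scale0r big1// => j _; rewrite mul0r scale0r.
  have ky := KW _ Ky; apply: (tmap_inj ky); rewrite linear_sum linearZ.
  apply/rowP => i; rewrite summxE (bigD1 i)//= big1 ?addr0 => [|j ji].
    rewrite /scale_sect !linearZ/= tinvK// !mxE !eqxx /=; ring.
  rewrite eq_sym in ji; rewrite /scale_sect !linearZ/= tinvK// !mxE (negbTE ji).
  by rewrite !mulr0.
Qed.

End BundleSections.

(** * Smooth families of matrices *)

Section SmoothMatrices.
Variables (R : realType) (n : nat) (M : manifold R n) (U : set M).
Hypothesis oU : open U.

Definition smooth_mx p q (B : M -> 'M[R]_(p, q)) :=
  forall i j, smooth_on U (fun x => B x i j).

Lemma smooth_on_prod (I : Type) (r : seq I) (F : I -> M -> R) :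
  (forall j, smooth_on U (F j)) -> smooth_on U (fun x => \prod_(j <- r) F j x).
Proof.
move=> sF; elim: r => [|i r IH].
  apply: (smooth_on_ext (f := fun=> 1) oU) => [x _|]; first by rewrite big_nil.
  exact: smooth_on_cst.
apply: (smooth_on_ext (f := fun x => F i x * \prod_(j <- r) F j x) oU).
  by move=> x _; rewrite big_cons.
exact: smooth_on_mul.
Qed.

Lemma smooth_mx_cst p q (A : 'M[R]_(p, q)) : smooth_mx (fun=> A).
Proof. by move=> i j; exact: smooth_on_cst. Qed.

Lemma smooth_mx_mul p q r (A : M -> 'M[R]_(p, q)) (B : M -> 'M[R]_(q, r)) :
  smooth_mx A -> smooth_mx B -> smooth_mx (fun x => A x *m B x).
Proof.
move=> sA sB i j; apply: (smooth_on_ext (f := fun x => \sum_l A x i l * B x l j) oU).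
  by move=> x _; rewrite mxE.
by apply: smooth_on_sum => // l; exact (smooth_on_mul oU (sA i l) (sB l j)).
Qed.

Lemma smooth_on_opp f : smooth_on U f -> smooth_on U (fun x => - f x).
Proof.
move=> sf; apply: (smooth_on_ext (f := fun x => -1 * f x) oU).
  by move=> x _; rewrite mulN1r.
by apply: smooth_on_mul => //; exact: smooth_on_cst.
Qed.

Lemma smooth_mx_sub p q (A B : M -> 'M[R]_(p, q)) :
  smooth_mx A -> smooth_mx B -> smooth_mx (fun x => A x - B x).
Proof.
move=> sA sB i j; apply: (smooth_on_ext (f := fun x => A x i j + - B x i j) oU).
  by move=> x _; rewrite !mxE.
exact (smooth_on_add oU (sA i j) (smooth_on_opp (sB i j))).
Qed.

Lemma smooth_on_det p (A : M -> 'M[R]_p) : smooth_mx A ->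
  smooth_on U (fun x => \det (A x)).
Proof.
move=> sA; rewrite /determinant.
apply: smooth_on_sum => // s; apply: smooth_on_mul => //.
  exact: smooth_on_cst.
by apply: smooth_on_prod => j; exact: sA.
Qed.

(** Cramer's formula: the entries of the inverse are cofactors divided by the determinant. *)
Lemma smooth_mx_inv p (A : M -> 'M[R]_p) : smooth_mx A ->
  (forall x, U x -> \det (A x) != 0) -> smooth_mx (fun x => invmx (A x)).
Proof.
move=> sA dA i j.
apply: (smooth_on_ext (f := fun x => (\det (A x))^-1 *
  ((-1) ^+ (j + i) * \det (row' j (col' i (A x))))) oU).
  by move=> x Ux; rewrite /invmx unitmxE unitfE dA// !mxE.
apply: smooth_on_mul => //; first by apply: smooth_on_inv => //; exact: smooth_on_det.
apply: smooth_on_mul => //; first exact: smooth_on_cst.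
apply: smooth_on_det => a b; apply: (smooth_on_ext (f := fun x => A x (lift j a) (lift i b)) oU).
  by move=> x _; rewrite !mxE.
exact: sA.
Qed.

End SmoothMatrices.

Lemma open_smooth_neq0 (R : realType) (n : nat) (M : manifold R n) (U : set M)
    (f : M -> R) : open U -> smooth_on U f -> open (U `&` [set x | f x != 0]).
Proof.
move=> oU sf; rewrite openE => x [Ux fx]; apply: filterI; first exact: open_nbhs_nbhs.
have fc := smooth_on_continuous oU Ux sf.
have N : nbhs (f x) [set y : R | y != 0].
  by apply: open_nbhs_nbhs; split=> //; exact: open_neq.
exact: fc N.
Qed.

Lemma tcoord_inj (R : realType) (n : nat) (M : manifold R n) (i : chart M) x
  (v : tangent x) : cdom i x -> tcoord i v = 0 -> v = 0.
Proof.
move=> di v0; apply: vder_eq0 => f sf.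
by rewrite (vderE v openT (I : setT x) di sf) v0 linear0.
Qed.

(** * Local generators of the kernel of the anchor *)

Lemma mxrank_minor (R : fieldType) (m n : nat) (B : 'M[R]_(m, n)) :
  exists (A : 'M_(\rank B, m)) (D : 'M_(n, \rank B)), A *m B *m D = 1%:M.
Proof.
exists (pinvmx (col_base B)), (pinvmx (row_base B)).
rewrite -[X in _ *m X *m _](mulmx_base B).
by rewrite (mulmxA (pinvmx _)) mulVpmx ?col_base_full// mul1mx mulmxVp// row_base_free.
Qed.

Section KernelProjector.
Variables (R : fieldType) (m n r : nat) (A : 'M[R]_(r, m)) (D : 'M[R]_(n, r)).

(* A projector onto the kernel of B, provided that A B D is invertible and that
   B has rank at most r. *)
Definition kerproj (B : 'M_(m, n)) : 'M_m :=
  1%:M - B *m D *m invmx (A *m B *m D) *m A.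

Lemma kerproj_id B p (v : 'M_(p, m)) : v *m B = 0 -> v *m kerproj B = v.
Proof. by move=> vB; rewrite /kerproj mulmxBr mulmx1 !mulmxA vB !mul0mx subr0. Qed.

(** [kerproj B] kills B D by construction. Moreover B D has rank at least r, hence at least that of
    B, so ker B and ker (B D) have equal dimension and coincide. The bound on the rank of B is where
    regularity is used. *)
Lemma kerproj_ker B : \det (A *m B *m D) != 0 -> (\rank B <= r)%N -> kerproj B *m B = 0.
Proof.
move=> dG rB; have uG : A *m B *m D \in unitmx by rewrite unitmxE unitfE.
have PR : kerproj B *m (B *m D) = 0.
  rewrite /kerproj mulmxBl mul1mx -!mulmxA [A *m (B *m D)]mulmxA.
  by rewrite mulVmx// mulmx1 subrr.
have rBR : (r <= \rank (B *m D))%N.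
  have E : \rank (A *m B *m D) = r by apply/eqP; rewrite -/(row_free _) row_free_unit.
  by rewrite -[leqLHS]E -mulmxA; exact: mxrankM_maxr.
have sK : (kermx B <= kermx (B *m D))%MS.
  by rewrite sub_kermx mulmxA mulmx_ker mul0mx.
have eK : (kermx (B *m D) <= kermx B)%MS.
  have [_ <-] := mxrank_leqif_sup sK.
  rewrite eqn_leq mxrankS//= !mxrank_ker leq_sub2l//.
  exact: leq_trans rB rBR.
by apply/eqP; rewrite -sub_kermx; apply: submx_trans eK; rewrite sub_kermx PR.
Qed.

End KernelProjector.

Section KernelBundle.
Variables (R : realType) (n : nat) (M : manifold R n).
Variable A : almost_Lie_algebroid M.

Lemma tcoordD (i : chart M) (x : M) (c : R) (v w : tangent x) :
  tcoord i (c *: v + w : tangent x) = c *: tcoord i v + tcoord i w :> 'rV[R]_n.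
Proof. exact: linearP. Qed.

Lemma tcoord0 (i : chart M) (x : M) : tcoord i (0 : tangent x) = 0 :> 'rV[R]_n.
Proof. exact: linear0. Qed.

Lemma tcoord_sum (i : chart M) (x : M) (I : Type) (r : seq I) (c : I -> R) (v : I -> tangent x) :
  tcoord i (\sum_(j <- r) c j *: v j : tangent x) =
  \sum_(j <- r) c j *: tcoord i (v j) :> 'rV[R]_n.
Proof.
elim: r => [|j r IH]; first by rewrite !big_nil tcoord0.
by rewrite !big_cons tcoordD IH.
Qed.

Definition anchor_mx (k : triv A) (i : chart M) (y : M) : 'M[R]_(vb_rank A, n) :=
  \matrix_(a, b) tcoord i (anchor A y (tinv k y (delta_mx 0 a))) 0 b.

Lemma anchor_mxE k i y (a : A y) : tdom k y ->
  tcoord i (anchor A y a) = tmap k y a *m anchor_mx k i y.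
Proof.
move=> ky; have -> : a = \sum_j tmap k y a 0 j *: tinv k y (delta_mx 0 j).
  apply: (tmap_inj ky); rewrite linear_sum.
  under eq_bigr do rewrite linearZ /= tinvK//.
  exact: row_sum_delta.
rewrite linear_sum; under eq_bigr do rewrite linearZ.
rewrite tcoord_sum; apply/rowP => b; rewrite !mxE summxE.
apply: eq_bigr => j _; rewrite !mxE; congr (_ * _).
rewrite linear_sum summxE (bigD1 j)//= big1 ?addr0 => [|l lj].
  by rewrite linearZ /= tinvK// !mxE !eqxx mulr1.
by rewrite linearZ /= tinvK// !mxE eq_sym (negbTE lj) mulr0.
Qed.

Lemma smooth_anchor_mx k i : smooth_mx (tdom k `&` cdom i) (anchor_mx k i).
Proof.
move=> a b; have ok := tdom_open k.
have ss : smooth_sect_on (tdom k) (fun y => tinv k y (delta_mx 0 a)).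
  by apply: smooth_sect_tinv => // j; exact: smooth_on_cst.
have oU : open (tdom k `&` cdom i) by apply: openI => //; exact: cdom_open.
by apply: (smooth_on_ext oU _ (anchor_smooth ok ss i b)) => y _; rewrite mxE.
Qed.

(** With T the coordinates of a basis of the image, the anchor matrix and T each factor through the
    other, and T is row-free since [tcoord i] is injective. *)
Lemma anchor_mx_rank k i y : tdom k y -> cdom i y ->
  \rank (anchor_mx k i y) = \dim (limg (anchor A y)).
Proof.
move=> ky iy; pose X := vbasis (limg (anchor A y)).
set d := \dim _ in X *.
pose T : 'M[R]_(d, n) := \matrix_(l, b) tcoord i (X`_l : tangent y) 0 b.
have TE (u : 'rV_d) : u *m T = tcoord i (\sum_l u 0 l *: X`_l : tangent y).
  rewrite tcoord_sum; apply/rowP => b; rewrite !mxE summxE.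
  by apply: eq_bigr => l _; rewrite !mxE.
apply/eqP; rewrite eqn_leq; apply/andP; split.
  pose Q : 'M[R]_(vb_rank A, d) := \matrix_(a, l)
    coord X l (anchor A y (tinv k y (delta_mx 0 a))).
  have -> : anchor_mx k i y = Q *m T.
    apply/row_matrixP => a; rewrite row_mul TE.
    have -> : row a (anchor_mx k i y) =
        tcoord i (anchor A y (tinv k y (delta_mx 0 a))).
      by apply/rowP => b; rewrite !mxE.
    congr (tcoord i _); rewrite {1}(coord_vbasis (memv_img _ (memvf (tinv k y (delta_mx 0 a))))).
    by apply: eq_bigr => l _; rewrite !mxE.
  exact: leq_trans (mxrankM_maxl _ _) (rank_leq_col _).
have Tf : row_free T.
  rewrite -kermx_eq0; apply/eqP/row_matrixP => l; rewrite row0.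
  set u := row l _; have uT : u *m T = 0.
    by apply/sub_kermxP; exact: row_sub.
  rewrite TE in uT; have := tcoord_inj iy uT.
  have /freeP fX := basis_free (vbasisP (limg (anchor A y))).
  by move=> /fX u0; apply/rowP => j; rewrite [RHS]mxE; exact: u0.
have <- : \rank T = d by apply/eqP.
pose Q : 'M[R]_(d, vb_rank A) := \matrix_(l, a)
  tmap k y (((anchor A y)^-1)%VF X`_l) 0 a.
have -> : T = Q *m anchor_mx k i y.
  apply/row_matrixP => l; rewrite row_mul.
  have -> : row l Q = tmap k y (((anchor A y)^-1)%VF X`_l).
    by apply/rowP => b; rewrite !mxE.
  rewrite -anchor_mxE// limg_lfunVK; last first.
    by rewrite vbasis_mem// mem_nth// size_tuple.
  by apply/rowP => b; rewrite !mxE.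
exact: mxrankM_maxr.
Qed.

Lemma anchor_ker k i y (a : A y) : tdom k y -> cdom i y ->
  (a \in lker (anchor A y)) = (tmap k y a *m anchor_mx k i y == 0).
Proof.
move=> ky iy; rewrite memv_ker -anchor_mxE//; apply/eqP/eqP => [->|].
  exact: tcoord0.
exact: tcoord_inj.
Qed.

Local Notation incl := Defs.incl.

Lemma incl_toFK x (v : kerF A x) : toF (incl v) = v.
Proof. exact: vsvalK. Qed.

Lemma toF_inclK x (a : A x) : a \in lker (anchor A x) -> incl (toF a) = a.
Proof. exact: vsprojK. Qed.

Lemma incl_inj x : injective (@Defs.incl _ _ _ A x).
Proof. exact: can_inj (@incl_toFK x). Qed.

Lemma incl_lin x c (v w : kerF A x) : incl (c *: v + w) = c *: incl v + incl w.
Proof. exact: linearP. Qed.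

Lemma incl_sum x (I : Type) (r : seq I) (c : I -> R) (v : I -> kerF A x) :
  incl (\sum_(j <- r) c j *: v j) = \sum_(j <- r) c j *: incl (v j).
Proof.
by rewrite /Defs.incl linear_sum; apply: eq_bigr => j _; rewrite linearZ.
Qed.

(** The rows of a smooth projector onto ker rho generate F. There are rank A of them, in general
    dependent, but with the coordinates of A restricted to F they satisfy the dual basis identity,
    which is all that is required. *)
Lemma local_dual_basisF x : regular A -> exists (m : nat) (chi : M -> R)
    (e : 'I_m -> sectF A) (th : 'I_m -> forall y, kerF A y -> R),
  [/\ smooth chi, chi x != 0, forall j, smooth_sectF (e j),
      forall j s, smooth_sectF s -> smooth (fun y => th j y (s y)) &
      (forall j y (c : R) (a b : kerF A y),
         th j y (c *: a + b) = c * th j y a + th j y b)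
      /\ forall y (a : kerF A y), chi y *: a = \sum_j th j y a *: e j y].
Proof.
move=> [r dimr]; have [k kx] := tdom_cover A x; pose i := chart_at x.
have ix : cdom i x by exact: chart_atP.
have oU : open (tdom k `&` cdom i).
  by apply: openI; [exact: tdom_open|exact: cdom_open].
pose B := anchor_mx k i; have sB : smooth_mx _ B := smooth_anchor_mx k i.
have rB y : (tdom k `&` cdom i) y -> \rank (B y) = r.
  by move=> [ky iy]; rewrite anchor_mx_rank.
have [L [D LBD]] := mxrank_minor (B x).
have sG : smooth_mx (tdom k `&` cdom i) (fun y => L *m B y *m D).
  apply: (smooth_mx_mul oU); last exact: smooth_mx_cst.
  by apply: (smooth_mx_mul oU) => //; exact: smooth_mx_cst.
have oW := open_smooth_neq0 oU (smooth_on_det oU sG).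
set W := (_ `&` _) in oW.
(* L and D are chosen at x, where L B D = 1; the determinant remains nonzero on the neighbourhood
   W. *)
have Wx : W x by split=> //=; rewrite LBD det1 oner_neq0.
have WU : W `<=` tdom k `&` cdom i by move=> y [].
have Wk : W `<=` tdom k by move=> y [[]].
have sGW : smooth_mx W (fun y => L *m B y *m D).
  by move=> a b; exact: smooth_on_sub WU (sG a b).
have sP : smooth_mx W (fun y => kerproj L D (B y)).
  have sBW : smooth_mx W B by move=> a b; exact: smooth_on_sub WU (sB a b).
  apply: (smooth_mx_sub oW); first exact: smooth_mx_cst.
  apply: (smooth_mx_mul oW); last exact: smooth_mx_cst.
  apply: (smooth_mx_mul oW); last by apply: (smooth_mx_inv oW) => // y [].
  by apply: (smooth_mx_mul oW) => //; exact: smooth_mx_cst.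
have PK y : W y -> kerproj L D (B y) *m B y = 0.
  by move=> Wy; apply: kerproj_ker; [case: Wy|rewrite !rB//; exact: WU].
pose f j y : A y := tinv k y (row j (kerproj L D (B y))).
have fK j y : W y -> f j y \in lker (anchor A y).
  move=> Wy; have [ky iy] := WU _ Wy.
  by rewrite (anchor_ker _ ky iy) tinvK// -row_mul PK// row0.
have [chi [K [sc cK KW chix chi0]]] := bump_manifold oW Wx.
exists (vb_rank A), (fun y => chi y * chi y), (fun j y => chi y *: toF (f j y)).
exists (fun j y a => chi y * tmap k y (incl a) 0 j); split.
- by apply: smooth_on_mul => //; exact: openT.
- by rewrite mulf_neq0.
- move=> j; have sf : smooth_sect_on W (f j).
    apply: (smooth_sect_tinv oW) => // l.
    by apply: (smooth_on_ext oW _ (sP j l)) => y _; rewrite [RHS]mxE.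
  apply: (smooth_sect_ext openT _ (smooth_sect_cutoff oW sc cK KW chi0 sf)).
  move=> y _; rewrite /scale_sect /t_sect.
  have [Ky|/chi0 ->] := pselect (K y); last first.
    by rewrite !scale0r /Defs.incl linear0.
  by rewrite /Defs.incl linearZ; congr (_ *: _); rewrite -[RHS]/(incl _) toF_inclK//; exact/fK/KW.
- move=> j s ss; apply: (smooth_on_cutoff oW sc cK KW chi0).
  by apply: smooth_on_tmap => //; exact: smooth_sect_sub (@subsetT _ _) ss.
- split=> [j y c a b|y a]; first by rewrite incl_lin linearP !mxE; ring.
  have [Ky|/chi0 c0] := pselect (K y); last first.
    by rewrite c0 mul0r scale0r big1// => j _; rewrite mul0r scale0r.
  have Wy := KW _ Ky; have [ky iy] := WU _ Wy.
  apply: (incl_inj (x := y)); apply: (tmap_inj ky); rewrite incl_sum.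
  have fE j : incl (chi y *: toF (f j y)) = chi y *: f j y.
    by rewrite -[in RHS](toF_inclK (fK j y Wy)); exact: linearZ.
  rewrite (eq_bigr (fun j => (chi y * tmap k y (incl a) 0 j) *: (chi y *: f j y))); last first.
    by move=> j _; rewrite -fE.
  have -> : incl ((chi y * chi y) *: a) = (chi y * chi y) *: incl a by exact: linearZ.
  have aK : tmap k y (incl a) *m B y = 0.
    by apply/eqP; rewrite -(anchor_ker _ ky iy); exact: subvsP.
  (* The coordinate row of a kernel vector is fixed by the projector, so it is the combination of
     the projector's rows with its own entries as coefficients. *)
  rewrite [RHS]linear_sum [LHS]linearZ /= -[X in _ *: X = _](kerproj_id L D aK).
  rewrite mulmx_sum_row scaler_sumr; apply: eq_bigr => j _.
  have H c d v : tmap k y (c *: (d *: v)) = c *: (d *: tmap k y v).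
    by rewrite linearZ /= linearZ.
  rewrite H /f tinvK// !scalerA; congr (_ *: _).
  by ring.
Qed.

End KernelBundle.

(** * The modules of smooth sections *)

Section SmoothRing.
Variables (R : realType) (n : nat) (M : manifold R n).

Definition smooth_pred : {pred M -> R} := fun f => `[< smooth f >].

Lemma smooth_predP f : reflect (smooth f) (f \in smooth_pred).
Proof. exact: asboolP. Qed.

Lemma smooth_subring_closed : subring_closed smooth_pred.
Proof.
split.
- by apply/smooth_predP; apply: smooth_on_cst; exact: openT.
- move=> f g /smooth_predP sf /smooth_predP sg; apply/smooth_predP.
  apply: (smooth_on_add openT sf); apply: (smooth_on_opp openT sg).
- move=> f g /smooth_predP sf /smooth_predP sg; apply/smooth_predP.
  exact: (smooth_on_mul openT sf sg).
Qed.

Record smoothfun := SmoothFun { sf_val :> M -> R; sf_valP : sf_val \in smooth_pred }.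

Fact smoothfun_rect (K : smoothfun -> Type) :
  (forall f (sf : f \in smooth_pred), K (SmoothFun sf)) -> forall u, K u.
Proof. by move=> Kf [f sf]; exact: Kf. Qed.
Fact smoothfun_valP f (sf : f \in smooth_pred) : sf_val (SmoothFun sf) = f.
Proof. by []. Qed.
HB.instance Definition _ :=
  isSub.Build (M -> R) smooth_pred smoothfun smoothfun_rect smoothfun_valP.
HB.instance Definition _ := [Choice of smoothfun by <:].
HB.instance Definition _ := GRing.SubChoice_isSubComPzRing.Build (M -> R)
  smooth_pred smoothfun smooth_subring_closed.

Lemma smoothfunP (f : smoothfun) : smooth f.
Proof. by apply/smooth_predP; exact: sf_valP. Qed.

Definition mksf f (sf : smooth f) : smoothfun := SmoothFun (introT (smooth_predP f) sf).

Lemma smoothfun_eq (f g : smoothfun) : (forall x, f x = g x) -> f = g.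
Proof. by move=> E; apply: val_inj; apply/funext. Qed.

Lemma sfD (f g : smoothfun) x : (f + g) x = f x + g x. Proof. by []. Qed.
Lemma sfM (f g : smoothfun) x : (f * g) x = f x * g x. Proof. by []. Qed.
Lemma sfN (f : smoothfun) x : (- f) x = - f x. Proof. by []. Qed.
Lemma sf1 x : (1 : smoothfun) x = 1. Proof. by []. Qed.
Section SectionModule.
Variable V : M -> vectType R.

(** Closure conditions shared by the smooth sections of A and of F; F is a family of kernels rather
    than a [vector_bundle], and one module construction serves both. *)
Record secpred := SecPred {
  sp :> (forall x, V x) -> Prop;
  sp0 : sp (fun=> 0);
  sp_lin : forall f s t, smooth f -> sp s -> sp t -> sp (fun x => f x *: s x + t x) }.

Variable S : secpred.

Record smsec := SmSec { ss_val :> forall x, V x; ss_valP : S ss_val }.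

Lemma smsec_eq (s t : smsec) : (forall x, s x = t x) -> s = t.
Proof.
move=> E; have : ss_val s = ss_val t by exact: functional_extensionality_dep.
by case: s t {E} => [s sP] [t tP] /= st; case: _ / st tP => tP; congr SmSec; exact: Prop_irrelevance.
Qed.

HB.instance Definition _ := gen_eqMixin smsec.
HB.instance Definition _ := gen_choiceMixin smsec.

Lemma sp_add s t : S s -> S t -> S (fun x => s x + t x).
Proof.
move=> sP tP; have := sp_lin (smooth_on_cst 1 openT) sP tP.
by congr (S _); apply: functional_extensionality_dep => x; rewrite scale1r.
Qed.

Lemma sp_scale f s : smooth f -> S s -> S (fun x => f x *: s x).
Proof.
move=> sf sP; have := sp_lin sf sP (sp0 S).
by congr (S _); apply: functional_extensionality_dep => x; rewrite addr0.
Qed.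

Lemma sp_opp s : S s -> S (fun x => - s x).
Proof.
move=> sP; have := sp_scale (smooth_on_cst (-1) openT) sP.
by congr (S _); apply: functional_extensionality_dep => x; rewrite scaleN1r.
Qed.

Definition smsec0 : smsec := SmSec (sp0 S).
Definition smsec_add (s t : smsec) : smsec := SmSec (sp_add (ss_valP s) (ss_valP t)).
Definition smsec_opp (s : smsec) : smsec := SmSec (sp_opp (ss_valP s)).
Definition smsec_scale (f : smoothfun) (s : smsec) : smsec :=
  SmSec (sp_scale (smoothfunP f) (ss_valP s)).

Fact smsec_addA : associative smsec_add.
Proof. by move=> s t u; apply: smsec_eq => x; exact: addrA. Qed.
Fact smsec_addC : commutative smsec_add.
Proof. by move=> s t; apply: smsec_eq => x; exact: addrC. Qed.
Fact smsec_add0 : left_id smsec0 smsec_add.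
Proof. by move=> s; apply: smsec_eq => x; exact: add0r. Qed.
Fact smsec_addN : left_inverse smsec0 smsec_opp smsec_add.
Proof. by move=> s; apply: smsec_eq => x; exact: addNr. Qed.

HB.instance Definition _ :=
  GRing.isZmodule.Build smsec smsec_addA smsec_addC smsec_add0 smsec_addN.

Fact smsec_scaleA (f g : smoothfun) (s : smsec) :
  smsec_scale f (smsec_scale g s) = smsec_scale (f * g) s.
Proof. by apply: smsec_eq => x; exact: scalerA. Qed.
Fact smsec_scale1 : left_id 1 smsec_scale.
Proof. by move=> s; apply: smsec_eq => x; exact: scale1r. Qed.
Fact smsec_scaleDr : right_distributive smsec_scale +%R.
Proof. by move=> f s t; apply: smsec_eq => x; exact: scalerDr. Qed.
Fact smsec_scaleDl s : {morph smsec_scale^~ s : f g / f + g}.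
Proof. by move=> f g; apply: smsec_eq => x; exact: scalerDl. Qed.

HB.instance Definition _ := GRing.Zmodule_isLmodule.Build smoothfun smsec
  smsec_scaleA smsec_scale1 smsec_scaleDr smsec_scaleDl.

Lemma ssD (s t : smsec) x : (s + t) x = s x + t x. Proof. by []. Qed.
Lemma ssZ (f : smoothfun) (s : smsec) x : (f *: s) x = f x *: s x. Proof. by []. Qed.
Lemma ssN (s : smsec) x : (- s) x = - s x. Proof. by []. Qed.

Lemma ss_sum (I : Type) (r : seq I) (F : I -> smsec) x :
  (\sum_(i <- r) F i) x = \sum_(i <- r) F i x.
Proof. by elim: r => [|i r IH]; rewrite ?big_nil// !big_cons ssD IH. Qed.

End SectionModule.
End SmoothRing.

Section Algebroid.
Variables (R : realType) (n : nat) (M : manifold R n).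
Variable A : almost_Lie_algebroid M.
Local Notation C := (smoothfun M).

Lemma spA_lin f (s t : sect A) : smooth f -> smooth_sect s -> smooth_sect t ->
  smooth_sect (fun x => f x *: s x + t x).
Proof. by move=> sf ss st; exact: (smooth_sect_lin openT). Qed.

Definition spA : secpred A := SecPred (smooth_sect0 (E := A) openT) spA_lin.

Lemma spF0 : smooth_sectF (fun x => 0 : kerF A x).
Proof.
apply: (smooth_sect_ext openT _ (smooth_sect0 (E := A) openT)) => x _.
by rewrite /t_sect /Defs.incl linear0.
Qed.

Lemma spF_lin f (s t : sectF A) : smooth f -> smooth_sectF s -> smooth_sectF t ->
  smooth_sectF (fun x => f x *: s x + t x).
Proof.
move=> sf ss st; apply: (smooth_sect_ext openT _ (smooth_sect_lin openT sf ss st)).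
by move=> x _; rewrite /t_sect incl_lin.
Qed.

Definition spF : secpred (kerF A) := SecPred spF0 spF_lin.

Definition SA : lmodType C := smsec spA.
Definition SF : lmodType C := smsec spF.
Definition mkA s (ss : smooth_sect s) : SA := SmSec (S := spA) ss.
Definition mkF s (ss : smooth_sectF s) : SF := SmSec (S := spF) ss.

End Algebroid.

(** * The Lie-Rinehart structure on sections of an almost Lie algebroid *)

Section AlmostLieRinehart.
Variables (R : realType) (n : nat) (M : manifold R n).
Variable A : almost_Lie_algebroid M.
Local Notation C := (smoothfun M).
Local Notation SA := (SA A).
Local Notation SF := (SF A).
Implicit Types (a b d : SA) (v w : SF) (f g : C).

Definition rhoA a f : C := mksf
  (smooth_on_vder openT (anchor_smooth openT (ss_valP a)) (smoothfunP f)).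

Lemma rhoAE a f x : rhoA a f x = vder (anchor A x (a x)) f. Proof. by []. Qed.

Definition brA a b : SA := mkA (br_smooth (ss_valP a) (ss_valP b)).

Lemma brAE a b x : brA a b x = br a b x. Proof. by []. Qed.

Definition tA v : SA := mkA (s := t_sect v) (ss_valP v).

Lemma tAE v x : tA v x = Defs.incl (v x). Proof. by []. Qed.

Lemma rhoA_ker a x : (forall f, rhoA a f = 0) -> a x \in lker (anchor A x).
Proof.
move=> a0; rewrite memv_ker; apply/eqP/vder_eq0 => f sf.
by have := congr1 (fun g : C => g x) (a0 (mksf sf)); rewrite rhoAE.
Qed.

Lemma rhoA_t v f : rhoA (tA v) f = 0.
Proof.
apply: smoothfun_eq => x; rewrite rhoAE tAE.
have /eqP -> : anchor A x (Defs.incl (v x)) == 0 by rewrite -memv_ker; exact: subvsP.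
exact: linear0.
Qed.

Lemma rhoA_br a b f : rhoA (brA a b) f = rhoA a (rhoA b f) - rhoA b (rhoA a f).
Proof.
apply: smoothfun_eq => x.
exact: (br_anchor x (ss_valP a) (ss_valP b) (smoothfunP f)).
Qed.

(** A section acting by zero on all functions lies in ker rho by [vder_eq0], and smoothness in F is
    by definition smoothness of the inclusion. [nab] and [Jac] are obtained this way. *)
Lemma smooth_toF a : (forall f, rhoA a f = 0) ->
  t_sect (fun x => toF (a x)) = a /\ smooth_sectF (fun x => toF (a x)).
Proof.
move=> a0; have E : t_sect (fun x => toF (a x)) = a.
  apply: functional_extensionality_dep => x.
  by rewrite /t_sect toF_inclK//; exact: rhoA_ker.
by split=> //; rewrite /smooth_sectF /smooth_sectF_on E; exact: (ss_valP a).
Qed.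

Definition toSF a (a0 : forall f, rhoA a f = 0) : SF := mkF (smooth_toF a0).2.

Lemma tA_toSF a (a0 : forall f, rhoA a f = 0) : tA (toSF a0) = a.
Proof. by apply: smsec_eq => x; exact: (congr1 (fun s : sect A => s x) (smooth_toF a0).1). Qed.

Lemma rhoA_add a f g : rhoA a (f + g) = rhoA a f + rhoA a g.
Proof. by apply: smoothfun_eq => x; exact: (vderD _ (smoothfunP f) (smoothfunP g)). Qed.

Lemma rhoA_mul a f g : rhoA a (f * g) = rhoA a f * g + f * rhoA a g.
Proof. by apply: smoothfun_eq => x; exact: (vderM _ (smoothfunP f) (smoothfunP g)). Qed.

Lemma rhoA_lin f a b g : rhoA (f *: a + b) g = f * rhoA a g + rhoA b g.
Proof.
apply: smoothfun_eq => x; rewrite sfD sfM !rhoAE ssD ssZ linearP.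
exact: vder_lin.
Qed.

Lemma rhoA0 a : rhoA a 0 = 0.
Proof. by apply: (addrI (rhoA a 0)); rewrite -rhoA_add !addr0. Qed.

Lemma rhoA_nab a v f : rhoA (brA a (tA v)) f = 0.
Proof. by rewrite rhoA_br !rhoA_t rhoA0 subrr. Qed.

Lemma rhoAD a b f : rhoA (a + b) f = rhoA a f + rhoA b f.
Proof. by rewrite -{1}[a]scale1r rhoA_lin mul1r. Qed.

(** The brackets act on functions as commutators of operators, for which the Jacobi identity
    holds. *)
Lemma rhoA_Jac a b d f :
  rhoA (brA a (brA b d) + brA b (brA d a) + brA d (brA a b)) f = 0.
Proof.
have rN h g : rhoA h (- g) = - rhoA h g.
  by apply: (addrI (rhoA h g)); rewrite -rhoA_add !subrr rhoA0.
by rewrite !rhoAD !rhoA_br !(rhoA_add, rN); ring.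
Qed.

Lemma brA_skew a b : brA b a = - brA a b.
Proof.
apply: smsec_eq => x.
by rewrite brAE (br_skew (ss_valP a) (ss_valP b)).
Qed.

Lemma brADl a b d : brA (a + b) d = brA a d + brA b d.
Proof.
apply: smsec_eq => x.
have := br_linear 1 (ss_valP a) (ss_valP b) (ss_valP d).
have -> : lin_sect 1 a b = a + b :> sect A.
  by apply: functional_extensionality_dep => y; rewrite /lin_sect scale1r.
by move=> /(congr1 (fun s : sect A => s x)); rewrite /lin_sect scale1r.
Qed.

Lemma brA_aa a : brA a a = 0.
Proof.
apply: smsec_eq => x; have := congr1 (fun s : SA => s x) (brA_skew a a).
rewrite ssN => /eqP; rewrite -addr_eq0 -mulr2n -scaler_nat scaler_eq0.
by rewrite pnatr_eq0 /= => /eqP.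
Qed.

Lemma brAZ a b f : brA a (f *: b) = rhoA a f *: b + f *: brA a b.
Proof.
apply: smsec_eq => x.
have := br_Leibniz (ss_valP a) (ss_valP b) (smoothfunP f).
by move=> /(congr1 (fun s : sect A => s x)).
Qed.

Lemma tA_lin f v w : tA (f *: v + w) = f *: tA v + tA w.
Proof. by apply: smsec_eq => x; exact: incl_lin. Qed.

Lemma tA_inj : injective tA.
Proof.
move=> v w E; apply: smsec_eq => x; apply: (incl_inj (x := x)).
exact: (congr1 (fun s : SA => s x) E).
Qed.

Definition alrA : almost_Lie_Rinehart SA SF := ALR rhoA_add rhoA_mul rhoA_lin
  brADl brA_skew brA_aa brAZ rhoA_br tA_lin tA_inj rhoA_t
  (fun a v => tA_toSF (rhoA_nab a v)) (fun a b d => tA_toSF (rhoA_Jac a b d)).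

End AlmostLieRinehart.

Section TensFacts.
Variables (C : comPzRingType) (SA SF : lmodType C).
Implicit Types (G : sform C SA SF).

Lemma tens_swapA G a b s1 s2 vs : tens G ->
  G (s1 ++ a :: b :: s2) vs = - G (s1 ++ b :: a :: s2) vs.
Proof.
elim: s1 G => [|x s1 IH] G tG; last exact: (IH _ (tens_insA x tG)).
by have := congr1 (fun F => F s2 vs) (insAC b a tG).
Qed.

Lemma tens_alternating G a s1 s2 s3 vs : tens G ->
  G (s1 ++ a :: s2 ++ a :: s3) vs = 0.
Proof.
move=> tG; elim: s2 s1 => [|b s2 IH] s1; first exact: tens_alt.
by rewrite /= tens_swapA// -cat_rcons IH oppr0.
Qed.

Section DualBasisScale.
Variables (V : lmodType C) (c d : C) (b : dual_basis V c).

Fact dual_basis_scale_lin i : Clin (fun s => d * db_form b i s).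
Proof. by move=> k s t; rewrite db_lin; ring. Qed.

Fact dual_basis_scale_sum s :
  (d * c) *: s = \sum_i (d * db_form b i s) *: db_vec b i.
Proof.
rewrite -scalerA (db_sum b) scaler_sumr.
by apply: eq_bigr => i _; rewrite scalerA.
Qed.

(** Gives the bases of A and of F, found with different bump functions, a common factor. *)
Definition dual_basis_scale : dual_basis V (d * c) :=
  DualBasis dual_basis_scale_lin dual_basis_scale_sum.

Lemma db_form_scale i s : db_form dual_basis_scale i s = d * db_form b i s.
Proof. by []. Qed.

End DualBasisScale.

End TensFacts.

(** Swaps bring the head of vs to the front of ws; the tails are then compared under a longer fixed
    prefix s. *)
Lemma perm_swap_invariant (T : eqType) (X : Type) (f : seq T -> X) :
  (forall s1 v w s2, f (s1 ++ v :: w :: s2) = f (s1 ++ w :: v :: s2)) ->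
  forall vs ws, perm_eq vs ws -> f vs = f ws.
Proof.
move=> fs.
have mv s a w1 w2 : f (s ++ w1 ++ a :: w2) = f (s ++ a :: w1 ++ w2).
  elim: w1 s => [//|b w1 IH] s.
  by rewrite cat_cons -cat_rcons IH cat_rcons fs.
suff H vs ws s : perm_eq vs ws -> f (s ++ vs) = f (s ++ ws) by move=> vs ws /(H _ _ [::]).
elim: vs ws s => [|a vs IH] ws s; first by rewrite perm_sym => /perm_nilP ->.
move=> pe; have aw : a \in ws by rewrite -(perm_mem pe) mem_head.
case/splitPr: aw pe => w1 w2 pe; rewrite mv -!cat_rcons; apply: IH.
by rewrite -(perm_cons a); apply: (perm_trans pe); rewrite perm_catC /= perm_cons perm_catC.
Qed.

Lemma perm_swap (T : eqType) (s1 s2 : seq T) v w :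
  perm_eq (s1 ++ v :: w :: s2) (s1 ++ w :: v :: s2).
Proof. by rewrite perm_cat2l; apply/seq.permP => p /=; rewrite addnCA. Qed.

Lemma the_spec (T : Type) (x0 : T) (P : T -> Prop) : (exists x, P x) -> P (the x0 P).
Proof. by rewrite /the; case: pselect => // h _; exact: (projT2 (cid h)). Qed.

Lemma the_eq (T : Type) (x0 : T) (P : T -> Prop) x :
  P x -> (forall y, P y -> y = x) -> the x0 P = x.
Proof. by move=> Px; apply; apply: the_spec; exists x. Qed.

(** * Cochains as forms on the modules of sections *)

Section Cochains.
Variables (R : realType) (n : nat) (M : manifold R n).
Variable A : almost_Lie_algebroid M.
Hypothesis hreg : regular A.
Local Notation C := (smoothfun M).
Local Notation SA := (SA A).
Local Notation SF := (SF A).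
Local Notation form := (sform C SA SF).
Implicit Types (G : form).

Definition cstC (k : R) : C := mksf (smooth_on_cst (M := M) k openT).

Lemma cstCE k x : cstC k x = k. Proof. by []. Qed.

Lemma charC m (c : C) : m.+1%:R * c = 0 -> c = 0.
Proof.
move=> mc; have E : c = cstC (m.+1%:R^-1) * (m.+1%:R * c).
  rewrite mulrA [X in X * c](_ : _ = 1) ?mul1r//; apply: smoothfun_eq => x.
  rewrite sfM cstCE sf1 (_ : (m.+1%:R : C) x = m.+1%:R).
    by rewrite mulVf// pnatr_eq0.
  by elim: (m.+1) => [//|l IH]; rewrite -!natr1 sfD IH.
by rewrite E mc mulr0.
Qed.

(** The link between modules and fibres: the coordinates of s at y depend only on the vector s y. *)
Definition pointwise_basis (V : M -> vectType R) (S : secpred V) (c : C)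
    (b : dual_basis (smsec S) c) :=
  forall j (s : smsec S) y, s y = 0 -> db_form b j s y = 0.

Lemma pointwise_basis_scale (V : M -> vectType R) (S : secpred V) (c d : C)
    (b : dual_basis (smsec S) c) :
  pointwise_basis b -> pointwise_basis (dual_basis_scale d b).
Proof. by move=> pb j s y sy; rewrite db_form_scale sfM pb ?mulr0. Qed.

Lemma ex_basisA x : exists (c : C) (b : dual_basis SA c), c x != 0 /\ pointwise_basis b.
Proof.
have [chi [e [th [sc cx se sth [thl thE]]]]] := local_dual_basis A x.
exists (mksf sc).
pose th' j (s : SA) : C := mksf (sth j s (ss_valP s)).
have th'l j : Clin (th' j).
  by move=> f s t; apply: smoothfun_eq => y; exact: thl.
have th'E (s : SA) : mksf sc *: s = \sum_j th' j s *: (mkA (se j) : SA).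
  by apply: smsec_eq => y; rewrite ss_sum; exact: thE.
exists (DualBasis th'l th'E); split=> // j s y sy /=.
rewrite /th' /= sy; have := thl j y (-1) 0 0.
by rewrite scaler0 addr0 mulN1r addNr.
Qed.

Lemma ex_basisF x : exists (c : C) (b : dual_basis SF c), c x != 0 /\ pointwise_basis b.
Proof.
have [m [chi [e [th [sc cx se sth [thl thE]]]]]] := local_dual_basisF x hreg.
exists (mksf sc).
pose th' j (s : SF) : C := mksf (sth j s (ss_valP s)).
have th'l j : Clin (th' j).
  by move=> f s t; apply: smoothfun_eq => y; exact: thl.
have th'E (s : SF) : mksf sc *: s = \sum_j th' j s *: (mkF (se j) : SF).
  by apply: smsec_eq => y; rewrite ss_sum; exact: thE.
exists (DualBasis th'l th'E); split=> // j s y sy /=.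
rewrite /th' /= sy; have := thl j y (-1) 0 0.
by rewrite scaler0 addr0 mulN1r addNr.
Qed.

Lemma ex_bases x : exists c : C, c x != 0 /\
  exists (bA : dual_basis SA c) (bF : dual_basis SF c),
    pointwise_basis bA /\ pointwise_basis bF.
Proof.
have [c [bA [cx pA]]] := ex_basisA x; have [d [bF [dx pF]]] := ex_basisF x.
exists (d * c); split; first by rewrite sfM mulf_neq0.
exists (dual_basis_scale d bA).
have [bF' pF'] : exists bF' : dual_basis SF (d * c), pointwise_basis bF'.
  rewrite mulrC; exists (dual_basis_scale c bF).
  exact: pointwise_basis_scale pF.
exists bF'; split=> //.
exact: pointwise_basis_scale pA.
Qed.

(** One function for each point, nonzero there: jointly they detect zero in C, as [chiM0] states. *)
Definition chiM x : C := projT1 (cid (ex_bases x)).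
Lemma chiMx x : chiM x x != 0.
Proof. by rewrite /chiM; case: cid => c []. Qed.
Lemma chiM0 (c : C) : (forall x, chiM x * c = 0) -> c = 0.
Proof.
move=> c0; apply: smoothfun_eq => x; have /eqP := congr1 (fun f : C => f x) (c0 x).
by rewrite sfM mulf_eq0 (negbTE (chiMx x)) => /eqP.
Qed.

Lemma chiM_bases x : exists (b : dual_basis SA (chiM x) * dual_basis SF (chiM x)),
  pointwise_basis b.1 /\ pointwise_basis b.2.
Proof.
rewrite /chiM; case: cid => c /= [_ [bA [bF [pA pF]]]].
by exists (bA, bF).
Qed.

Definition bM x := projT1 (cid (chiM_bases x)).
Lemma bM_pointwise x : pointwise_basis (bM x).1 /\ pointwise_basis (bM x).2.
Proof. exact: projT2 (cid (chiM_bases x)). Qed.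

(** Expand chi s in the dual basis at x: all coefficients vanish at x, whereas chi does not. *)
Lemma tens_pointwiseA G (s : SA) ps vs x : tens G -> s x = 0 -> insA s G ps vs x = 0.
Proof.
move=> tG sx; have [pA _] := bM_pointwise x.
have := congr1 (fun F : form => F ps vs x) (insAZ (chiM x) s tG).
rewrite {1}/insA (db_sum (bM x).1) tens_sumA// /fscale sfM => E.
have {}E : chiM x x * insA s G ps vs x = 0.
  rewrite -E; elim/big_rec: _ => // j f _ f0.
  by rewrite sfD f0 addr0 sfM pA// mul0r.
by move/eqP: E; rewrite mulf_eq0 (negbTE (chiMx x)) => /eqP.
Qed.

Lemma tens_pointwiseF G (s : SF) ps vs x : tens G -> s x = 0 -> insF s G ps vs x = 0.
Proof.
move=> tG sx; have [_ pF] := bM_pointwise x.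
have := congr1 (fun F : form => F ps vs x) (insFZ (chiM x) s tG).
rewrite {1}/insF (db_sum (bM x).2) tens_sumF// /fscale sfM => E.
have {}E : chiM x x * insF s G ps vs x = 0.
  rewrite -E; elim/big_rec: _ => // j f _ f0.
  by rewrite sfD f0 addr0 sfM pF// mul0r.
by move/eqP: E; rewrite mulf_eq0 (negbTE (chiMx x)) => /eqP.
Qed.

Definition evA (ps : seq SA) x : seq (A x) := [seq (p : SA) x | p <- ps].
Definition evF (vs : seq SF) x : seq (kerF A x) := [seq (v : SF) x | v <- vs].

Lemma tens_ev G ps ps' vs vs' x : tens G -> evA ps x = evA ps' x ->
  evF vs x = evF vs' x -> G ps vs x = G ps' vs' x.
Proof.
elim: ps ps' G => [|p ps IH] [|p' ps'] //= G tG.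
  move=> _; elim: vs vs' G tG => [|v vs IH] [|v' vs'] //= G tG [vv' vvs].
  have -> : G [::] (v :: vs) x = insF v G [::] vs x by [].
  have -> : v = (v - v') + v' by rewrite subrK.
  rewrite insFD// addfE sfD tens_pointwiseF ?add0r//; last first.
    by rewrite ssD ssN vv' subrr.
  by rewrite (IH vs')//; exact: tens_insF.
move=> [pp' pps] vvs.
have -> : G (p :: ps) vs x = insA p G ps vs x by [].
have -> : p = (p - p') + p' by rewrite subrK.
rewrite insAD// addfE sfD tens_pointwiseA ?add0r//; last first.
  by rewrite ssD ssN pp' subrr.
by rewrite (IH ps')//; exact: tens_insA.
Qed.

(** The coordinates of a are used as constant coefficients of the cut-off generators, divided by chi
    x to undo the cut-off at x. *)
Lemma ex_extA x (a : A x) : exists s : SA, s x = a.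
Proof.
have [chi [e [th [sc cx se sth [thl thE]]]]] := local_dual_basis A x.
exists (\sum_j cstC ((chi x)^-1 * th j x a) *: (mkA (se j) : SA)).
rewrite ss_sum -[RHS]scale1r -(mulVf cx) -scalerA thE scaler_sumr.
by apply: eq_bigr => j _; rewrite scalerA.
Qed.

Lemma ex_extF x (a : kerF A x) : exists s : SF, s x = a.
Proof.
have [m [chi [e [th [sc cx se sth [thl thE]]]]]] := local_dual_basisF x hreg.
exists (\sum_j cstC ((chi x)^-1 * th j x a) *: (mkF (se j) : SF)).
rewrite ss_sum -[RHS]scale1r -(mulVf cx) -scalerA thE scaler_sumr.
by apply: eq_bigr => j _; rewrite scalerA.
Qed.

Definition extA x (a : A x) : SA := projT1 (cid (ex_extA a)).
Definition extF x (a : kerF A x) : SF := projT1 (cid (ex_extF a)).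
Lemma extAE x (a : A x) : extA a x = a. Proof. exact: projT2 (cid (ex_extA a)). Qed.
Lemma extFE x (a : kerF A x) : extF a x = a. Proof. exact: projT2 (cid (ex_extF a)). Qed.

Lemma evA_ext x (ps : seq (A x)) : evA [seq extA p | p <- ps] x = ps.
Proof. by rewrite /evA -map_comp -[RHS]map_id; apply: eq_map => p /=; exact: extAE. Qed.
Lemma evF_ext x (vs : seq (kerF A x)) : evF [seq extF v | v <- vs] x = vs.
Proof. by rewrite /evF -map_comp -[RHS]map_id; apply: eq_map => p /=; exact: extFE. Qed.

(* The choice of the sections through the given vectors is irrelevant, by
   [tens_ev]. *)
Definition unsec G : cform A := fun x ps vs =>
  G [seq extA p | p <- ps] [seq extF v | v <- vs] x.

Lemma unsecE G ps vs x : tens G -> unsec G (evA ps x) (evF vs x) = G ps vs x.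
Proof. by move=> tG; apply: tens_ev => //; [exact: evA_ext|exact: evF_ext]. Qed.

Lemma cform_eq (g h : cform A) :
  (forall x (ps : seq SA) (vs : seq SF), g x (evA ps x) (evF vs x) = h x (evA ps x) (evF vs x)) ->
  g = h.
Proof.
move=> E; apply: functional_extensionality_dep => x.
apply/funext => ps; apply/funext => vs.
by have := E x [seq extA p | p <- ps] [seq extF v | v <- vs]; rewrite evA_ext evF_ext.
Qed.

Implicit Types (g h : cform A) (ps : seq SA) (vs : seq SF).

Definition valA (s : SA) : sect A := s.
Definition valF (v : SF) : sectF A := v.

Definition toA (s : sect A) : SA :=
  if pselect (smooth_sect s) is left h then mkA h else 0.
Definition toSFs (v : sectF A) : SF :=
  if pselect (smooth_sectF v) is left h then mkF h else 0.

Lemma toAE s : smooth_sect s -> valA (toA s) = s.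
Proof. by move=> ss; rewrite /toA; case: pselect. Qed.
Lemma toSFsE v : smooth_sectF v -> valF (toSFs v) = v.
Proof. by move=> ss; rewrite /toSFs; case: pselect. Qed.

Lemma evs_valA ps x : evs (map valA ps) x = evA ps x.
Proof. by rewrite /evs -map_comp. Qed.
Lemma evsF_valF vs x : evsF (map valF vs) x = evF vs x.
Proof. by rewrite /evsF -map_comp. Qed.

Lemma nth_valA ps i : nth (fun=> 0) (map valA ps) i = valA (nth 0 ps i).
Proof. by elim: ps i => [|a ps IH] [|i] //=. Qed.
Lemma nth_valF vs i : nth (fun=> 0) (map valF vs) i = valF (nth 0 vs i).
Proof. by elim: vs i => [|a vs IH] [|i] //=. Qed.

Lemma smooth_valA ps i : smooth_sect (nth (fun=> 0) (map valA ps) i).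
Proof. by rewrite nth_valA; exact (ss_valP (nth 0 ps i)). Qed.
Lemma smooth_valF vs i : smooth_sectF (nth (fun=> 0) (map valF vs) i).
Proof. by rewrite nth_valF; exact (ss_valP (nth 0 vs i)). Qed.

Lemma map_toAK (ps : seq (sect A)) :
  (forall i, (i < size ps)%N -> smooth_sect (nth (fun=> 0) ps i)) ->
  map valA (map toA ps) = ps.
Proof.
elim: ps => //= s ps IH sp; rewrite toAE; last exact: (sp 0%N).
by rewrite IH// => i lt; exact: (sp i.+1).
Qed.
Lemma map_toSFsK (vs : seq (sectF A)) :
  (forall i, (i < size vs)%N -> smooth_sectF (nth (fun=> 0) vs i)) ->
  map valF (map toSFs vs) = vs.
Proof.
elim: vs => //= s vs IH sp; rewrite toSFsE; last exact: (sp 0%N).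
by rewrite IH// => i lt; exact: (sp i.+1).
Qed.

(* The default value is never taken on cochains. *)
Definition sec g : form := fun ps vs =>
  if pselect (smooth (fun x => g x (evA ps x) (evF vs x))) is left h
  then mksf h else 0.

Lemma secE g ps vs x : smooth_form g -> sec g ps vs x = g x (evA ps x) (evF vs x).
Proof.
move=> sg; rewrite /sec; case: pselect => // -[].
have := sg setT (map valA ps) (map valF vs) openT
  (fun i _ => smooth_valA ps i) (fun i _ => smooth_valF vs i).
rewrite (_ : (fun x => _) = (fun x => g x (evA ps x) (evF vs x)))//.
by apply/funext => y; rewrite evs_valA evsF_valF.
Qed.

Lemma sec_tens g : cochain g -> tens (sec g).
Proof.
case=> [[lA lF] ag sg smg _]; split=> *; apply: smoothfun_eq => x.
- by rewrite sfD sfM !secE// /evA !map_cat /= lA.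
- by rewrite sfD sfM !secE// /evF !map_cat /= lF.
- by rewrite secE// /evA !map_cat /= (ag _ _ _ [::]).
- rewrite !secE// /evF !map_cat /=; apply: sg; exact: perm_swap.
Qed.

Lemma sec_supported (P : pred nat) g : smooth_form g ->
  concentrated_in (fun p q => P (p + 2 * q)%N) g -> supported P (sec g).
Proof.
move=> sg Pg ps vs np; apply: smoothfun_eq => x; rewrite secE//.
by apply: Pg; rewrite !size_map.
Qed.

Lemma sec_acochain g : cochain g -> acochain (sec g).
Proof.
move=> cg; split; first exact: sec_tens.
case: cg => _ _ _ sg [N gN]; exists N.
exact: sec_supported.
Qed.

Lemma unsecP G ps vs x (l : seq (A x)) (m : seq (kerF A x)) : tens G ->
  evA ps x = l -> evF vs x = m -> unsec G l m = G ps vs x.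
Proof. by move=> tG <- <-; exact: unsecE. Qed.

Lemma unsec_concentrated (P : pred nat) G : supported P G ->
  concentrated_in (fun p q => P (p + 2 * q)%N) (unsec G).
Proof. by move=> PG x ps vs np; rewrite /unsec PG// !size_map. Qed.

Lemma unsec_multilinear G : tens G -> multilinear (unsec G).
Proof.
move=> tG; split=> [x k a b s1 s2 vs|x k a b ps s1 s2].
  rewrite (unsecP (ps := map (extA (x := x)) s1 ++
    (cstC k *: extA a + extA b) :: map (extA (x := x)) s2)
    (vs := map (extF (x := x)) vs) tG).
  - by rewrite tens_linA// /unsec !map_cat.
  - rewrite /evA map_cat map_cons ssD ssZ cstCE !extAE.
    by rewrite -/(evA (map _ s1) x) -/(evA (map _ s2) x) !evA_ext.
  - exact: evF_ext.
rewrite (unsecP (vs := map (extF (x := x)) s1 ++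
  (cstC k *: extF a + extF b) :: map (extF (x := x)) s2)
  (ps := map (extA (x := x)) ps) tG).
- by rewrite tens_linF// /unsec !map_cat.
- exact: evA_ext.
- rewrite /evF map_cat map_cons ssD ssZ cstCE !extFE.
  by rewrite -/(evF (map _ s1) x) -/(evF (map _ s2) x) !evF_ext.
Qed.

Lemma multilinear_scale g x (k : R) : multilinear g ->
  forall (ps : seq (A x)) (vs : seq (kerF A x)),
  g x [seq k *: a | a <- ps] [seq k *: v | v <- vs] =
  k ^+ (size ps + size vs) * g x ps vs.
Proof.
move=> [lA lF] ps vs; rewrite exprD -mulrA.
have ZA s1 (a : A x) s2 ws : g x (s1 ++ k *: a :: s2) ws = k * g x (s1 ++ a :: s2) ws.
  have := lA x k a 0 s1 s2 ws; rewrite addr0 => ->.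
  by have := lA x (-1) 0 0 s1 s2 ws; rewrite scaler0 addr0 mulN1r addNr => ->; rewrite addr0.
have ZF qs s1 (a : kerF A x) s2 : g x qs (s1 ++ k *: a :: s2) = k * g x qs (s1 ++ a :: s2).
  have := lF x k a 0 qs s1 s2; rewrite addr0 => ->.
  by have := lF x (-1) 0 0 qs s1 s2; rewrite scaler0 addr0 mulN1r addNr => ->; rewrite addr0.
have EA s qs ws : g x (s ++ [seq k *: a | a <- qs]) ws = k ^+ size qs * g x (s ++ qs) ws.
  elim: qs s => [|a qs IH] s /=; first by rewrite expr0 mul1r.
  by rewrite ZA -(cat_rcons a s [seq k *: b | b <- qs]) IH cat_rcons exprS mulrA.
have EF s qs ws : g x qs (s ++ [seq k *: a | a <- ws]) = k ^+ size ws * g x qs (s ++ ws).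
  elim: ws s => [|a ws IH] s /=; first by rewrite expr0 mul1r.
  by rewrite ZF -(cat_rcons a s [seq k *: b | b <- ws]) IH cat_rcons exprS mulrA.
by have := EA [::] ps [seq k *: v | v <- vs]; rewrite /= => ->; rewrite (EF [::]).
Qed.

Lemma smooth_on_exp U (f : M -> R) m : open U -> smooth_on U f ->
  smooth_on U (fun x => f x ^+ m).
Proof.
move=> oU sf; elim: m => [|m IH]; first by apply: smooth_on_cst.
apply: (smooth_on_ext (f := fun x => f x * f x ^+ m) oU).
  by move=> x _; rewrite exprS.
exact: smooth_on_mul.
Qed.

Lemma smooth_sectF_cutoff W (K : set M) chi (v : sectF A) : open W -> smooth chi ->
  closed K -> K `<=` W -> (forall z, ~ K z -> chi z = 0) -> smooth_sectF_on W v ->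
  smooth_sectF (fun x => chi x *: v x).
Proof.
move=> oW sc cK KW chi0 sv; 
apply: (smooth_sect_ext openT _ (smooth_sect_cutoff oW sc cK KW chi0 sv)) => x _.
have := incl_lin (chi x) (v x) 0; rewrite addr0 /t_sect => ->.
by rewrite /Defs.incl linear0 addr0.
Qed.

(* Near a given point the values of [unsec G] on local sections are, up to a
   power of a bump function, those of [G] on global ones. *)
Lemma unsec_smooth G : tens G -> smooth_form (unsec G).
Proof.
move=> tG U ps vs oU sp sv; apply: smooth_on_local => x0 Ux.
have [chi [K [sc cK KU chix chi0]]] := bump_manifold oU Ux.
(* On W the power of chi brought in by cutting off all the arguments can be divided out. *)
set W := U `&` [set x | chi x != 0].
have oW : open W by apply: open_smooth_neq0 => //; exact: smooth_on_sub sc.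
exists W; split=> //.
pose qs := [seq toA (scale_sect chi s) | s <- ps].
pose ws := [seq toSFs (fun x => chi x *: v x) | v <- vs].
have Eq y : evA qs y = [seq chi y *: a | a <- evs ps y].
  rewrite /qs; elim: ps sp {qs} => [//|s ps IH] sp /=.
  rewrite IH => [|i lt]; last exact: (sp i.+1).
  rewrite -[X in X :: _]/(valA (toA (scale_sect chi s)) y) toAE//.
  exact: (smooth_sect_cutoff oU sc cK KU chi0 (sp 0%N _)).
have Ew y : evF ws y = [seq chi y *: a | a <- evsF vs y].
  rewrite /ws; elim: vs sv {ws} => [//|s vs IH] sv /=.
  rewrite IH => [|i lt]; last exact: (sv i.+1).
  rewrite -[X in X :: _]/(valF (toSFs (fun x => chi x *: s x)) y) toSFsE//.
  exact: (smooth_sectF_cutoff oU sc cK KU chi0 (sv 0%N _)).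
apply: (smooth_on_ext (f := fun y => (chi y)^-1 ^+ (size ps + size vs) * G qs ws y) oW).
  move=> y [_ cy]; rewrite -(unsecP tG (Eq y) (Ew y)).
  rewrite (multilinear_scale _ (unsec_multilinear tG))// !size_map mulrA -exprMn.
  by rewrite mulVf// expr1n mul1r.
apply: (smooth_on_mul oW).
  apply: (smooth_on_exp _ oW); apply: (smooth_on_inv oW) => [y []//|].
  exact: smooth_on_sub sc.
by apply: smooth_on_sub (smoothfunP (G qs ws)).
Qed.

Lemma unsec_cochain G : acochain G -> cochain (unsec G).
Proof.
move=> [tG [N GN]]; split.
- exact: unsec_multilinear.
- by move=> x a s1 s2 s3 vs; rewrite /unsec !(map_cat, map_cons) tens_alternating.
- move=> x ps; apply: (perm_swap_invariant (f := unsec G (x := x) ps)) => s1 v w s2.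
  by rewrite /unsec !(map_cat, map_cons) tens_sym.
- exact: unsec_smooth.
- by exists N; exact: (unsec_concentrated GN).
Qed.

Lemma sec_unsec G : acochain G -> sec (unsec G) = G.
Proof.
move=> aG; have [tG _] := aG; apply: formP => ps vs; apply: smoothfun_eq => x.
by rewrite secE ?unsecE//; case: (unsec_cochain aG).
Qed.

Lemma unsec_sec g : cochain g -> unsec (sec g) = g.
Proof.
move=> cg; apply: cform_eq => x ps vs; rewrite unsecE; last exact: sec_tens.
by rewrite secE//; case: cg.
Qed.

Lemma sf_sum (I : Type) (r : seq I) (F : I -> C) x :
  (\sum_(i <- r) F i) x = \sum_(i <- r) F i x.
Proof. by elim: r => [|i r IH]; rewrite ?big_nil// !big_cons sfD IH. Qed.

Lemma sf_sign m x : ((-1) ^+ m : C) x = (-1) ^+ m.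
Proof. by elim: m => [//|m IH]; rewrite !exprS sfM IH. Qed.

Lemma unsec_mul G H : unsec (fmul G H) = form_mul (unsec G) (unsec H).
Proof.
apply: functional_extensionality_dep => x; apply/funext => ps; apply/funext => vs.
rewrite /unsec /fmul /form_mul !unshuffles_map big_map sf_sum.
apply: eq_bigr => u _; rewrite big_map sf_sum; apply: eq_bigr => w _.
by rewrite !sfM sf_sign.
Qed.

Lemma unsec_add G H : unsec (G + H) = form_add (unsec G) (unsec H).
Proof. by []. Qed.

Lemma unsec_scale (a : R) G : unsec (fscale (cstC a) G) = form_scale a (unsec G).
Proof. by []. Qed.

Lemma unsec_lin (a : R) g1 g2 : cochain g1 -> cochain g2 ->
  form_add (form_scale a g1) g2 = unsec (fscale (cstC a) (sec g1) + sec g2).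
Proof. by move=> c1 c2; rewrite unsec_add unsec_scale !unsec_sec. Qed.

Lemma acochain_scale c G : acochain G -> acochain (fscale c G).
Proof.
move=> [tG [N GN]]; split; first exact: tens_scale.
by exists N => ps vs lt; rewrite /fscale GN// mulr0.
Qed.

Lemma sec_lin (a : R) g1 g2 : cochain g1 -> cochain g2 ->
  sec (form_add (form_scale a g1) g2) = fscale (cstC a) (sec g1) + sec g2.
Proof.
move=> c1 c2; rewrite unsec_lin// sec_unsec//; apply: acochain_add.
  by apply: acochain_scale; exact: sec_acochain.
exact: sec_acochain.
Qed.

Lemma sec_mul g1 g2 : cochain g1 -> cochain g2 ->
  sec (form_mul g1 g2) = fmul (sec g1) (sec g2).
Proof.
move=> c1 c2; rewrite -{1}(unsec_sec c1) -{1}(unsec_sec c2) -unsec_mul sec_unsec//.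
by apply: acochain_mul; exact: sec_acochain.
Qed.

Lemma unsec_genfun (c : C) : unsec (genfun c) = gen_fun c.
Proof.
by apply: functional_extensionality_dep => x; apply/funext => -[|a ps]; apply/funext => -[].
Qed.

Lemma unsec_genA (th : SA -> C) : unsec (genA th) = gen_A (fun x a => th (extA a) x).
Proof.
apply: functional_extensionality_dep => x; apply/funext => -[|a [|b ps]];
  by apply/funext => -[].
Qed.

Lemma unsec_genF (be : SF -> C) : unsec (genF be) = gen_F (fun x v => be (extF v) x).
Proof.
apply: functional_extensionality_dep => x; apply/funext => -[|a ps];
  by apply/funext => -[|b [|? ?]].
Qed.

Lemma Clin_dual_sect (th : SA -> C) : Clin th -> dual_sect (fun x (a : A x) => th (extA a) x).
Proof.
move=> thl; have [[lA _] _ _ sm _] := unsec_cochain (bihom_acochain (bihom_genA SF thl)).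
rewrite unsec_genA in lA sm; split.
  by move=> x k a b; exact: (lA x k a b [::] [::] [::]).
by move=> U psi oU sp; apply: (sm U [:: psi] [::] oU) => -[].
Qed.

Lemma Clin_dual_sectF (be : SF -> C) : Clin be ->
  dual_sectF (fun x (v : kerF A x) => be (extF v) x).
Proof.
move=> bel; have [[_ lF] _ _ sm _] := unsec_cochain (bihom_acochain (bihom_genF SA bel)).
rewrite unsec_genF in lF sm; split.
  by move=> x k a b; exact: (lF x k a b [::] [::] [::]).
by move=> U psi oU sp; apply: (sm U [::] [:: psi] oU) => -[].
Qed.

Lemma dual_sect_Clin (al : forall x, A x -> R) : dual_sect al ->
  exists th : SA -> C, [/\ Clin th, forall (s : SA) x, th s x = al x (s x) &
    gen_A al = unsec (genA th)].
Proof.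
move=> [l sm]; pose th (s : SA) : C := mksf (sm setT s openT (ss_valP s)).
exists th; split=> //.
  by move=> c a b; apply: smoothfun_eq => x; exact: l.
rewrite unsec_genA; congr gen_A; apply: functional_extensionality_dep => x.
by apply/funext => a; rewrite /th /= extAE.
Qed.

Lemma dual_sectF_Clin (be : forall x, kerF A x -> R) : dual_sectF be ->
  exists th : SF -> C, [/\ Clin th, forall (s : SF) x, th s x = be x (s x) &
    gen_F be = unsec (genF th)].
Proof.
move=> [l sm]; pose th (s : SF) : C := mksf (sm setT s openT (ss_valP s)).
exists th; split=> //.
  by move=> c a b; apply: smoothfun_eq => x; exact: l.
rewrite unsec_genF; congr gen_F; apply: functional_extensionality_dep => x.
by apply/funext => a; rewrite /th /= extFE.
Qed.

Lemma cochain_lin (a : R) g1 g2 : cochain g1 -> cochain g2 ->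
  cochain (form_add (form_scale a g1) g2).
Proof.
move=> c1 c2; rewrite unsec_lin//; apply: unsec_cochain; apply: acochain_add.
  by apply: acochain_scale; exact: sec_acochain.
exact: sec_acochain.
Qed.

Lemma cochain_mul g1 g2 : cochain g1 -> cochain g2 -> cochain (form_mul g1 g2).
Proof.
move=> c1 c2; rewrite -(unsec_sec c1) -(unsec_sec c2) -unsec_mul; apply: unsec_cochain.
by apply: acochain_mul; exact: sec_acochain.
Qed.

(** * Transport to cochains, and identification of D, J^ and delta^ *)

Local Notation L := (alrA A).

Lemma rho_const_cst (a : R) : rho_const L (cstC a).
Proof.
by move=> s; apply: smoothfun_eq => x; rewrite [LHS]/(vder _ _) /vder diff_cst.
Qed.

Record odd_op (T : form -> form) : Prop := OddOp {
  oo_der : is_der (rho_const L) true T;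
  oo_tens : forall G, tens G -> tens (T G);
  oo_supp : forall (P Q : pred nat) G, (forall m, P m -> Q m.+1) ->
    supported P G -> supported Q (T G) }.

Lemma odd_op_Dop : odd_op (Dop L).
Proof.
by split; [exact: Dop_der|move=> G; exact: tens_Dop|move=> P Q G; exact: supported_Dop].
Qed.
Lemma odd_op_hatJ : odd_op (hatJop L).
Proof.
by split; [exact: hatJop_der|move=> G; exact: tens_hatJ|move=> P Q G; exact: supported_hatJ].
Qed.
Lemma odd_op_delta : odd_op (deltaop L).
Proof.
by split; [exact: delta_der|move=> G; exact: tens_delta|move=> P Q G; exact: supported_delta].
Qed.
Lemma odd_op_dop : odd_op (dop L).
Proof.
by split; [exact: dop_der|move=> G; exact: tens_dop|move=> P Q G; exact: supported_dop].
Qed.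

Lemma acochain_op T G : odd_op T -> acochain G -> acochain (T G).
Proof.
move=> [_ Tt Ts] [tG [N GN]]; split; first exact: Tt.
by exists N.+1; exact: Ts GN.
Qed.

Lemma odd_derivative_op T : odd_op T -> odd_derivative (fun g => unsec (T (sec g))).
Proof.
move=> oT; have [[TD TZ Tb TM] _ Ts] := oT.
have aT g : cochain g -> acochain (T (sec g)).
  by move=> cg; apply: acochain_op => //; exact: sec_acochain.
split=> [k g [cg gk]|a g1 g2 c1 c2|k g1 g2 [c1 g1k] c2].
- split; first by apply: unsec_cochain; exact: aT.
  apply: (unsec_concentrated (P := pred1 k.+1)).
  apply: (Ts (pred1 k)) => [m /= /eqP ->//|]; apply: sec_supported => //.
  by case: cg.
- by rewrite sec_lin// TD TZ//; exact: rho_const_cst.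
(* On a form of degree k = p + 2q the sign (-1)^p of [bar] is the constant (-1)^k. *)
- have E : bar (sec g1) = fscale (cstC ((-1) ^+ k)) (sec g1).
    apply: formP => ps vs; rewrite /bar /fscale.
    have [sk|nk] := eqVneq (size ps + 2 * size vs)%N k; last first.
      rewrite (sec_supported (P := pred1 k) _ g1k) ?mulr0//.
      by case: c1.
    congr (_ * _); apply: smoothfun_eq => x; rewrite sf_sign cstCE -sk exprD mulnC exprM.
    by rewrite sqrr_sign mulr1.
  rewrite sec_mul// TM /= E fmulZl unsec_add unsec_scale !unsec_mul !unsec_sec//.
Qed.

Lemma unsec0 : unsec 0 = @form0 _ _ _ A.
Proof. by []. Qed.

Lemma unsec_add1 G H :
  unsec (G + H) = form_add (form_scale 1 (unsec G)) (unsec H).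
Proof.
apply: functional_extensionality_dep => x; apply/funext => ps; apply/funext => vs.
by rewrite /form_add /form_scale mul1r.
Qed.

(** [odd_derivative] guarantees cochain values on homogeneous arguments only, so G is split into its
    components and linearity is used. *)
Lemma odd_derivative_cochain (X : cform A -> cform A) G : odd_derivative X ->
  acochain G -> cochain (X (unsec G)).
Proof.
move=> [Xd Xl _] aG; have [tG [N GN]] := aG.
have u0 : cochain (unsec 0) := unsec_cochain (acochain0 SA SF).
have X0 : cochain (X (unsec 0)).
  by case: (Xd 0%N (unsec 0)) => //; split.
have Xsum (I : Type) (r : seq I) (F : I -> form) :
    (forall i, acochain (F i) /\ cochain (X (unsec (F i)))) ->
    acochain (\sum_(i <- r) F i) /\ cochain (X (unsec (\sum_(i <- r) F i))).
  move=> FX; elim: r => [|i r [IH1 IH2]].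
    by rewrite big_nil; split=> //; exact: acochain0.
  rewrite big_cons; have [F1 F2] := FX i; split; first exact: acochain_add.
  have -> : unsec (F i + \sum_(j <- r) F j) =
      form_add (form_scale 1 (unsec (F i))) (unsec (\sum_(j <- r) F j)).
    exact: unsec_add1.
  rewrite Xl; [|exact: unsec_cochain|exact: unsec_cochain].
  exact: cochain_lin.
rewrite (component_sum GN); case: (Xsum _ (index_enum 'I_N.+1)
  (fun p => \sum_(q < N.+1) component p q G)) => // p; apply: Xsum => q.
have bc := bihom_component p q tG; split; first exact: bihom_acochain bc.
case: (Xd (p + 2 * q)%N (unsec (component p q G))) => //; split.
  by apply: unsec_cochain; exact: bihom_acochain bc.
exact: (unsec_concentrated (P := pred1 (p + 2 * q)%N) (bihom_supported bc)).
Qed.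

Lemma aderivation_odd (X : cform A -> cform A) : odd_derivative X ->
  aderivation (fun G => sec (X (unsec G))).
Proof.
move=> oX; have cX G : acochain G -> cochain (X (unsec G)) by exact: odd_derivative_cochain.
have [_ Xl Xm] := oX; split=> [G H aG aH|p q G H bG aH].
  (* Linearity of X is stated for a g1 + g2, so additivity is the case a = 1. *)
  have -> : unsec (G + H) = form_add (form_scale 1 (unsec G)) (unsec H).
    exact: unsec_add1.
  rewrite Xl; try exact: unsec_cochain.
  rewrite sec_lin; try exact: cX.
  by rewrite (_ : cstC 1 = 1) ?fscale1//; exact: smoothfun_eq.
have aG := bihom_acochain bG.
rewrite unsec_mul (Xm (p + 2 * q)%N); last exact: unsec_cochain; last first.
  split; first exact: unsec_cochain.
  exact: (unsec_concentrated (P := pred1 (p + 2 * q)%N) (bihom_supported bG)).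
have -> : (-1) ^+ (p + 2 * q) = (-1) ^+ p :> R.
  by rewrite exprD exprM sqrrN expr1n expr1n mulr1.
have Z1 g : form_scale 1 g = g.
  apply: functional_extensionality_dep => x; apply/funext => ps; apply/funext => vs.
  exact: mul1r.
have addC g h : form_add g h = form_add h g.
  apply: functional_extensionality_dep => x; apply/funext => ps; apply/funext => vs.
  exact: addrC.
rewrite addC sec_lin; try by apply: cochain_mul;
  first [exact: cX | exact: unsec_cochain].
rewrite !sec_mul; try (first [exact: cX | exact: unsec_cochain]).
rewrite !sec_unsec// addrC; congr (_ + fscale _ _).
by apply: smoothfun_eq => x; rewrite sf_sign cstCE.
Qed.

Lemma odd_derivative_eq (X Y : cform A -> cform A) :
  odd_derivative X -> odd_derivative Y ->
  (forall f, smooth f -> X (gen_fun f) = @form0 _ _ _ A) ->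
  (forall f, smooth f -> Y (gen_fun f) = @form0 _ _ _ A) ->
  (forall al, dual_sect al -> X (gen_A al) = Y (gen_A al)) ->
  (forall be, dual_sectF be -> X (gen_F be) = Y (gen_F be)) ->
  forall g, cochain g -> X g = Y g.
Proof.
move=> oX oY X0 Y0 XA XF g cg; have ag := sec_acochain cg.
rewrite -(unsec_sec cg) -(unsec_sec (odd_derivative_cochain oX ag)).
rewrite -[RHS](unsec_sec (odd_derivative_cochain oY ag)); congr unsec.
have s0 : sec (@form0 _ _ _ A) = 0 by rewrite -unsec0 sec_unsec//; exact: acochain0.
apply: (aderivation_eq (fun x => (bM x).1) (fun x => (bM x).2)
  chiM0 charC (aderivation_odd oX) (aderivation_odd oY)) => //.
- by move=> c; rewrite unsec_genfun X0//; exact: smoothfunP.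
- by move=> c; rewrite unsec_genfun Y0//; exact: smoothfunP.
- by move=> th thl; rewrite unsec_genA XA//; exact: Clin_dual_sect.
- by move=> be bel; rewrite unsec_genF XF//; exact: Clin_dual_sectF.
Qed.

Lemma gen_fun_acochain f (sf : smooth f) : gen_fun f = unsec (genfun (mksf sf)).
Proof. by rewrite unsec_genfun. Qed.

Lemma is_hatdelta_op : is_hatdelta (fun g : cform A => unsec (deltaop L (sec g))).
Proof.
split; first exact: odd_derivative_op odd_op_delta.
- move=> f sf; rewrite (gen_fun_acochain sf) sec_unsec.
    by rewrite delta_genfun.
  by apply: bihom_acochain; exact: bihom_genfun.
- move=> al dal; have [th [thl thE ->]] := dual_sect_Clin dal.
  rewrite sec_unsec; last by apply: bihom_acochain; exact: bihom_genA.
  rewrite delta_genA unsec_genF; congr gen_F; apply: functional_extensionality_dep => x.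
  by apply/funext => v; rewrite thE /t_dual -{2}(extFE v).
- move=> be dbe; have [th [thl thE ->]] := dual_sectF_Clin dbe.
  rewrite sec_unsec; last by apply: bihom_acochain; exact: bihom_genF.
  by rewrite delta_genF.
Qed.

(** The element selected by [the] is constrained on cochains only; there uniqueness of derivations
    with given values on generators identifies it. *)
Lemma hatdeltaE g : cochain g -> hatdelta g = unsec (deltaop L (sec g)).
Proof.
have [oX X0 XA XF] : is_hatdelta (@hatdelta _ _ _ A).
  by apply: the_spec; eexists; exact: is_hatdelta_op.
have [oY Y0 YA YF] := is_hatdelta_op.
apply: (odd_derivative_eq oX oY X0 Y0) => [al dal|be dbe].
  by rewrite XA// YA.
by rewrite XF// YF.
Qed.

Lemma is_hatJ_op : is_hatJ (fun g : cform A => unsec (hatJop L (sec g))).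
Proof.
split; first exact: odd_derivative_op odd_op_hatJ.
- move=> f sf; rewrite (gen_fun_acochain sf) sec_unsec.
    by rewrite hatJ_genfun.
  by apply: bihom_acochain; exact: bihom_genfun.
- move=> al dal; have [th [thl thE ->]] := dual_sect_Clin dal.
  rewrite sec_unsec; last by apply: bihom_acochain; exact: bihom_genA.
  by rewrite hatJ_genA.
- move=> be dbe; have [th [thl thE ->]] := dual_sectF_Clin dbe.
  have bF := bihom_genF SA thl; have aF := bihom_acochain bF.
  rewrite sec_unsec//; have [_ Jt Js] := odd_op_hatJ; split.
    (* Degree 3 also allows the bidegree (1, 1), which is excluded because J^ vanishes on fewer than
       three arguments in A. *)
    have s3 : supported (pred1 3) (hatJop L (genF th)).
      by apply: (Js (pred1 2) _ _ _ (bihom_supported bF)) => m /= /eqP ->.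
    have c3 := unsec_concentrated (P := pred1 3) s3.
    move=> x ps vs np; have [lt|ge] := ltnP (size ps) 3.
      by rewrite /unsec hatJ_low// size_map.
    apply: c3; apply: contra np => /= /eqP E; apply/andP; split; apply/eqP; lia.
  move=> phi psi chi x s1 s2 s3.
  apply: (etrans (unsecE [:: mkA s1; mkA s2; mkA s3] [::] x (Jt _ aF.1))).
  rewrite -[hatJop _ _ _ _]/(insA (mkA s2)
    (insA (mkA s1) (hatJop L (genF th))) [:: mkA s3] [::]).
  by rewrite insA_hatJ_genF insA_hatJ2_genF /genA thE.
Qed.

Lemma pairing_J_unique be (g h : cform A) : is_pairing_J be g -> is_pairing_J be h -> g = h.
Proof.
move=> [g3 gJ] [h3 hJ]; apply: cform_eq => x ps vs.
have [|np] := boolP ((size (evA ps x) == 3) && (size (evF vs x) == 0))%N; last first.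
  by rewrite g3// h3.
rewrite !size_map => /andP[]; case: ps => [|a [|b [|d [|]]]]//= _; case: vs => //= _.
by rewrite (gJ a b d x (ss_valP a) (ss_valP b) (ss_valP d))
  (hJ a b d x (ss_valP a) (ss_valP b) (ss_valP d)).
Qed.

Lemma hatJE g : cochain g -> hatJ g = unsec (hatJop L (sec g)).
Proof.
have [oX X0 XA XF] : is_hatJ (@hatJ _ _ _ A).
  by apply: the_spec; eexists; exact: is_hatJ_op.
have [oY Y0 YA YF] := is_hatJ_op.
apply: (odd_derivative_eq oX oY X0 Y0) => [al dal|be dbe].
  by rewrite XA// YA.
exact: pairing_J_unique (XF _ dbe) (YF _ dbe).
Qed.

Lemma map_rem_at (T U : Type) (f : T -> U) i s : map f (rem_at i s) = rem_at i (map f s).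
Proof. by rewrite /rem_at map_cat map_take map_drop. Qed.

Lemma map_set_nth_valF vs j (v : SF) : (j < size vs)%N ->
  map valF (set_nth 0 vs j v) = set_nth (fun=> 0) (map valF vs) j v.
Proof. by elim: vs j => [//|w vs IH] [|j] //= lt; rewrite IH. Qed.

Lemma nablaS_sec g (a : SA) ps vs x : cochain g ->
  nablaS a (fun y => g y (evs (map valA ps) y)) (map valF vs) x =
  Dcov L a (sec g) ps vs x.
Proof.
case=> _ _ _ sg _; rewrite /nablaS /Dcov [RHS]sfD sfN sf_sum size_map.
apply: (f_equal2 (fun u v : R => u - v)).
  rewrite [RHS]/(vder _ _) /rho_der; congr (vder _ _).
  by apply/funext => y; rewrite evs_valA evsF_valF secE.
apply: eq_bigr => j _; rewrite nth_valF.
rewrite -[nabla _ _]/(valF (nab L a (nth 0 vs j))) -map_set_nth_valF//.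
by rewrite evs_valA evsF_valF secE.
Qed.

Lemma D_formula_sec g ps vs x : cochain g ->
  D_formula g (map valA ps) (map valF vs) x =
  Dform L (sec g) ps vs x.
Proof.
move=> cg; have [_ _ _ sg _] := cg.
rewrite /D_formula /Dform [RHS]sfD !sf_sum size_map; congr (_ + _).
  apply: eq_bigr => i _; rewrite sfM sf_sign -map_rem_at nth_valA.
  by rewrite nablaS_sec.
apply: eq_bigr => j _; rewrite sf_sum; apply: eq_bigr => i _.
rewrite sfM sf_sign !nth_valA -!map_rem_at.
rewrite -[br _ _]/(valA (lbr L (nth 0 ps i) (nth 0 ps j))) -map_cons.
by rewrite evs_valA evsF_valF secE.
Qed.

(** All vectors at a point extend to smooth sections, so the formula for D determines every value.
    Existence is the tensoriality of [Dop], which makes the formula independent of the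
    extensions. *)
Lemma DE g : cochain g -> D g = unsec (Dop L (sec g)).
Proof.
move=> cg; have tg := sec_tens cg; have sD : acochain (Dop L (sec g)).
  by apply: (acochain_op odd_op_Dop); exact: sec_acochain.
have E ps vs x : unsec (Dop L (sec g)) (evA ps x) (evF vs x) =
    D_formula g (map valA ps) (map valF vs) x.
  by rewrite D_formula_sec// DformE// unsecE//; case: sD.
apply: the_eq => [|h [_ hD]].
  split; first exact: unsec_cochain.
  move=> ps vs x sp sv; rewrite -(map_toAK sp) -(map_toSFsK sv).
  by rewrite -E evs_valA evsF_valF.
apply: cform_eq => x ps vs; rewrite E -evs_valA -evsF_valF; apply: hD => i _.
  exact: smooth_valA.
exact: smooth_valF.
Qed.

Lemma ddE g : cochain g -> dd g = unsec (dop L (sec g)).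
Proof.
move=> cg; rewrite /dd (DE cg) (hatJE cg) (hatdeltaE cg) /dop.
rewrite (unsec_add (Dop L (sec g) + hatJop L (sec g)) (deltaop L (sec g))).
by rewrite (unsec_add (Dop L (sec g)) (hatJop L (sec g))).
Qed.

End Cochains.

Theorem theorem4p6 (R : realType) (n : nat) (M : manifold R n)
    (A : almost_Lie_algebroid M) (hreg : regular A) :
  [/\ forall (k : nat) (g : cform A), cochain_deg k g -> cochain_deg k.+1 (dd g),
      forall (k : nat) (g1 g2 : cform A), cochain_deg k g1 -> cochain g2 ->
        dd (form_mul g1 g2) =
        form_add (form_mul (dd g1) g2)
                 (form_scale ((-1) ^+ k) (form_mul g1 (dd g2))) &
      forall g : cform A, cochain g -> dd (dd g) = @form0 R n M A].
Proof.
have [dk _ dM] := odd_derivative_op hreg (odd_op_dop A).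
split=> [k g gk|k g1 g2 g1k c2|g cg].
- by rewrite (ddE hreg); [exact: dk|case: gk].
- have c1 := g1k.1; rewrite !(ddE hreg)//; first exact: dM.
  exact: (cochain_mul hreg).
(* To apply [ddE] twice, dd g must itself be a cochain; [sec] then undoes [unsec] between the two
   applications. *)
- have aG := acochain_op (odd_op_dop A) (sec_acochain cg).
  rewrite (ddE hreg cg) (ddE hreg); last exact: unsec_cochain.
  rewrite sec_unsec// (dop2_eq0 (alrA A) (fun x => (bM hreg x).1) (fun x => (bM hreg x).2))//.
  - exact: chiM0.
  - exact: charC.
  - exact: sec_acochain.
Qed.
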